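(* Let $A$ be a $\sigma$-unital $C^*$-algebra, let $G$ be a second-countable compact group, and let $\alpha\colon G\to\mathrm{Aut}(A)$ be an action with the Rokhlin property. Given a compact subset $F_1\subseteq A$, a compact subset $F_2\subseteq A^\alpha$ and $\varepsilon>0$, there exists a completely positive contractive map $\psi\colon A\to A^\alpha$ such that (1) for all $a,b\in F_1$, we have $\|\psi(ab)-\psi(a)\psi(b)\|<\varepsilon$; (2) for all $a\in F_2$, we have $\|\psi(a)-a\|<\varepsilon$. Moreover, if $A$ is unital, then $\psi$ can be chosen so that $\psi(1)=1$. In particular, when $A$ is separable, there exists a sequence $(\psi_n)_{n\in\mathbb{N}}$ of completely positive contractive linear maps $\psi_n\colon A\to A^\alpha$, which can be arranged to be unital if $A$ is, such that $\lim_{n\to\infty}\|\psi_n(ab)-\psi_n(a)\psi_n(b)\|=0$ for all $a,b\in A$ and $\lim_{n\to\infty}\|\psi_n(a)-a\|=0$ for all $a\in A^\alpha$.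
   Context: Conventions: homomorphisms between $C^*$-algebras are $*$-homomorphisms, subalgebras are $C^*$-subalgebras; actions on $C^*$-algebras are point-norm continuous; $A^\alpha=\{a\in A:\alpha_g(a)=a\ \forall g\in G\}$ is the fixed point algebra. Sequence algebras: for a $C^*$-algebra $A$, let $\ell^\infty(\mathbb{N},A)$ be the $C^*$-algebra of bounded sequences in $A$, $c_0(\mathbb{N},A)$ the ideal of norm-null sequences, $A_\infty=\ell^\infty(\mathbb{N},A)/c_0(\mathbb{N},A)$ with quotient map $\eta_A$; $A$ sits in $A_\infty$ as constant sequences. For a subalgebra $D\subseteq A$, let $\mathrm{Ann}(D,A_\infty)$ be the annihilator of $D$ in $A_\infty$, an ideal of $A_\infty\cap D'$, let $F(D,A)=(A_\infty\cap D')/\mathrm{Ann}(D,A_\infty)$ and let $\kappa_{D,A}$ be the quotient map. If $\alpha\colon G\to\mathrm{Aut}(A)$ is an action and $D$ is $\alpha$-invariant, entrywise application of $\alpha$ gives actions (not necessarily continuous) $\alpha^\infty$ on $\ell^\infty(\mathbb{N},A)$, $\alpha_\infty$ on $A_\infty$ and on $A_\infty\cap D'$, and $F(\alpha)$ on $F(D,A)$. Let $\ell^\infty_\alpha(\mathbb{N},A)$ be the set of $a\in\ell^\infty(\mathbb{N},A)$ with $g\mapsto\alpha^\infty_g(a)$ norm continuous, $A_{\infty,\alpha}=\eta_A(\ell^\infty_\alpha(\mathbb{N},A))$ and $F_\alpha(D,A)=\kappa_{D,A}(A_{\infty,\alpha}\cap D')$. Rokhlin property: an action $\alpha\colon G\to\mathrm{Aut}(A)$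 of a second-countable compact group $G$ on a $\sigma$-unital $C^*$-algebra $A$ has the Rokhlin property if for every separable $\alpha$-invariant subalgebra $D\subseteq A$ there is an equivariant unital homomorphism $\varphi\colon(C(G),\mathtt{Lt})\to(F_\alpha(D,A),F(\alpha))$, where $\mathtt{Lt}$ is the action of $G$ on $C(G)$ induced by left translation. *)

(* Defs.v *)
From HB Require Import structures.
From mathcomp Require Import all_boot all_order all_algebra.
From mathcomp Require Import generic_quotient ring_quotient.
From mathcomp Require Import complex.
From mathcomp Require Import all_classical all_reals all_analysis.

Set Implicit Arguments.
Unset Strict Implicit.
Unset Printing Implicit Defensive.

Import Order.TTheory GRing.Theory Num.Theory.
Import numFieldNormedType.Exports.

Local Open Scope classical_set_scope.
Local Open Scope ring_scope.
Local Open Scope complex_scope.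

Reserved Notation "x ** y" (at level 40, left associativity).

(* MathComp rings are unital, so the possibly non-unital product of a
   *-algebra is a separate operation. *)
HB.mixin Record Lmodule_isStarAlgebra (C : numClosedFieldType) A
    of GRing.Lmodule C A := {
  smul : A -> A -> A ;
  star : A -> A ;
  smulA : associative smul ;
  smulDl : left_distributive smul +%R ;
  smulDr : right_distributive smul +%R ;
  smulZl : forall (c : C) (a b : A), smul (c *: a) b = c *: smul a b ;
  smulZr : forall (c : C) (a b : A), smul a (c *: b) = c *: smul a b ;
  starK : involutive star ;
  starD : {morph star : a b / a + b} ;
  starZ : forall (c : C) (a : A), star (c *: a) = (Num.conj c) *: star a ;
  starM : forall a b : A, star (smul a b) = smul (star b) (star a)
}.

#[short(type="starAlgType")]
HB.structure Definition StarAlgebra (C : numClosedFieldType) :=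
  {A of GRing.Lmodule C A & Lmodule_isStarAlgebra C A}.

Notation "x ** y" := (smul x y) : ring_scope.

HB.mixin Record isCStarAlgebra (R : realType) A
    of StarAlgebra R[i] A & CompleteNormedModule R[i] A := {
  normsM : forall a b : A, `|a ** b| <= `|a| * `|b| ;
  cstar_identity : forall a : A, `|star a ** a| = `|a| ^+ 2
}.

#[short(type="cstarAlgType")]
HB.structure Definition CStarAlgebra (R : realType) :=
  {A of StarAlgebra R[i] A & CompleteNormedModule R[i] A & isCStarAlgebra R A}.

Section StarAlgebraTheory.
Context {C : numClosedFieldType} {A : starAlgType C}.
Implicit Types a b : A.

Lemma smul0l a : 0 ** a = 0.
Proof. by rewrite -(scale0r a) smulZl !scale0r. Qed.

Lemma smul0r a : a ** 0 = 0.
Proof. by rewrite -(scale0r a) smulZr !scale0r. Qed.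

Lemma smulNl a b : (- a) ** b = - (a ** b).
Proof. by rewrite -scaleN1r smulZl scaleN1r. Qed.

Lemma smulNr a b : a ** (- b) = - (a ** b).
Proof. by rewrite -scaleN1r smulZr scaleN1r. Qed.

Lemma star0 : star (0 : A) = 0.
Proof. by rewrite -(scale0r (0 : A)) starZ rmorph0 !scale0r. Qed.

Lemma starN a : star (- a) = - star a.
Proof. by rewrite -scaleN1r starZ rmorphN1 scaleN1r. Qed.

End StarAlgebraTheory.

Definition star_hom (C : numClosedFieldType) (A B : starAlgType C)
    (f : A -> B) : Prop :=
  [/\ linear f, {morph f : a b / a ** b} & {morph f : a / star a}].

Definition is_unity (C : numClosedFieldType) (A : starAlgType C) (u : A) :=
  forall a : A, u ** a = a /\ a ** u = a.

Record starSubalg (C : numClosedFieldType) (A : starAlgType C) := StarSubalg {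
  subalg_pred :> {pred A} ;
  subalg_submod : submod_closed subalg_pred ;
  subalgM : {in subalg_pred &, forall a b, a ** b \in subalg_pred} ;
  subalgS : {in subalg_pred, forall a, star a \in subalg_pred}
}.

HB.instance Definition _ (C : numClosedFieldType) (A : starAlgType C)
  (S : starSubalg A) :=
  GRing.isSubmodClosed.Build C A (subalg_pred S) (subalg_submod S).

Record starIdeal (C : numClosedFieldType) (A : starAlgType C) := StarIdeal {
  ideal_pred :> {pred A} ;
  ideal_submod : submod_closed ideal_pred ;
  idealMl : forall a b, b \in ideal_pred -> a ** b \in ideal_pred ;
  idealMr : forall a b, a \in ideal_pred -> a ** b \in ideal_pred ;
  idealS : {in ideal_pred, forall a, star a \in ideal_pred}
}.

HB.instance Definition _ (C : numClosedFieldType) (A : starAlgType C)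
  (I : starIdeal A) :=
  GRing.isSubmodClosed.Build C A (ideal_pred I) (ideal_submod I).

Section SubStarAlgebra.
Context {C : numClosedFieldType} {A : starAlgType C}.
Variable S : starSubalg A.

Record sub_star := SubStar { sub_star_val :> A ; _ : sub_star_val \in S }.

HB.instance Definition _ := [isSub for sub_star_val].
HB.instance Definition _ := [Choice of sub_star by <:].
HB.instance Definition _ := [SubChoice_isSubLmodule of sub_star by <:].

Let mul (x y : sub_star) : sub_star :=
  SubStar (subalgM (valP x) (valP y)).
Let inv (x : sub_star) : sub_star := SubStar (subalgS (valP x)).

Let mulA : associative mul.
Proof. by move=> x y z; apply: val_inj; exact: smulA. Qed.
Let mulDl : left_distributive mul +%R.
Proof. by move=> x y z; apply: val_inj; exact: smulDl. Qed.
Let mulDr : right_distributive mul +%R.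
Proof. by move=> x y z; apply: val_inj; exact: smulDr. Qed.
Let mulZl c x y : mul (c *: x) y = c *: mul x y.
Proof. by apply: val_inj; exact: smulZl. Qed.
Let mulZr c x y : mul x (c *: y) = c *: mul x y.
Proof. by apply: val_inj; exact: smulZr. Qed.
Let invK : involutive inv.
Proof. by move=> x; apply: val_inj; exact: starK. Qed.
Let invD : {morph inv : x y / x + y}.
Proof. by move=> x y; apply: val_inj; exact: starD. Qed.
Let invZ c x : inv (c *: x) = (Num.conj c) *: inv x.
Proof. by apply: val_inj; exact: starZ. Qed.
Let invM x y : inv (mul x y) = mul (inv y) (inv x).
Proof. by apply: val_inj; exact: starM. Qed.

HB.instance Definition _ := Lmodule_isStarAlgebra.Build C sub_star
  mulA mulDl mulDr mulZl mulZr invK invD invZ invM.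

End SubStarAlgebra.

Section QuotientStarAlgebra.
Local Open Scope quotient_scope.
Context {C : numClosedFieldType} {A : starAlgType C}.
Variable I : starIdeal A.

Definition star_quot : Type := Quotient.quot (ideal_pred I).

HB.instance Definition _ := ZmodQuotient.on star_quot.

Definition quot_map (a : A) : star_quot := \pi a.

Let Q := star_quot.
Local Notation p := quot_map.

Lemma quot_mapP a b : reflect (p a = p b) (a - b \in I).
Proof. by rewrite Quotient.idealrBE; exact: eqP. Qed.

Lemma quot_reprK : cancel (repr : Q -> A) p.
Proof. exact: reprK. Qed.

Lemma quot_mapK a : repr (p a) - a \in I.
Proof. by apply/quot_mapP; rewrite quot_reprK. Qed.

Lemma quot_mapD a b : p (a + b) = p a + p b.
Proof. exact: Quotient.pi_add. Qed.

Let scale (c : C) (x : Q) : Q := p (c *: repr x).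
Let mul (x y : Q) : Q := p (repr x ** repr y).
Let inv (x : Q) : Q := p (star (repr x)).

Let scaleE c a : scale c (p a) = p (c *: a).
Proof. by apply/quot_mapP; rewrite -scalerBr rpredZ// quot_mapK. Qed.

Let mulE a b : mul (p a) (p b) = p (a ** b).
Proof.
apply/quot_mapP; set a' := repr (p a); set b' := repr (p b).
have -> : a' ** b' - a ** b = (a' - a) ** b' + a ** (b' - b).
  by rewrite smulDl smulDr smulNl smulNr addrA subrK.
by apply: rpredD; [apply: idealMr|apply: idealMl]; exact: quot_mapK.
Qed.

Let invE a : inv (p a) = p (star a).
Proof.
by apply/quot_mapP; rewrite -starN -starD; apply: idealS; exact: quot_mapK.
Qed.

Let quotW (P : Q -> Prop) : (forall a, P (p a)) -> forall x, P x.
Proof. by move=> h x; rewrite -(quot_reprK x). Qed.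

Let scaleA c d x : scale c (scale d x) = scale (c * d) x.
Proof. by elim/quotW: x => a; rewrite !scaleE scalerA. Qed.
Let scale1 : left_id 1 scale.
Proof. by elim/quotW => a; rewrite scaleE scale1r. Qed.
Let scaleDr : right_distributive scale +%R.
Proof.
move=> c; elim/quotW => a; elim/quotW => b.
by rewrite -quot_mapD !scaleE -quot_mapD scalerDr.
Qed.
Let scaleDl x : {morph scale^~ x : c d / c + d}.
Proof.
by elim/quotW: x => a c d; rewrite !scaleE -quot_mapD scalerDl.
Qed.

HB.instance Definition _ := GRing.Zmodule_isLmodule.Build C star_quot
  scaleA scale1 scaleDr scaleDl.

Lemma quot_mapZ c a : p (c *: a) = c *: p a.
Proof. by rewrite -scaleE. Qed.

Let mulA : associative mul.
Proof.
elim/quotW => a; elim/quotW => b; elim/quotW => c.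
by rewrite !mulE smulA.
Qed.
Let mulDl : left_distributive mul +%R.
Proof.
elim/quotW => a; elim/quotW => b; elim/quotW => c.
by rewrite -quot_mapD !mulE -quot_mapD smulDl.
Qed.
Let mulDr : right_distributive mul +%R.
Proof.
elim/quotW => a; elim/quotW => b; elim/quotW => c.
by rewrite -quot_mapD !mulE -quot_mapD smulDr.
Qed.
Let mulZl c x y : mul (c *: x) y = c *: mul x y.
Proof.
elim/quotW: x => a; elim/quotW: y => b.
by rewrite -quot_mapZ !mulE -quot_mapZ smulZl.
Qed.
Let mulZr c x y : mul x (c *: y) = c *: mul x y.
Proof.
elim/quotW: x => a; elim/quotW: y => b.
by rewrite -quot_mapZ !mulE -quot_mapZ smulZr.
Qed.
Let invK : involutive inv.
Proof. by elim/quotW => a; rewrite !invE starK. Qed.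
Let invD : {morph inv : x y / x + y}.
Proof.
elim/quotW => a; elim/quotW => b.
by rewrite -quot_mapD !invE -quot_mapD starD.
Qed.
Let invZ c x : inv (c *: x) = (Num.conj c) *: inv x.
Proof. by elim/quotW: x => a; rewrite -quot_mapZ !invE -quot_mapZ starZ. Qed.
Let invM x y : inv (mul x y) = mul (inv y) (inv x).
Proof.
by elim/quotW: x => a; elim/quotW: y => b; rewrite mulE !invE mulE starM.
Qed.

HB.instance Definition _ := Lmodule_isStarAlgebra.Build C star_quot
  mulA mulDl mulDr mulZl mulZr invK invD invZ invM.

Lemma quot_map_star_hom : star_hom quot_map.
Proof.
split=> [c a b|a b|a]; first by rewrite quot_mapD quot_mapZ.
- exact/esym/mulE.
- exact/esym/invE.
Qed.

End QuotientStarAlgebra.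

(* Induced maps, totalized: [sub_lift S f] restricts [f] to [S] and is zero
   where [f] leaves [S]; [quot_lift I f] evaluates [f] on a representative. The
   two lemmas below say that these are the expected maps as soon as [f]
   preserves [S], respectively descends to the quotient by [I]. *)
Section InducedMaps.
Context {C : numClosedFieldType} {A : starAlgType C}.

Definition sub_lift (S : starSubalg A) (f : A -> A) (x : sub_star S) :
  sub_star S := insubd 0 (f (val x)).

Definition quot_lift (I : starIdeal A) (f : A -> A) (x : star_quot I) :
  star_quot I := quot_map I (f (repr x)).

Lemma sub_liftE (S : starSubalg A) (f : A -> A) (x : sub_star S) :
  f (val x) \in S -> val (sub_lift f x) = f (val x).
Proof. exact: insubdK. Qed.

Lemma quot_liftE (I : starIdeal A) (f : A -> A) (a : A) :
  (forall b c, b - c \in I -> f b - f c \in I) ->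
  quot_lift f (quot_map I a) = quot_map I (f a).
Proof. by move=> fI; apply/quot_mapP/fI/quot_mapK. Qed.

End InducedMaps.

Section FunctionStarAlgebra.
Context {C : numClosedFieldType} (T : Type) (A : starAlgType C).
Implicit Types f g h : T -> A.

Let mul f g : T -> A := fun t => f t ** g t.
Let inv f : T -> A := fun t => star (f t).

Let mulA : associative mul.
Proof. by move=> f g h; apply/funext => t; exact: smulA. Qed.
Let mulDl : left_distributive mul +%R.
Proof. by move=> f g h; apply/funext => t; exact: smulDl. Qed.
Let mulDr : right_distributive mul +%R.
Proof. by move=> f g h; apply/funext => t; exact: smulDr. Qed.
Let mulZl (c : C) f g : mul (c *: f) g = c *: mul f g.
Proof. by apply/funext => t; exact: smulZl. Qed.
Let mulZr (c : C) f g : mul f (c *: g) = c *: mul f g.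
Proof. by apply/funext => t; exact: smulZr. Qed.
Let invK : involutive inv.
Proof. by move=> f; apply/funext => t; exact: starK. Qed.
Let invD : {morph inv : f g / f + g}.
Proof. by move=> f g; apply/funext => t; exact: starD. Qed.
Let invZ (c : C) f : inv (c *: f) = (Num.conj c) *: inv f.
Proof. by apply/funext => t; exact: starZ. Qed.
Let invM f g : inv (mul f g) = mul (inv g) (inv f).
Proof. by apply/funext => t; exact: starM. Qed.

HB.instance Definition _ := Lmodule_isStarAlgebra.Build C (T -> A)
  mulA mulDl mulDr mulZl mulZr invK invD invZ invM.

End FunctionStarAlgebra.

Section ScalarStarAlgebra.
Variable C : numClosedFieldType.
Let mulZl (c : C) (x y : C^o) : (c *: x) * y = c *: (x * y).
Proof. by rewrite /GRing.scale /= mulrA. Qed.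
Let mulZr (c : C) (x y : C^o) : x * (c *: y) = c *: (x * y).
Proof. by rewrite /GRing.scale /= mulrCA. Qed.
Let conjZ (c : C) (x : C^o) : 
  Num.conj (c *: x : C) = Num.conj c *: (Num.conj (x : C) : C^o).
Proof. exact: rmorphM. Qed.
Let conjMC (x y : C^o) :
  Num.conj (x * y : C) = Num.conj (y : C) * Num.conj (x : C) :> C^o.
Proof. by rewrite rmorphM mulrC. Qed.
HB.instance Definition _ := Lmodule_isStarAlgebra.Build C C^o
  (@mulrA _) (@mulrDl _) (@mulrDr _) mulZl mulZr (@conjCK C)
  (@rmorphD _ _ Num.conj) conjZ conjMC.
End ScalarStarAlgebra.

HB.mixin Record isTopologicalGroup G of Group G & Topological G := {
  mulg_continuous : continuous (fun xy : G * G => (xy.1 * xy.2)%g) ;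
  invg_continuous : continuous (fun x : G => (x^-1)%g)
}.

#[short(type="topGroupType")]
HB.structure Definition TopologicalGroup :=
  {G of Group G & Topological G & isTopologicalGroup G}.

Section ContinuousFunctions.
Variables (R : realType) (G : topologicalType).

Lemma conj_continuous (C : numClosedFieldType) :
  continuous (Num.conj : C^o -> C^o).
Proof.
move=> x; have F : Filter (nbhs (x : C^o)) by exact: nbhs_filter.
apply/cvgrPdist_lt => e e0; near=> y; rewrite -rmorphB norm_conjC; near: y.
by exists e.
Unshelve. all: by end_near. Qed.

Definition cont_pred : {pred G -> R[i]^o} :=
  [pred f | `[< continuous f >]].

Lemma cont_predP f : reflect (continuous f) (f \in cont_pred).
Proof. exact: asboolP. Qed.

Let cont_submod : submod_closed cont_pred.
Proof.
split=> [|c f g]; first by apply/cont_predP/cst_continuous.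
move=> /cont_predP cf /cont_predP cg; apply/cont_predP => x.
by apply: cvgD; [apply: cvgZr; exact: cf|exact: cg].
Qed.

Let contM : {in cont_pred &, forall f g, f ** g \in cont_pred}.
Proof.
move=> f g /cont_predP cf /cont_predP cg; apply/cont_predP => x.
by apply: cvgM; [exact: cf|exact: cg].
Qed.

Let contS : {in cont_pred, forall f, star f \in cont_pred}.
Proof.
move=> f /cont_predP cf; apply/cont_predP => x.
by apply: cvg_comp; [exact: cf|exact: conj_continuous].
Qed.

Definition cont_subalg := StarSubalg cont_submod contM contS.

Definition contFun := sub_star cont_subalg.

Let cont_cst (c : R[i]^o) : cst c \in cont_subalg.
Proof. by apply/cont_predP/cst_continuous. Qed.

Definition cont_one : contFun := SubStar (cont_cst 1).

End ContinuousFunctions.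

Section LeftTranslation.
Variables (R : realType) (G : topGroupType).

Lemma mulg_left_continuous (g : G) : continuous (fun h => (g^-1 * h)%g).
Proof.
move=> h.
apply: (@continuous_comp _ _ _ (fun h : G => ((g^-1)%g, h))
  (fun xy : G * G => (xy.1 * xy.2)%g)); last exact: mulg_continuous.
by apply: cvg_pair => //=; exact: cvg_cst.
Qed.

Let left_trans_cont (g : G) (f : contFun R G) :
  (fun h => val f (g^-1 * h)%g) \in cont_subalg R G.
Proof.
apply/cont_predP => h.
have /cont_predP cf := valP f.
by apply: cvg_comp; [exact: mulg_left_continuous|exact: cf].
Qed.

Definition left_trans (g : G) (f : contFun R G) : contFun R G :=
  SubStar (left_trans_cont g f).

End LeftTranslation.

Section CStarTheory.
Context {R : realType} {A : cstarAlgType R}.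

Lemma norm_star (a : A) : `|star a| = `|a|.
Proof.
have le (b : A) : `|b| <= `|star b|.
  have [->|b0] := eqVneq b 0; first by rewrite normr0.
  have b_gt0 : 0 < `|b| by rewrite normr_gt0.
  by rewrite -(ler_pM2r b_gt0) -expr2 -cstar_identity normsM.
by apply/eqP; rewrite eq_le le -{2}(starK a) le.
Qed.

End CStarTheory.

Section SequenceAlgebra.
Variables (R : realType) (A : cstarAlgType R).

Definition linf_pred : {pred nat -> A} :=
  [pred a | `[< exists M : R[i], forall n, `|a n| <= M >]].

Lemma linf_predP a : reflect (exists M : R[i], forall n, `|a n| <= M) (a \in linf_pred).
Proof. exact: asboolP. Qed.

Let linf_submod : submod_closed linf_pred.
Proof.
split=> [|c a b].
  by apply/linf_predP; exists 0 => n; rewrite normr0.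
move=> /linf_predP[M aM] /linf_predP[N bN]; apply/linf_predP.
exists (`|c| * M + N) => n.
apply: (le_trans (ler_normD _ _)); apply: lerD => //.
by rewrite normrZ ler_wpM2l.
Qed.

Let linfM : {in linf_pred &, forall a b, a ** b \in linf_pred}.
Proof.
move=> a b /linf_predP[M aM] /linf_predP[N bN]; apply/linf_predP.
by exists (M * N) => n; rewrite (le_trans (normsM _ _))// ler_pM.
Qed.

Let linfS : {in linf_pred, forall a, star a \in linf_pred}.
Proof.
move=> a /linf_predP[M aM]; apply/linf_predP.
by exists M => n; rewrite norm_star.
Qed.

Definition linf_subalg := StarSubalg linf_submod linfM linfS.

Definition linf := sub_star linf_subalg.

Let linf_const_subproof (a : A) : cst a \in linf_subalg.
Proof. by apply/linf_predP; exists `|a|. Qed.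

Definition linf_const (a : A) : linf := SubStar (linf_const_subproof a).

Definition c0_pred : {pred linf} :=
  [pred a : linf | `[< val a @ \oo --> (0 : A) >]].

Lemma c0_predP a : reflect (val a @ \oo --> (0 : A)) (a \in c0_pred).
Proof. exact: asboolP. Qed.

Let c0_submod : submod_closed c0_pred.
Proof.
split=> [|c a b]; first by apply/c0_predP; exact: cvg_cst.
move=> /c0_predP a0 /c0_predP b0; apply/c0_predP.
by rewrite -[0](scaler0 _ c) -[c *: 0]addr0; apply: cvgD => //; exact: cvgZr.
Qed.

Let cvg0_le (u v : nat -> A) (M : R[i]) :
  (forall n, `|v n| <= M * `|u n|) -> u @ \oo --> (0 : A) ->
  v @ \oo --> (0 : A).
Proof.
move=> vu u0; have M0 : 0 <= `|M| + 1 by rewrite addr_ge0.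
have Mgt : 0 < `|M| + 1 by rewrite ltr_wpDl.
apply/cvgrPdist_lt => e e0.
have d0 : 0 < e / (`|M| + 1) by rewrite divr_gt0.
have /cvgrPdist_lt/(_ _ d0) := u0.
apply: filterS => n; rewrite !sub0r !normrN ltr_pdivlMr// => h.
apply: le_lt_trans h; rewrite mulrC.
have h0 : 0 <= M * `|u n| by exact: le_trans (vu n).
apply: (le_trans (vu n)); rewrite -[M * _]ger0_norm// normrM normr_id.
by rewrite ler_wpM2r// lerDl.
Qed.

Let c0l (a b : linf) : b \in c0_pred -> a ** b \in c0_pred.
Proof.
move=> /c0_predP b0; apply/c0_predP.
have /linf_predP[M aM] := valP a.
by apply: cvg0_le b0 => n; rewrite (le_trans (normsM _ _))// ler_wpM2r.
Qed.

Let c0r (a b : linf) : a \in c0_pred -> a ** b \in c0_pred.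
Proof.
move=> /c0_predP a0; apply/c0_predP.
have /linf_predP[M bM] := valP b.
by apply: cvg0_le a0 => n; rewrite (le_trans (normsM _ _))// mulrC ler_wpM2r.
Qed.

Let c0S : {in c0_pred, forall a, star a \in c0_pred}.
Proof.
move=> a /c0_predP a0; apply/c0_predP.
by apply: (cvg0_le (M := 1)) a0 => n; rewrite mul1r norm_star.
Qed.

Definition c0_ideal := StarIdeal c0_submod c0l c0r c0S.

Definition Ainf := star_quot c0_ideal.

Definition eta (a : linf) : Ainf := quot_map c0_ideal a.

Definition Ainf_const (a : A) : Ainf := eta (linf_const a).

Lemma Ainf_const_star a : Ainf_const (star a) = star (Ainf_const a).
Proof.
have [_ _ <-] := quot_map_star_hom c0_ideal.
by congr quot_map; apply: val_inj.
Qed.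

End SequenceAlgebra.

Section CentralSequenceAlgebra.
Variables (R : realType) (A : cstarAlgType R) (D : starSubalg A).

Definition commutant_pred : {pred Ainf A} :=
  [pred x | `[< forall d, d \in D ->
                  x ** Ainf_const d = Ainf_const d ** x >]].

Lemma commutant_predP x : reflect (forall d, d \in D -> x ** Ainf_const d = Ainf_const d ** x) (x \in commutant_pred).
Proof. exact: asboolP. Qed.

Let commutant_submod : submod_closed commutant_pred.
Proof.
split=> [|c x y].
  by apply/commutant_predP => d _; rewrite smul0l smul0r.
move=> /commutant_predP xD /commutant_predP yD; apply/commutant_predP => d dD.
by rewrite smulDl smulDr smulZl smulZr xD// yD.
Qed.

Let commutantM : {in commutant_pred &, forall x y, x ** y \in commutant_pred}.
Proof.
move=> x y /commutant_predP xD /commutant_predP yD; apply/commutant_predP => d dD.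
by rewrite -smulA yD// smulA xD// smulA.
Qed.

Let commutantS : {in commutant_pred, forall x, star x \in commutant_pred}.
Proof.
move=> x /commutant_predP xD; apply/commutant_predP => d dD.
have := xD _ (subalgS dD); rewrite Ainf_const_star => /(congr1 star).
by rewrite !starM starK.
Qed.

(* A_\infty \cap D' *)
Definition commutant := StarSubalg commutant_submod commutantM commutantS.

Definition ann_pred : {pred sub_star commutant} :=
  [pred x | `[< forall d, d \in D ->
                  val x ** Ainf_const d = 0 /\ Ainf_const d ** val x = 0 >]].

Lemma ann_predP x : reflect (forall d, d \in D ->
  val x ** Ainf_const d = 0 /\ Ainf_const d ** val x = 0) (x \in ann_pred).
Proof. exact: asboolP. Qed.

Let ann_submod : submod_closed ann_pred.
Proof.
split=> [|c x y].
  by apply/ann_predP => d _; rewrite smul0l smul0r.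
move=> /ann_predP xD /ann_predP yD; apply/ann_predP => d dD /=.
rewrite smulDl smulDr smulZl smulZr.
by have [-> ->] := xD _ dD; have [-> ->] := yD _ dD; rewrite scaler0 addr0.
Qed.

Let annl (x y : sub_star commutant) : y \in ann_pred -> x ** y \in ann_pred.
Proof.
move=> /ann_predP yD; apply/ann_predP => d dD /=.
have /commutant_predP xD := valP x; have [yd dy] := yD _ dD.
by rewrite -smulA yd smul0r smulA -xD// -smulA dy smul0r.
Qed.

Let annr (x y : sub_star commutant) : x \in ann_pred -> x ** y \in ann_pred.
Proof.
move=> /ann_predP xD; apply/ann_predP => d dD /=.
have /commutant_predP yD := valP y; have [xd dx] := xD _ dD.
by rewrite smulA dx smul0l -smulA yD// smulA xd smul0l.
Qed.

Let annS : {in ann_pred, forall x, star x \in ann_pred}.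
Proof.
move=> x /ann_predP xD; apply/ann_predP => d dD /=.
have [xd dx] := xD _ (subalgS dD); move: xd dx.
rewrite Ainf_const_star => /(congr1 star) + /(congr1 star).
by rewrite !starM !starK star0.
Qed.

Definition ann := StarIdeal ann_submod annl annr annS.

(* F(D, A) *)
Definition central_seq := star_quot ann.

Definition kappa (x : sub_star commutant) : central_seq := quot_map ann x.

End CentralSequenceAlgebra.

Record cstarAction (R : realType) (G : topGroupType) (A : cstarAlgType R) :=
  CStarAction {
    act :> G -> A -> A ;
    act_star_hom : forall g, star_hom (act g) ;
    act1 : forall a, act 1%g a = a ;
    actM : forall g h a, act (g * h)%g a = act g (act h a) ;
    act_continuous : forall a, continuous (fun g => act g a)
  }.

Section Actions.
Variables (R : realType) (G : topGroupType) (A : cstarAlgType R).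
Variable alpha : cstarAction G A.

Definition fixed_pred : {pred A} :=
  [pred a | `[< forall g, alpha g a = a >]].

Lemma fixed_predP a : reflect (forall g, alpha g a = a) (a \in fixed_pred).
Proof. exact: asboolP. Qed.

Let fixed_submod : submod_closed fixed_pred.
Proof.
have alpha_lin g : linear (alpha g) by case: (act_star_hom alpha g).
split=> [|c a b].
  apply/fixed_predP => g; have := alpha_lin g 1 0 0.
  by rewrite !scale1r addr0 => /eqP; rewrite -subr_eq0 opprD addNKr oppr_eq0 => /eqP.
move=> /fixed_predP fa /fixed_predP fb; apply/fixed_predP => g.
by rewrite alpha_lin fa fb.
Qed.

Let fixedM : {in fixed_pred &, forall a b, a ** b \in fixed_pred}.
Proof.
move=> a b /fixed_predP fa /fixed_predP fb; apply/fixed_predP => g.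
by have [_ -> _] := act_star_hom alpha g; rewrite fa fb.
Qed.

Let fixedS : {in fixed_pred, forall a, star a \in fixed_pred}.
Proof.
move=> a /fixed_predP fa; apply/fixed_predP => g.
by have [_ _ ->] := act_star_hom alpha g; rewrite fa.
Qed.

Definition fixed_subalg := StarSubalg fixed_submod fixedM fixedS.

Definition fixed_alg := sub_star fixed_subalg.

(* The induced actions. Automorphisms of C*-algebras are isometric, so the
   default value in [sub_lift] is not reached by [act_linf], nor by
   [act_commutant] when D is invariant, and [act_Ainf] and [act_F] do not
   depend on representatives. *)
Definition act_linf (g : G) : linf A -> linf A :=
  @sub_lift _ _ (linf_subalg A) (fun (a : nat -> A) n => alpha g (a n)).

Definition act_Ainf (g : G) : Ainf A -> Ainf A := quot_lift (act_linf g).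

Definition act_commutant (D : starSubalg A) (g : G) :
  sub_star (commutant D) -> sub_star (commutant D) := sub_lift (act_Ainf g).

Definition act_F (D : starSubalg A) (g : G) :
  central_seq D -> central_seq D := quot_lift (act_commutant g).

Definition linf_alpha : set (linf A) :=
  [set a | forall g0 : G, forall e : R, 0 < e ->
     \forall g \near g0, forall n,
       `|val (act_linf g a) n - val (act_linf g0 a) n| <= e%:C].

Definition Ainf_alpha : set (Ainf A) := [set eta a | a in linf_alpha].

Definition F_alpha (D : starSubalg A) : set (central_seq D) :=
  [set kappa x | x in [set x | Ainf_alpha (val x)]].

Definition separable_set (D : set A) :=
  exists S : set A, [/\ countable S, S `<=` D & D `<=` closure S].

Definition Rokhlin :=
  forall D : starSubalg A,
    closed [set` D] -> separable_set [set` D] ->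
    (forall g a, a \in D -> alpha g a \in D) ->
  exists phi : contFun R G -> central_seq D,
    [/\ star_hom phi,
        forall f, F_alpha (phi f),
        forall y, F_alpha y ->
          phi (cont_one R G) ** y = y /\ y ** phi (cont_one R G) = y &
        forall g f, phi (left_trans g f) = act_F g (phi f)].

End Actions.

Definition positive (C : numClosedFieldType) (A : starAlgType C) : set A :=
  [set star b ** b | b in setT].

Definition sigma_unital (R : realType) (A : cstarAlgType R) :=
  exists e : nat -> A,
    [/\ forall n, positive (e n) /\ `|e n| <= 1,
        forall n, positive (e n.+1 - e n) &
        forall a, (fun n => e n ** a) @ \oo --> a /\
                  (fun n => a ** e n) @ \oo --> a].

(* Positivity in M_n(A), in the form X = Y^* Y. *)
Definition mx_positive (C : numClosedFieldType) (A : starAlgType C) (n : nat) :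
    set 'M[A]_n :=
  [set X | exists Y : 'M[A]_n,
     X = \matrix_(i, j) \sum_k star (Y k i) ** Y k j].

Definition completely_positive (C : numClosedFieldType) (A B : starAlgType C)
    (psi : A -> B) :=
  forall n (X : 'M[A]_n), mx_positive X -> mx_positive (map_mx psi X).

Definition cpc (R : realType) (G : topGroupType) (A : cstarAlgType R)
    (alpha : cstarAction G A) (psi : {linear A -> fixed_alg alpha}) :=
  completely_positive psi /\ forall a, `|val (psi a)| <= `|a|.

(* Main.v *)
(* Finite averages over translates contract every orbit to a point, which gives
   an averaging map [E : A -> A^alpha] without Haar measure. For finitely many
   [a], compactness of [G] gives points [gamma_p] and a partition of unity
   [sum_p |s_p|^2 = 1] in [C(G)] such that [alpha_g a] is close to
   [alpha_{gamma_p} a] on the support of [s_p]. Lift the Rokhlin homomorphism to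
   [beta : C(G) -> A_{infty,alpha}]. As [beta] is central and equivariant,
   [a |-> sum_p beta(|s_p|^2) alpha_{gamma_p}(a)] is a discretisation of
   "[beta] applied to [g |-> alpha_g a]": it is almost multiplicative, almost
   invariant, and the identity on [A^alpha]. Compressing a lift by an approximate
   unit, one obtains [Phi(a) = sum_p w_p^* alpha_{gamma_p}(a) w_p] with
   [|sum_p w_p^* w_p| <= 1], and the map wanted is [E o Phi].

   Complete positivity of [E o Phi] requires a square root, in [M_n(A^alpha)], of
   the average of a Gram matrix. Both this square root and the order theory of a
   C*-algebra (Kaplansky's theorem, norm monotonicity, contractivity of
   *-homomorphisms) come from iterating [z |-> (k + z^2) / 2], whose fixed point
   [z] satisfies [(1 - z)^2 = 1 - k], so no functional calculus is needed. *)

(* The obstacle is that [phi] takes values in a quotient by an annihilator, so a lift [beta]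
   respects the relations of [C(G)] only against factors from [D]: in [A_infty] itself,
   [sum_p beta(|s_p|^2)] acts as the identity on [D] but carries no useful norm bound. Hence [D] is
   made to contain an approximate unit besides the given elements, and norm estimates are obtained
   by inserting its elements next to each [beta(s_p)]. Scaling the inserted element so that its
   square has norm at most some [r < 1] leaves the room needed to pass from a bound in [A_infty] to
   the exact bound [1] at a finite index.

   The same quotient makes [phi 1] a unit only against elements of [F_alpha(D, A)]; to test it, an
   invariant approximate unit is needed, which [E] itself provides.

   The weights are squares [|s_p|^2] because every summand must have the form [w^* a w], and the
   supports of the products [s_p s_q] decide which differences have to be small. Lifts in
   [A_{infty,alpha}] make almost invariance uniform in [g] at a single index; only then does [E]
   move [Phi(a)] by a small amount. *)
Require Import Defs.
From HB Require Import structures.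
From mathcomp Require Import all_boot all_order all_algebra.
From mathcomp Require Import complex.
From mathcomp Require Import all_classical all_reals all_analysis.
From mathcomp Require Import ring lra.
Set Implicit Arguments.
Unset Strict Implicit.
Unset Printing Implicit Defensive.
Import Order.TTheory GRing.Theory Num.Theory.
Import numFieldNormedType.Exports.
Local Open Scope classical_set_scope.
Local Open Scope ring_scope.
Local Open Scope complex_scope.

(** * Linear arithmetic in modules *)

Section LinearNormalization.
Variables (K : pzRingType) (V : lmodType K).

Inductive lexpr :=
  | LAtom of nat | LZero | LAdd of lexpr & lexpr | LOpp of lexpr
  | LScale of K & lexpr.

Fixpoint leval (v : seq V) (e : lexpr) : V :=
  match e with
  | LAtom i => nth 0 v i
  | LZero => 0
  | LAdd a b => leval v a + leval v b
  | LOpp a => - leval v a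
  | LScale c a => c *: leval v a
  end.

(** [Nat.eqb] is used instead of [==] so that [cbn] reduces each coefficient to an explicit
    expression within reach of [ring] or [field]. *)
Fixpoint lcoef (i : nat) (e : lexpr) : K :=
  match e with
  | LAtom j => if Nat.eqb j i then 1 else 0
  | LZero => 0
  | LAdd a b => lcoef i a + lcoef i b
  | LOpp a => - lcoef i a
  | LScale c a => c * lcoef i a
  end.

Fixpoint lcoefs_eq (n : nat) (e f : lexpr) : Prop :=
  match n with
  | 0 => True
  | n.+1 => lcoef n e = lcoef n f /\ lcoefs_eq n e f
  end.

Lemma levalE v e : leval v e = \sum_(i < size v) lcoef i e *: nth 0 v i.
Proof.
elim: e => [j||a IHa b IHb|a IHa|c a IHa] /=.
- have jE (i : nat) : Nat.eqb j i = (j == i) by apply/PeanoNat.Nat.eqb_spec/eqP.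
  have [js|js] := ltnP j (size v).
    rewrite (bigD1 (Ordinal js)) //= jE eqxx scale1r big1 ?addr0 // => i ij.
    rewrite jE; case: eqP => [ji|]; last by rewrite scale0r.
    by case/eqP: ij; apply: val_inj.
  rewrite nth_default // big1 // => i _; rewrite jE; case: eqP => [ji|].
    by move: js; rewrite ji leqNgt ltn_ord.
  by rewrite scale0r.
- by rewrite big1 // => i _; rewrite scale0r.
- by rewrite IHa IHb -big_split /=; apply: eq_bigr => i _; rewrite scalerDl.
- by rewrite IHa -sumrN; apply: eq_bigr => i _; rewrite scaleNr.
- by rewrite IHa scaler_sumr; apply: eq_bigr => i _; rewrite scalerA.
Qed.

Lemma leval_eq v e f : lcoefs_eq (size v) e f -> leval v e = leval v f.
Proof.
move=> h; rewrite !levalE; apply: eq_bigr => i _; congr (_ *: _).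
elim: (size v) i h => [[]//|n IH i /= [en h]].
have [->//|ni] := eqVneq (i : nat) n.
have ltin : (i < n)%N by rewrite ltn_neqAle ni -ltnS ltn_ord.
exact: (IH (Ordinal ltin)).
Qed.

End LinearNormalization.

Ltac lmem_idx x v :=
  lazymatch v with
  | x :: _ => constr:(0%N)
  | _ :: ?w => let n := lmem_idx x w in constr:(n.+1)
  end.

Ltac ladd_atom x v :=
  match v with
  | _ => let _ := lmem_idx x v in v
  | _ => constr:(x :: v)
  end.

Ltac latoms t v :=
  lazymatch t with
  | (?a + ?b)%R => let v1 := latoms a v in latoms b v1
  | (- ?a)%R => latoms a v
  | (?c *: ?a)%R => latoms a v
  | 0%R => v
  | _ => ladd_atom t v
  end.

Ltac lreify K t v :=
  lazymatch t with
  | (?a + ?b)%R =>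
      let x := lreify K a v in let y := lreify K b v in constr:(@LAdd K x y)
  | (- ?a)%R => let x := lreify K a v in constr:(@LOpp K x)
  | (?c *: ?a)%R => let x := lreify K a v in constr:(@LScale K c x)
  | 0%R => constr:(@LZero K)
  | _ => let i := lmem_idx t v in constr:(@LAtom K i)
  end.

(* Reduces an equation between linear combinations over a field [K] to the
   equations between the coefficients of the syntactically distinct terms. *)
Ltac lmod K :=
  lazymatch goal with
  | |- @eq ?T ?l ?r =>
    let v0 := constr:(@nil T) in
    let v1 := latoms l v0 in
    let v := latoms r v1 in
    let e := lreify K l v in
    let f := lreify K r v in
    apply: (@leval_eq K _ v e f);
    cbn [lcoefs_eq lcoef size Nat.eqb];
    repeat (split; [try (by first [ring | field; rewrite ?pnatr_eq0]) | ]); try exact I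
  end.

Definition smulE := (@smulDl, @smulDr, @smulNl, @smulNr, @smulZl, @smulZr,
  @smul0l, @smul0r, @smulA).
Definition starE := (@starD, @starN, @starZ, @starM, @starK, @star0).

(** * Square roots by iteration *)

Section RealNorm.
Variable R : realType.
Implicit Types V : normedModType R[i].

(** Norms over [R[i]] are valued in [R[i]]. They are real, so the real part loses nothing, and it
    brings all estimates into [R], where [lra] and [nra] apply. *)
Definition nrm V (a : V) : R := complex.Re `|a|.

Lemma nrmE V (a : V) : `|a| = (nrm a)%:C.
Proof. by rewrite /nrm RRe_real // ger0_real. Qed.

Lemma nrm_ge0 V (a : V) : 0 <= nrm a.
Proof. by rewrite -lecR -nrmE normr_ge0. Qed.

Lemma nrm0 V : nrm (0 : V) = 0.
Proof. by rewrite /nrm normr0. Qed.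

Lemma nrm_eq0 V (a : V) : nrm a = 0 -> a = 0.
Proof. by move=> a0; apply/eqP; rewrite -normr_eq0 nrmE a0. Qed.

Lemma nrm_le0 V (a : V) : nrm a <= 0 -> a = 0.
Proof. by move=> a0; apply/nrm_eq0/eqP; rewrite eq_le a0 nrm_ge0. Qed.

Lemma nrmN V (a : V) : nrm (- a) = nrm a.
Proof. by rewrite /nrm normrN. Qed.

Lemma nrmD V (a b : V) : nrm (a + b) <= nrm a + nrm b.
Proof. by rewrite -lecR rmorphD /= -!nrmE ler_normD. Qed.

Lemma nrmB V (a b : V) : nrm (a - b) <= nrm a + nrm b.
Proof. by rewrite -(nrmN b) nrmD. Qed.

Lemma nrm_distC V (a b : V) : nrm (a - b) = nrm (b - a).
Proof. by rewrite -nrmN opprB. Qed.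

Lemma nrm_triangle V (b a c : V) : nrm (a - c) <= nrm (a - b) + nrm (b - c).
Proof. by rewrite -{1}(subrK b a) -addrA nrmD. Qed.

Lemma nrm_dist V (a b : V) : `|nrm a - nrm b| <= nrm (a - b).
Proof.
have h (x y : V) : nrm x <= nrm (x - y) + nrm y by rewrite -{1}(subrK y x) nrmD.
have := h a b; have := h b a; rewrite (nrm_distC b a) ler_norml => *.
by apply/andP; split; lra.
Qed.

Definition cmod (z : R[i]) : R := complex.Re `|z|.

Lemma cmodE z : `|z| = (cmod z)%:C.
Proof. by rewrite /cmod RRe_real // ger0_real. Qed.

Lemma cmod_ge0 z : 0 <= cmod z.
Proof. by rewrite -lecR -cmodE normr_ge0. Qed.

Lemma cmodM z w : cmod (z * w) = cmod z * cmod w.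
Proof. by apply: complexI; rewrite rmorphM /= -!cmodE normrM. Qed.

Lemma cmodR (r : R) : cmod r%:C = `|r|.
Proof. by apply: complexI; rewrite -cmodE normc_def /= expr0n addr0 sqrtr_sqr. Qed.

Lemma nrmZ V z (a : V) : nrm (z *: a) = cmod z * nrm a.
Proof. by apply: complexI; rewrite rmorphM /= -nrmE normrZ cmodE nrmE. Qed.

Lemma nrmZR V (r : R) (a : V) : nrm (r%:C *: a) = `|r| * nrm a.
Proof. by rewrite nrmZ cmodR. Qed.

Lemma cvg_nrmP V (u : nat -> V) l :
  u @ \oo --> l <->
  forall e : R, 0 < e -> \forall n \near \oo, nrm (u n - l) <= e.
Proof.
split=> [/cvgrPdist_le h e e0|h].
  have /h : 0 < e%:C by rewrite ltcR.
  by apply: filterS => n; rewrite distrC nrmE lecR.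
apply/cvgrPdist_le => e e0.
have er : e = (complex.Re e)%:C by rewrite RRe_real // gtr0_real.
have /h : 0 < complex.Re e by rewrite -ltcR -er.
by apply: filterS => n; rewrite distrC nrmE er lecR.
Qed.

Lemma cauchy_nrm (V : completeNormedModType R[i]) (u : nat -> V) :
  (forall e : R, 0 < e -> exists N, forall n, (N <= n)%N -> nrm (u n - u N) <= e) ->
  exists l : V, u @ \oo --> l.
Proof.
move=> h; apply/cvg_ex/cauchy_cvgP/cauchy_ballP => e e0.
have er : e = (complex.Re e)%:C by rewrite RRe_real // gtr0_real.
have e0' : 0 < complex.Re e by rewrite -ltcR -er.
have [|N hN] := h (complex.Re e / 4); first by rewrite divr_gt0.
exists (u @` [set n | (N <= n)%N], u @` [set n | (N <= n)%N]) => /=.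
  by split; exists N => // n Nn; exists n.
move=> [x y] /= [[n Nn <-] [m Nm <-]].
rewrite -ball_normE /= er nrmE ltcR.
have := hN n Nn; have := hN m Nm; have := nrm_triangle (u N) (u n) (u m).
by rewrite (nrm_distC (u N) (u m)) => *; lra.
Qed.

End RealNorm.

Section BoundedSquareRoot.
Variables (R : realType) (B : lmodType R[i]) (mul : B -> B -> B).
Variable bnd : B -> R -> Prop.

Definition bnd_cvg (w : nat -> B) (z : B) :=
  forall e : R, 0 < e -> \forall n \near \oo, bnd (w n - z) e.

(* [bnd a c] stands for [|a| <= c] in an algebra whose norm is only given through
   its upper bounds. *)
Record banach_bound : Prop := {
  bbBl : forall a b c, mul (a - b) c = mul a c - mul b c ;
  bbBr : forall a b c, mul c (a - b) = mul c a - mul c b ;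
  bb_le : forall a c d, bnd a c -> c <= d -> bnd a d ;
  bb_lim : forall a c, (forall e, 0 < e -> bnd a (c + e)) -> bnd a c ;
  bb0 : bnd 0 0 ;
  bb_eq0 : forall a, bnd a 0 -> a = 0 ;
  bbD : forall a b c d, bnd a c -> bnd b d -> bnd (a + b) (c + d) ;
  bbZ : forall z a c, bnd a c -> bnd (z *: a) (cmod z * c) ;
  bbM : forall a b c d, bnd a c -> bnd b d -> bnd (mul a b) (c * d) ;
  bb_complete : forall w : nat -> B,
    (forall e, 0 < e -> exists N, forall n, (N <= n)%N -> bnd (w n - w N) e) ->
    exists z, bnd_cvg w z
}.

Hypothesis bb : banach_bound.

Lemma bbN a c : bnd a c -> bnd (- a) c.
Proof.
move=> /(bbZ bb (-1)); rewrite scaleN1r; congr (bnd _ _).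
by rewrite /cmod normrN1 mul1r.
Qed.

Lemma bbB a b c d : bnd a c -> bnd b d -> bnd (a - b) (c + d).
Proof. by move=> ha /bbN; exact: (bbD bb). Qed.

Lemma bbC a b c : bnd (a - b) c -> bnd (b - a) c.
Proof. by move=> /bbN; rewrite opprB. Qed.

Lemma bbZR (r : R) a c : 0 <= r -> bnd a c -> bnd (r%:C *: a) (r * c).
Proof. by move=> r0 /(bbZ bb r%:C); rewrite cmodR ger0_norm. Qed.

Lemma bb_half a c : bnd a c -> bnd (2^-1 *: a) (2^-1 * c).
Proof.
move=> /(bbZR (r := 2^-1)); rewrite invr_ge0 // fmorphV /= rmorph_nat; exact.
Qed.

(** This is the iteration for the scalar [k = 1]. It increases, stays below [1], and majorises both
    the iterates in [B] and their increments, so convergence of this real sequence forces that of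
    the iterates. *)
Fixpoint root_bound (n : nat) : R :=
  if n is n.+1 then 2^-1 * (1 + root_bound n ^+ 2) else 0.

Lemma root_bound_itv n : 0 <= root_bound n <= 1.
Proof. by elim: n => [|n /andP[h0 h1]] /=; [lra | apply/andP; split; nra]. Qed.

Lemma root_bound_leS n : root_bound n <= root_bound n.+1.
Proof. by have := sqr_ge0 (1 - root_bound n); rewrite /=; nra. Qed.

Lemma root_bound_cauchy e : 0 < e ->
  exists N, forall n, (N <= n)%N -> root_bound n - root_bound N <= e.
Proof.
move=> e0.
have mono : {homo root_bound : n m / (n <= m)%N >-> n <= m}.
  by apply: homo_leq => [x||]; [|exact: le_trans|exact: root_bound_leS].
have : cvgn root_bound.
  apply: nondecreasing_is_cvgn => //.
  by exists 1 => _ [n _ <-]; case/andP: (root_bound_itv n).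
move=> /cvgrPdist_le /(_ (e / 2)); rewrite divr_gt0 // => /(_ isT) [N _ hN].
exists N => n Nn; have := hN n Nn; have := hN N (leqnn N).
by rewrite /= !ler_norml => /andP[? ?] /andP[? ?]; lra.
Qed.

Variable k : B.
Hypothesis k1 : bnd k 1.

Let step w := 2^-1 *: (k + mul w w).
Let w n := iter n step 0.

Let w_bnd n : bnd (w n) (root_bound n).
Proof.
elim: n => [|n IH]; first exact: (bb0 bb).
by apply: bb_half; apply: (bbD bb) => //; rewrite expr2; apply: (bbM bb).
Qed.

(** The identity [x x - y y = x (x - y) + (x - y) y] needs no commutativity, and the scalar
    iteration satisfies it with nonnegative terms, so the bound passes term by term. *)
Let w_bndS n : bnd (w n.+1 - w n) (root_bound n.+1 - root_bound n).
Proof.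
have wS m : w m.+1 = 2^-1 *: (k + mul (w m) (w m)) by [].
have rS m : root_bound m.+1 = 2^-1 * (1 + root_bound m ^+ 2) by [].
elim: n => [|n IH].
  by rewrite [w 0]/= subr0 [root_bound 0]/= subr0; exact: w_bnd.
have -> : w n.+2 - w n.+1 =
    2^-1 *: (mul (w n.+1) (w n.+1 - w n) + mul (w n.+1 - w n) (w n)).
  rewrite (bbBl bb) (bbBr bb) [w n.+2]wS [X in _ - X = _]wS.
  by move: (w n.+1) (w n) => x y; lmod R[i].
have -> : root_bound n.+2 - root_bound n.+1 = 2^-1 *
    (root_bound n.+1 * (root_bound n.+1 - root_bound n) +
     (root_bound n.+1 - root_bound n) * root_bound n).
  rewrite [root_bound n.+2]rS [X in _ - X = _]rS.
  by move: (root_bound n.+1) (root_bound n) => x y; field.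
by apply: bb_half; apply: (bbD bb); apply: (bbM bb).
Qed.

Let w_bndD m n : (m <= n)%N -> bnd (w n - w m) (root_bound n - root_bound m).
Proof.
move=> /subnK <-; elim: (n - m)%N => [|d IH].
  by rewrite !subrr; exact: (bb0 bb).
rewrite addSn; have -> : w (d + m).+1 - w m =
  (w (d + m).+1 - w (d + m)%N) + (w (d + m)%N - w m) by rewrite addrA subrK.
have -> : root_bound (d + m).+1 - root_bound m =
    (root_bound (d + m).+1 - root_bound (d + m)) +
    (root_bound (d + m) - root_bound m) by ring.
exact: (bbD bb).
Qed.

(* [1 - z] is a square root of [1 - k]; the last clause transfers to [z] every
   closed property that is stable under the iteration. *)
Lemma bounded_root : exists z, [/\ bnd z 1, z = 2^-1 *: (k + mul z z) &
  forall P : B -> Prop, P 0 -> (forall x, P x -> P (2^-1 *: (k + mul x x))) ->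
    (forall u x, (forall n, P (u n)) -> bnd_cvg u x -> P x) -> P z].
Proof.
have [|z wz] := bb_complete bb (w := w).
  move=> e /root_bound_cauchy[N hN]; exists N => n Nn.
  by apply: (bb_le bb) (hN n Nn); exact: w_bndD.
have near_ex e : 0 < e -> exists n, bnd (w n - z) e /\ bnd (w n.+1 - z) e.
  move=> /wz[N _ hN]; exists N; split; [exact: (hN N (leqnn N))|].
  exact: (hN N.+1 (leqnSn N)).
have z1 : bnd z 1.
  apply: (bb_lim bb) => e /near_ex[n [hn _]].
  have -> : z = w n + (z - w n) by rewrite addrC subrK.
  apply: (bbD bb); last exact: bbC.
  by apply: (bb_le bb) (w_bnd n) _; case/andP: (root_bound_itv n).
exists z; split=> [//||P P0 PS Pl].
  apply/eqP; rewrite -subr_eq0; apply/eqP; apply: (bb_eq0 bb).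
  apply: (bb_lim bb) => e e0.
  have [|n [hn hn1]] := near_ex (e / 2); first by rewrite divr_gt0.
  have -> : z - 2^-1 *: (k + mul z z) =
    (z - w n.+1) + 2^-1 *: (mul (w n) (w n - z) + mul (w n - z) z).
    transitivity (z - 2^-1 *: (k + mul (w n) (w n)) +
      2^-1 *: (mul (w n) (w n) - mul z z)); first by lmod R[i].
    by rewrite (bbBl bb) (bbBr bb); congr (_ + _ *: _); rewrite addrA subrK.
  have -> : 0%R + e = e / 2 + 2^-1 * (1 * (e / 2) + (e / 2) * 1) by field.
  apply: (bbD bb); first exact: bbC.
  apply: bb_half; apply: (bbD bb); apply: (bbM bb) => //.
  by apply: (bb_le bb) (w_bnd n) _; case/andP: (root_bound_itv n).
apply: Pl wz; elim => [//|n IH].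
exact: PS.
Qed.

End BoundedSquareRoot.

(** * Positive elements *)

Section PositiveElements.
Variables (R : realType) (B : starAlgType R[i]) (e : B) (bnd : B -> R -> Prop).
Implicit Types a b c h k v x y : B.

Record cstar_bound : Prop := {
  cb_banach :> banach_bound (@smul _ B) bnd ;
  cb_unity : is_unity e ;
  cb1 : bnd e 1 ;
  cb_ge0 : forall a (t : R), bnd a t -> 0 <= t ;
  cb_ex : forall a, exists t : R, bnd a t ;
  cbS : forall a (t : R), bnd a t -> bnd (star a) t ;
  cbX : forall a (t : R), 0 <= t -> bnd (star a ** a) (t ^+ 2) -> bnd a t
}.

Hypothesis cb : cstar_bound.
Let bb := cb_banach cb.

(** For self-adjoint [h], the inequality [|t - h| <= t] places the spectrum in [[0, 2t]]. In this
    metric form positivity is visibly stable under sums, which the form [star b ** b] is not. *)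
Definition posel h := star h = h /\ exists t : R, bnd (t%:C *: e - h) t.

Let e1l x : e ** x = x. Proof. by have [] := cb_unity cb x. Qed.
Let e1r x : x ** e = x. Proof. by have [] := cb_unity cb x. Qed.
Let eS : star e = e.
Proof. by rewrite -(e1r (star e)) -{2}(starK e) -starM e1r starK. Qed.
Let conjcR (r : R) : Num.conj r%:C = r%:C.
Proof. by rewrite conj_Creal // realE lecR ?ler0c; case: (leP 0 r) => //= /ltW; rewrite lecR. Qed.
Let starZR (r : R) a : star (r%:C *: a) = r%:C *: star a.
Proof. by rewrite starZ conjcR. Qed.

Lemma cb_sa_eq0 a : star a = a -> a ** a = 0 -> a = 0.
Proof.
move=> sa aa; apply: (bb_eq0 bb); apply: (cbX cb) => //.
by rewrite sa aa expr0n; exact: (bb0 bb).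
Qed.

(** From [z = (k + z z) / 2] follows [z z = 2 z - k], so [c = e - z] squares to [e - k].
    Self-adjointness and commutation with [x] hold at the starting point [0] and survive both the
    iteration and limits. *)
Lemma sqrt_one_sub k : star k = k -> bnd k 1 ->
  exists c, [/\ star c = c, c ** c = e - k, bnd (e - c) 1 &
    forall x, x ** k = k ** x -> x ** c = c ** x].
Proof.
move=> sk k1; have [z [z1 zE zP]] := bounded_root bb k1.
have sz : star z = z.
  apply: (zP (fun z => star z = z)) => [|x sx|u x su ux]; first exact: star0.
    by rewrite starZ starD starM sx sk fmorphV /= conjC_nat.
  apply/eqP; rewrite -subr_eq0; apply/eqP; apply: (bb_eq0 bb).
  apply: (bb_lim bb) => d d0.
  have [|N _ /(_ N (leqnn N)) uxN] := ux (d / 2); first by rewrite divr_gt0.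
  have -> : star x - x = (u N - x) - star (u N - x).
    by rewrite starD starN su; lmod R[i].
  by rewrite add0r [X in bnd _ X]splitr; apply: (bbB bb) => //; exact: (cbS cb).
exists (e - z); split.
- by rewrite starD starN eS sz.
- rewrite !smulE e1l e1l e1r.
  have -> : z ** z = 2 *: z - k.
    transitivity (2 *: (2^-1 *: (k + z ** z)) - k); first by lmod R[i].
    by rewrite -zE.
  by lmod R[i].
- by rewrite opprB addrC subrK.
- move=> x xk; rewrite !smulE e1l e1r; congr (_ - _).
  apply: (zP (fun z => x ** z = z ** x)) => [|y xy|u y xu uy].
  + by rewrite !smulE.
  + by rewrite !smulE xk xy -smulA xy smulA.
  + have [t xt] := cb_ex cb x; have t0 := cb_ge0 cb xt.
    apply/eqP; rewrite -subr_eq0; apply/eqP; apply: (bb_eq0 bb).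
    apply: (bb_lim bb) => d d0.
    (* The commutator with [y] splits into two products, each at most [t] times the tolerance;
       [t + 1] avoids a division by zero. *)
    have d'0 : 0 < d / (2 * (t + 1)) by rewrite divr_gt0 // mulr_gt0 // ltr_wpDl.
    have [N _ /(_ N (leqnn N)) uyN] := uy _ d'0.
    have -> : x ** y - y ** x = (u N - y) ** x - x ** (u N - y).
      by rewrite !smulE xu; lmod R[i].
    apply: (bb_le bb); first by apply: (bbB bb); apply: (bbM bb); eassumption.
    rewrite add0r -subr_ge0.
    have -> : d - (d / (2 * (t + 1)) * t + t * (d / (2 * (t + 1)))) = d / (t + 1).
      by field; rewrite gt_eqF // ltr_wpDl.
    by rewrite divr_ge0 ?ltW // ltr_wpDl.
Qed.

(* [c + i s] is unitary. *)
Lemma circle_bound s c : star s = s -> star c = c -> s ** c = c ** s ->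
  s ** s + c ** c = e -> bnd s 1 /\ bnd c 1.
Proof.
move=> ss sc comm sce.
pose u := c + 'i *: s.
have su : star u = c - 'i *: s by rewrite starD starZ ss sc conjCi scaleNr.
have i2 : 'i * 'i = -1 :> R[i] by rewrite -expr2 sqrCi.
have uu : star u ** u = e.
  rewrite su /u !smulE comm -sce.
  rewrite !scalerA i2 scaleN1r.
  by lmod R[i].
have u1 : bnd u 1.
  by apply: (cbX cb) => //; rewrite uu expr1n; exact: (cb1 cb).
have su1 : bnd (star u) 1 by exact: (cbS cb).
have half_bnd := bb_half bb.
split.
- have -> : s = - 2^-1 *: ('i *: (u - star u)).
    have -> : u - star u = (2 * 'i) *: s by rewrite su /u; lmod R[i].
    rewrite (scalerA 'i) mulrCA i2 mulrN1 scalerA mulrNN.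
    by rewrite mulVf ?scale1r // pnatr_eq0.
  have -> : 1 = 2^-1 * (cmod ('i : R[i]) * (1 + 1)) :> R.
    have -> : cmod ('i : R[i]) = 1 by apply: complexI; rewrite -cmodE normCi.
    by field.
  rewrite scaleNr; apply: (bbN bb); apply: half_bnd; apply: (bbZ bb).
  exact: (bbB bb).
- have -> : c = 2^-1 *: (u + star u) by rewrite su /u; lmod R[i].
  have -> : 1 = 2^-1 * (1 + 1) :> R by field.
  by apply: half_bnd; apply: (bbD bb).
Qed.

(** Division by [t] turns [|t - h| <= t] into [|k| <= 1] for [k = e - h / t], and [h = t (e - k)],
    so the root is [sqrt t] times the root of [e - k]. *)
Lemma pos_sqrt h : posel h ->
  exists c, [/\ posel c, c ** c = h & forall x, x ** h = h ** x -> x ** c = c ** x].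
Proof.
move=> [sh [t0 ht0]].
(* The given [t0] may be zero; passing to [t0 + 1] only adds [e], whose bound is [1]. *)
have t00 := cb_ge0 cb ht0; pose t := t0 + 1; have t1 : 0 < t by rewrite ltr_wpDl.
have ht : bnd (t%:C *: e - h) t.
  have -> : t%:C *: e - h = (t0%:C *: e - h) + e.
    by rewrite /t rmorphD /= scalerDl scale1r; lmod R[i].
  by apply: (bbD bb) => //; exact: (cb1 cb).
have tC : t%:C != 0 by rewrite gt_eqF // ltcR.
pose k := e - t%:C^-1 *: h.
have [] := @sqrt_one_sub k.
- by rewrite /k starD starN eS -fmorphV starZR sh.
- have -> : k = (t^-1)%:C *: (t%:C *: e - h).
    by rewrite /k scalerBr scalerA fmorphV mulVf // scale1r.
  rewrite -(mulVf (lt0r_neq0 t1)); apply: (bbZR bb) => //.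
  by rewrite invr_ge0 ltW.
move=> c [sc cc c1 cP].
have sq0 : 0 <= Num.sqrt t by exact: sqrtr_ge0.
exists ((Num.sqrt t)%:C *: c); split.
- split; first by rewrite starZR sc.
  exists (Num.sqrt t); rewrite -scalerBr -[X in bnd _ X]mulr1.
  exact: (bbZR bb).
- rewrite !smulE scalerA -rmorphM /= -expr2 sqr_sqrtr ?ltW // cc /k.
  by rewrite opprB addrC subrK scalerA mulfV // scale1r.
- move=> x xh; rewrite !smulE cP // /k !smulE e1l e1r.
  by rewrite xh.
Qed.

(** After scaling to [|d| <= 1], the root [c] of [e - d d] commutes with [d] and [d d + c c = e]. So
    [circle_bound] gives [|c| <= 1], and [e - d d = c c] has bound [1]. This is what makes squares
    of self-adjoint elements positive. *)
Lemma sqr_bound b t : 0 < t -> star b = b -> bnd b t ->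
  bnd ((t ^+ 2)%:C *: e - b ** b) (t ^+ 2).
Proof.
move=> t0 sb bt; pose d := (t^-1)%:C *: b.
have tC : t%:C != 0 by rewrite gt_eqF // ltcR.
have sd : star d = d by rewrite starZR sb.
have d1 : bnd d 1.
  rewrite -(mulVf (lt0r_neq0 t0)); apply: (bbZR bb) => //.
  by rewrite invr_ge0 ltW.
have [] := @sqrt_one_sub (d ** d).
- by rewrite starM sd.
- by rewrite -[1]mulr1; apply: (bbM bb).
move=> c [sc cc _ cP].
have [||||_ c1] := @circle_bound d c => //.
- by apply: cP; rewrite smulA.
- by rewrite cc addrC subrK.
have -> : (t ^+ 2)%:C *: e - b ** b = (t ^+ 2)%:C *: (c ** c).
  rewrite cc /d !smulE scalerBr !scalerA -!rmorphM /=.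
  by congr (_ - _); rewrite -[LHS]scale1r; congr (_%:C *: _); field; rewrite gt_eqF.
rewrite -[X in bnd _ X]mulr1; apply: (bbZR bb); first exact: sqr_ge0.
by rewrite -[1]mulr1; apply: (bbM bb).
Qed.

Let bnd_pos a : exists2 t : R, 0 < t & bnd a t.
Proof.
have [t at_] := cb_ex cb a; have t0 := cb_ge0 cb at_.
exists (t + 1); first by rewrite ltr_wpDl.
by apply: (bb_le bb at_); rewrite lerDl.
Qed.

Lemma sqr_pos b : star b = b -> posel (b ** b).
Proof.
move=> sb; split; first by rewrite starM sb.
by have [t t0 bt] := bnd_pos b; exists (t ^+ 2); exact: sqr_bound.
Qed.

Lemma posD h k : posel h -> posel k -> posel (h + k).
Proof.
move=> [sh [t ht]] [sk [s ks]]; split; first by rewrite starD sh sk.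
exists (t + s); rewrite rmorphD /= scalerDl opprD addrACA.
exact: (bbD bb).
Qed.

Lemma posZ (r : R) h : 0 <= r -> posel h -> posel (r%:C *: h).
Proof.
move=> r0 [sh [t ht]]; split; first by rewrite starZR sh.
by exists (r * t); rewrite rmorphM /= -scalerA -scalerBr; apply: (bbZR bb).
Qed.

(** The roots [s] of [x] and [c] of [e - x] commute and satisfy [s s + c c = e], so [circle_bound]
    bounds [s], and with it [x = s s]. *)
Lemma pos_le1_bound x : posel x -> posel (e - x) -> bnd x 1.
Proof.
move=> /pos_sqrt[s [[ss _] sx _]] /pos_sqrt[c [[sc _] cx cP]].
have [||||s1 _] := @circle_bound s c => //.
- by apply: cP; rewrite !smulE e1l e1r -sx smulA.
- by rewrite sx cx addrC subrK.
by rewrite -sx -[1]mulr1; apply: (bbM bb).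
Qed.

(** After division by [t], [e - x / t] is the sum of [e - y / t], positive because [|y / t| <= 1],
    and of [(y - x) / t]; the previous lemma applies to [x / t]. *)
Lemma pos_bound_mono x y t : 0 < t ->
  posel x -> posel (y - x) -> bnd y t -> bnd x t.
Proof.
move=> t0 px pyx yt.
have tV0 : 0 <= t^-1 by rewrite invr_ge0 ltW.
have tC : t%:C != 0 by rewrite gt_eqF // ltcR.
have h1 : bnd ((t^-1)%:C *: y) 1.
  by rewrite -(mulVf (lt0r_neq0 t0)); apply: (bbZR bb).
have sy : star y = y.
  have [sx _] := px; have [syx _] := pyx.
  by rewrite -(subrK x y) starD sx syx.
have /(bbZR bb (ltW t0)) : bnd ((t^-1)%:C *: x) 1.
  apply: pos_le1_bound; first exact: posZ.
  have -> : e - (t^-1)%:C *: x =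
      (e - (t^-1)%:C *: y) + (t^-1)%:C *: (y - x) by lmod R[i].
  apply: posD; last exact: posZ.
  split; first by rewrite starD starN starZR eS sy.
  by exists 1; rewrite scale1r opprB addrC subrK.
by rewrite mulr1 fmorphV scalerA mulfV // scale1r.
Qed.

(* With [v'] for the adjoint of [v], the square root [k] of [v v'] satisfies
   [|k + k^3| = |(1 + v'v) v'| <= 1] and [(k + k^3)^2 >= 2 k^4]. *)
Lemma neg_sqr_bound v m : star m = m -> star v ** v = - (m ** m) ->
  bnd v 1 -> bnd v (9 / 10).
Proof.
move=> sm vm v1.
have sv1 := cbS cb v1.
have m1 : bnd m 1.
  apply: (cbX cb) => //; rewrite sm -[m ** m]opprK -vm.
  by apply: (bbN bb); rewrite expr2; apply: (bbM bb).
have vv1 : bnd (e + star v ** v) 1.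
  have := sqr_bound ltr01 sm m1.
  by rewrite expr1n scale1r vm.
have pvv : posel (v ** star v).
  pose a := v + star v; pose d := 'i *: (v - star v).
  have sa : star a = a by rewrite starD starK addrC.
  have sd : star d = d.
    by rewrite starZ starD starN starK conjCi scaleNr -scalerN opprB.
  (* [v v' + v' v] is half the sum of the squares of [a] and [d], twice the real and imaginary parts
     of [v] up to sign. Since [- v' v = m m] by hypothesis, [v v'] is a positive combination of
     squares. *)
  have -> : v ** star v = (2^-1)%:C *: (a ** a + d ** d) + m ** m.
    rewrite -[m ** m]opprK -vm {1 2}/d smulZl smulZr scalerA -expr2 sqrCi.
    rewrite scaleN1r /a !smulE.
    by rewrite fmorphV rmorph_nat; lmod R[i].
  apply: posD; last exact: sqr_pos.
  by apply: posZ; [rewrite invr_ge0|apply: posD; exact: sqr_pos].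
have [k [[sk _] kk _]] := pos_sqrt pvv.
have kf1 : bnd (k + k ** k ** k) 1.
  apply: (cbX cb) => //.
  have -> : star (k + k ** k ** k) ** (k + k ** k ** k) =
      star (star v ** (e + v ** star v)) ** (star v ** (e + v ** star v)).
    rewrite -kk [in RHS]starM starK -[RHS]smulA (smulA v (star v)) -kk.
    by rewrite !(starD, starM) sk eS !smulE !(e1l, e1r); lmod R[i].
  rewrite expr1n.
  have -> : star v ** (e + v ** star v) = (e + star v ** v) ** star v.
    by rewrite !smulE e1l e1r.
  rewrite -[1]mulr1; apply: (bbM bb).
    by apply: (cbS cb); rewrite -[1]mulr1; apply: (bbM bb).
  by rewrite -[1]mulr1; apply: (bbM bb).
pose f := (k + k ** k ** k) ** (k + k ** k ** k).
have f1 : bnd f 1 by rewrite -[1]mulr1; apply: (bbM bb).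
have h2 : bnd (2 *: ((k ** k) ** (k ** k))) 1.
  apply: (pos_bound_mono (y := f)) => //.
    rewrite -(rmorph_nat (real_complex R) 2); apply: posZ => //.
    by apply: sqr_pos; rewrite starM sk.
  have -> : f - 2 *: ((k ** k) ** (k ** k)) =
      k ** k + (k ** k ** k) ** (k ** k ** k).
    by rewrite /f !smulE; lmod R[i].
  by apply: posD; apply: sqr_pos; rewrite ?starM ?sk ?smulA.
(* From [2 k^4 <= 1] in norm one gets [|k^2|^2 <= 1/2], and [1/2 <= (9/10)^4]. Any factor below [1]
   whose fourth power is at least [1/2] would serve. *)
have kk2 : bnd (k ** k) ((9 / 10) ^+ 2).
  apply: (cbX cb); first exact: sqr_ge0.
  rewrite starM sk; have := bb_half bb h2.
  rewrite scalerA mulVf ?scale1r ?pnatr_eq0 // => h3.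
  by apply: (bb_le bb h3); lra.
rewrite -[v]starK; apply: (cbS cb); apply: (cbX cb); first lra.
by rewrite starK -kk.
Qed.

(** The hypothesis is invariant under rescaling [v] and [m] together, so [neg_sqr_bound] improves
    any positive bound on [v] by the factor [9/10]. Repetition drives the bound to [0]. *)
Lemma neg_sqr_eq0 v m : star m = m -> star v ** v = - (m ** m) -> v = 0.
Proof.
move=> sm vm; have [t t0 vt] := bnd_pos v.
have vn n : bnd v (t * (9 / 10) ^+ n).
  elim: n => [|n IH]; first by rewrite mulr1.
  set s := t * (9 / 10) ^+ n in IH.
  have s0 : 0 < s by rewrite mulr_gt0 // exprn_gt0.
  have sC : s%:C != 0 by rewrite gt_eqF // ltcR.
  have sV0 : 0 <= s^-1 by rewrite invr_ge0 ltW.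
  have /(bbZR bb (ltW s0)) : bnd ((s^-1)%:C *: v) (9 / 10).
    apply: (@neg_sqr_bound _ ((s^-1)%:C *: m)).
    - by rewrite starZR sm.
    - by rewrite starZR !smulE vm !scalerN.
    - by rewrite -(mulVf (lt0r_neq0 s0)); apply: (bbZR bb).
  by rewrite fmorphV scalerA mulfV // scale1r /s -mulrA -exprSr.
apply: (bb_eq0 bb); apply: (bb_lim bb) => d d0.
have : (fun n => t * (9 / 10) ^+ n) @ \oo --> (0 : R).
  rewrite -[0](mulr0 t); apply: cvgMr.
  by apply: cvg_expr; rewrite ger0_norm; lra.
move=> /cvgrPdist_le /(_ d d0)[N _ /(_ N (leqnn N))].
rewrite /= sub0r normrN => h; apply: (bb_le bb (vn N)).
by rewrite add0r; exact: le_trans (ler_norm _) h.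
Qed.

(* Kaplansky: for [h = b'b], [r = (h^2)^(1/2)] and [p = r - h], the element
   [v = b p] satisfies [v'v = - (r^(1/2) p)^2], hence vanishes. *)
Lemma star_sqr_pos b : posel (star b ** b).
Proof.
have [h hE] : exists h, h = star b ** b by exists (star b ** b).
have sh : star h = h by rewrite hE starM starK.
have [r [pr rr rP]] := pos_sqrt (sqr_pos sh).
have hr : h ** r = r ** h by apply: rP; rewrite smulA.
have [w [[sw _] ww wP]] := pos_sqrt pr.
have hw : h ** w = w ** h by exact: wP.
have rw : r ** w = w ** r by exact: wP.
have sr : star r = r by have [] := pr.
have [p pE] : exists p, p = r - h by exists (r - h).
have wp : p ** w = w ** p by rewrite pE !smulE rw hw.
have sp : star p = p by rewrite pE starD starN sr sh.
have hp : h ** p = - (r ** p) by rewrite pE !smulE hr -rr; lmod R[i].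
have v0 : b ** p = 0.
  apply: (@neg_sqr_eq0 _ (w ** p)); first by rewrite starM sw sp wp.
  rewrite starM sp -smulA (smulA (star b)) -hE hp smulNr; congr (- _).
  by rewrite -ww !smulA wp.
have wp0 : w ** p = 0.
  apply: cb_sa_eq0; first by rewrite starM sw sp wp.
  rewrite -[LHS]opprK; apply/eqP; rewrite oppr_eq0; apply/eqP.
  have -> : - ((w ** p) ** (w ** p)) = star p ** (star b ** b ** p).
    rewrite -hE hp sp smulNr; congr (- _).
    by rewrite -ww !smulA wp.
  by rewrite -smulA v0 !smul0r.
(* [p p = r p - h p = 2 r p = 2 w (w p)], which is zero by the preceding step. *)
have p0 : p = 0.
  apply: cb_sa_eq0 => //.
  rewrite {1}pE smulDl smulNl hp opprK -ww -smulA wp0.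
  by rewrite smul0r addr0.
have rh : r = h by apply/eqP; rewrite -subr_eq0 -pE p0.
by rewrite -hE -rh.
Qed.

End PositiveElements.

(** * Unitization and order *)

Section ComplexModulus.
Variable R : realType.
Implicit Types z w : R[i].

Lemma cmodD z w : cmod (z + w) <= cmod z + cmod w.
Proof. by rewrite -lecR rmorphD /= -!cmodE ler_normD. Qed.

Lemma cmod_eq0 z : cmod z <= 0 -> z = 0.
Proof.
move=> z0; apply/eqP; rewrite -normr_eq0 cmodE; apply/eqP; congr _%:C.
by apply/eqP; rewrite eq_le z0 cmod_ge0.
Qed.

Lemma cmodN z : cmod (- z) = cmod z.
Proof. by rewrite /cmod normrN. Qed.

Lemma cmod_conj z : cmod (Num.conj z) = cmod z.
Proof. by rewrite /cmod norm_conjC. Qed.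

Lemma cmod_le z : cmod z <= `|complex.Re z| + `|complex.Im z|.
Proof.
rewrite [z in cmod z]complexE; apply: le_trans (cmodD _ _) _.
rewrite cmodR cmodM cmodR.
have -> : cmod ('i%C : R[i]) = 1.
  by apply: complexI; rewrite -cmodE normc_def /= expr0n expr1n add0r sqrtr1.
by rewrite mul1r.
Qed.

Lemma Re_le_cmod z : `|complex.Re z| <= cmod z.
Proof.
rewrite -lecR -cmodE; case: z => a b /=; rewrite normc_def /= lecR.
by rewrite -sqrtr_sqr ler_sqrt ?lerDl ?sqr_ge0 // addr_ge0 ?sqr_ge0.
Qed.

Lemma Im_le_cmod z : `|complex.Im z| <= cmod z.
Proof.
rewrite -lecR -cmodE; case: z => a b /=; rewrite normc_def /= lecR.
by rewrite -sqrtr_sqr ler_sqrt ?lerDr ?sqr_ge0 // addr_ge0 ?sqr_ge0.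
Qed.

Lemma cauchy_real (u : nat -> R) :
  (forall e : R, 0 < e -> exists N, forall n, (N <= n)%N -> `|u n - u N| <= e) ->
  exists l : R, u @ \oo --> l.
Proof.
move=> h; apply/cvg_ex/cauchy_cvgP/cauchy_ballP => e e0.
have [|N hN] := h (e / 4); first by rewrite divr_gt0.
exists (u @` [set n | (N <= n)%N], u @` [set n | (N <= n)%N]) => /=.
  by split; exists N => // n Nn; exists n.
move=> [x y] /= [[n Nn <-] [m Nm <-]].
rewrite -ball_normE /=.
have := hN n Nn; have := hN m Nm; have := ler_distD (u N) (u n) (u m).
by rewrite (distrC (u N) (u m)) => *; lra.
Qed.

Lemma cauchy_cmod (u : nat -> R[i]) :
  (forall e : R, 0 < e -> exists N, forall n, (N <= n)%N -> cmod (u n - u N) <= e) ->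
  exists l, forall e, 0 < e -> \forall n \near \oo, cmod (u n - l) <= e.
Proof.
move=> h.
have [|a ha] := @cauchy_real (fun n => complex.Re (u n)).
  move=> e /h[N hN]; exists N => n /hN; apply: le_trans.
  by rewrite -raddfB Re_le_cmod.
have [|b hb] := @cauchy_real (fun n => complex.Im (u n)).
  move=> e /h[N hN]; exists N => n /hN; apply: le_trans.
  by rewrite -raddfB Im_le_cmod.
exists (a +i* b) => e e0.
have e2 : 0 < e / 2 by rewrite divr_gt0.
near=> n; apply: le_trans (cmod_le _) _; rewrite !raddfB /= [e]splitr.
apply: lerD; rewrite distrC; near: n.
  by move/cvgrPdist_le: ha; apply.
by move/cvgrPdist_le: hb; apply.
Unshelve. all: by end_near. Qed.

Lemma ler_addgt0M (y c t : R) : 0 <= t ->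
  (forall e, 0 < e -> y <= (c + e) * t) -> y <= c * t.
Proof.
move=> t0 h; apply/ler_addgt0Pr => e e0.
have t1 : 0 < t + 1 by rewrite ltr_wpDl.
have := h (e / (t + 1)); rewrite divr_gt0 // => /(_ isT) /le_trans; apply.
rewrite mulrDl lerD2l mulrAC ler_pdivrMr //.
by apply: ler_wpM2l; [exact: ltW|rewrite lerDl].
Qed.

End ComplexModulus.

Section CStarNorm.
Variables (R : realType) (A : cstarAlgType R).
Implicit Types a b x : A.

Lemma nrmM a b : nrm (a ** b) <= nrm a * nrm b.
Proof. by rewrite -lecR rmorphM /= -!nrmE normsM. Qed.

Lemma nrm_cstar a : nrm (star a ** a) = nrm a ^+ 2.
Proof. by apply: complexI; rewrite rmorphXn /= -!nrmE cstar_identity. Qed.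

Lemma nrmS a : nrm (star a) = nrm a.
Proof. by rewrite /nrm norm_star. Qed.

Lemma nrm_cstar' a : nrm (a ** star a) = nrm a ^+ 2.
Proof. by rewrite -{1}(starK a) nrm_cstar nrmS. Qed.

(** Testing at [x = star a] gives [|a|^2 <= c |a|]. Thus the norm of [A] is that of left
    multiplication, whether or not [A] has a unit. *)
Lemma nrm_le_op a c : 0 <= c -> (forall x, nrm (a ** x) <= c * nrm x) -> nrm a <= c.
Proof.
move=> c0 /(_ (star a)); rewrite nrm_cstar' nrmS expr2.
have [->|a0] := eqVneq (nrm a) 0; first by [].
by rewrite ler_pM2r // lt_neqAle eq_sym a0 nrm_ge0.
Qed.

End CStarNorm.

Section Unitization.
Variables (R : realType) (A : cstarAlgType R).

Definition unitization : Type := (R[i]^o * A)%type.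
HB.instance Definition _ := GRing.Lmodule.on unitization.
Implicit Types u v w : unitization.

Let mul u v : unitization :=
  (u.1 * v.1, u.1 *: v.2 + v.1 *: u.2 + u.2 ** v.2).
Let inv u : unitization := (Num.conj (u.1 : R[i]), star u.2).

Let pair_eq u v : u.1 = v.1 -> u.2 = v.2 -> u = v.
Proof. by case: u v => [? ?] [? ?] /= -> ->. Qed.

Let mulA : associative mul.
Proof.
move=> u v w; apply: pair_eq => /=; first exact: mulrA.
by rewrite !smulE !scalerDr !scalerA; lmod R[i].
Qed.
Let mulDl : left_distributive mul +%R.
Proof.
move=> u v w; apply: pair_eq => /=; first exact: mulrDl.
by rewrite !smulE; lmod R[i].
Qed.
Let mulDr : right_distributive mul +%R.
Proof.
move=> u v w; apply: pair_eq => /=; first exact: mulrDr.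
by rewrite !smulE; lmod R[i].
Qed.
Let mulZl c u v : mul (c *: u) v = c *: mul u v.
Proof.
apply: pair_eq => /=; first by rewrite /GRing.scale /= mulrA.
by rewrite -[c *: u.1]/(c * u.1) !smulE; lmod R[i].
Qed.
Let mulZr c u v : mul u (c *: v) = c *: mul u v.
Proof.
apply: pair_eq => /=; first by rewrite /GRing.scale /= mulrCA.
by rewrite -[c *: v.1]/(c * v.1) !smulE; lmod R[i].
Qed.
Let invK : involutive inv.
Proof. by move=> u; apply: pair_eq => /=; rewrite ?conjCK ?starK. Qed.
Let invD : {morph inv : u v / u + v}.
Proof. by move=> u v; apply: pair_eq => /=; rewrite ?rmorphD ?starD. Qed.
Let invZ c u : inv (c *: u) = (Num.conj c) *: inv u.
Proof. by apply: pair_eq => /=; rewrite ?starZ // rmorphM. Qed.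
Let invM u v : inv (mul u v) = mul (inv v) (inv u).
Proof.
apply: pair_eq => /=; first by rewrite rmorphM mulrC.
by rewrite !starE; lmod R[i].
Qed.

HB.instance Definition _ := Lmodule_isStarAlgebra.Build R[i] unitization
  mulA mulDl mulDr mulZl mulZr invK invD invZ invM.

Definition uone : unitization := (1, 0).
Definition uinj (a : A) : unitization := (0, a).
Definition uact u (x : A) : A := u.1 *: x + u.2 ** x.

(* The first clause makes the bound faithful when [A] is itself unital. *)
Definition ubnd u (c : R) :=
  cmod u.1 <= c /\ forall x, nrm (uact u x) <= c * nrm x.

Lemma uactM u v x : uact (u ** v) x = uact u (uact v x).
Proof. by rewrite /uact /= !smulE; lmod R[i]. Qed.

Lemma uactD u v x : uact (u + v) x = uact u x + uact v x.
Proof. by rewrite /uact /= !smulE; lmod R[i]. Qed.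

Lemma uactZ c u x : uact (c *: u) x = c *: uact u x.
Proof. by rewrite /uact /= -[c *: u.1]/(c * u.1) !smulE; lmod R[i]. Qed.

(** With [star x ** y] as inner product, [A] is a Hilbert module over itself, and [star u] acts as
    the adjoint of [u]. The C*-identity of the unitization is read off from this action. *)
Lemma uact_star u x y : star (uact u x) ** y = star x ** uact (star u) y.
Proof. by rewrite /uact /= !starE !smulE; lmod R[i]. Qed.

(** A bound on [u] controls both coordinates, which reduces completeness of the unitization to that
    of [R[i]] and of [A]. *)
Lemma ubnd_snd u c : ubnd u c -> nrm u.2 <= c + c.
Proof.
move=> [u1 u2]; have c0 : 0 <= c by exact: le_trans (cmod_ge0 _) u1.
apply: nrm_le_op => [|x]; first exact: addr_ge0.
have -> : u.2 ** x = uact u x - u.1 *: x by rewrite /uact addrC addKr.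
apply: le_trans (nrmB _ _) _; rewrite mulrDl; apply: lerD => //.
by rewrite nrmZ ler_wpM2r // nrm_ge0.
Qed.

Lemma ubndW u (c d : R) : cmod u.1 <= c -> nrm u.2 <= d -> 0 <= d -> ubnd u (c + d).
Proof.
move=> uc ud d0; split; first by rewrite (le_trans uc) // lerDl.
move=> x; apply: le_trans (nrmD _ _) _; rewrite mulrDl; apply: lerD.
  by rewrite nrmZ ler_wpM2r // nrm_ge0.
by apply: le_trans (nrmM _ _) _; rewrite ler_wpM2r // nrm_ge0.
Qed.

Lemma ubnd_banach : banach_bound (@smul _ unitization) ubnd.
Proof.
split.
- by move=> a b c; rewrite smulDl smulNl.
- by move=> a b c; rewrite smulDr smulNr.
- move=> a c d [a1 a2] cd; split; first exact: le_trans cd.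
  by move=> x; apply: le_trans (a2 x) _; rewrite ler_wpM2r // nrm_ge0.
- move=> a c h; split; first by apply/ler_addgt0Pr => e /h[].
  move=> x; apply: ler_addgt0M => [|e /h[_ ->]//].
  exact: nrm_ge0.
- split; first by rewrite -(cmodN 0) oppr0 /cmod normr0.
  by move=> x; rewrite /uact /= scale0r smul0l addr0 nrm0 mul0r.
- move=> a a0; apply: pair_eq; first by case: a0 => /cmod_eq0.
  by apply: nrm_le0; rewrite -[0]addr0; exact: ubnd_snd.
- move=> a b c d [a1 a2] [b1 b2]; split.
    by apply: le_trans (cmodD _ _) _; exact: lerD.
  move=> x; rewrite uactD mulrDl; apply: le_trans (nrmD _ _) _.
  exact: lerD.
- move=> z a c [a1 a2]; split; first by rewrite cmodM ler_wpM2l // cmod_ge0.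
  by move=> x; rewrite uactZ nrmZ -mulrA ler_wpM2l // cmod_ge0.
- move=> a b c d [a1 a2] [b1 b2].
  have c0 : 0 <= c by exact: le_trans (cmod_ge0 _) a1.
  split; first by rewrite cmodM ler_pM // cmod_ge0.
  move=> x; rewrite uactM; apply: le_trans (a2 _) _.
  by rewrite -mulrA ler_wpM2l.
- move=> w h.
  have [|l hl] := @cauchy_cmod R (fun n => (w n).1).
    by move=> e /h[N hN]; exists N => n /hN[].
  have [|a /cvg_nrmP ha] := @cauchy_nrm R A (fun n => (w n).2).
    move=> e e0; have [|N hN] := h (e / 2); first by rewrite divr_gt0.
    exists N => n /hN/ubnd_snd; rewrite /=.
    by rewrite -splitr.
  exists (l, a) => e e0; have e2 : 0 < e / 2 by rewrite divr_gt0.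
  near=> n; rewrite [e]splitr; apply: ubndW => /=; last exact: ltW.
    by near: n; exact: hl.
  by near: n; exact: ha.
Unshelve. all: by end_near. Qed.

(** [|u x|^2] is the norm of [star x ** (star u ** u) x], which gives the C*-identity. The bound for
    [star u] follows from [|star u x|^2 <= |x| |u (star u x)|] by cancelling [|star u x|]. *)
Lemma ubnd_cstar : cstar_bound uone ubnd.
Proof.
split; first exact: ubnd_banach.
- move=> u; split; apply: pair_eq => /=.
  + exact: mul1r.
  + by rewrite scale1r scaler0 smul0l !addr0.
  + exact: mulr1.
  + by rewrite scaler0 smul0r scale1r add0r addr0.
- split; first by rewrite /cmod normr1.
  by move=> x; rewrite /uact /= scale1r smul0l addr0 mul1r.
- by move=> a t [a1 _]; exact: le_trans (cmod_ge0 _) a1.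
- by move=> a; exists (cmod a.1 + nrm a.2); apply: ubndW => //; exact: nrm_ge0.
- move=> u t [u1 u2]; have t0 : 0 <= t by exact: le_trans (cmod_ge0 _) u1.
  split=> [|x]; first by rewrite /= cmod_conj.
  have [->|y0] := eqVneq (nrm (uact (star u) x)) 0.
    by rewrite mulr_ge0 // nrm_ge0.
  have yp : 0 < nrm (uact (star u) x) by rewrite lt_neqAle eq_sym y0 nrm_ge0.
  rewrite -(ler_pM2r yp) -expr2 -nrm_cstar uact_star starK.
  apply: le_trans (nrmM _ _) _; rewrite nrmS mulrC.
  apply: le_trans (ler_wpM2r (nrm_ge0 x) (u2 _)) _.
  by rewrite mulrAC.
- move=> u t t0 [u1 u2]; split.
    move: u1; rewrite /= cmodM cmod_conj -expr2 ler_pXn2r // nnegrE //.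
    exact: cmod_ge0.
  move=> x; rewrite -(@ler_pXn2r _ 2) ?nnegrE ?mulr_ge0 ?nrm_ge0 //.
  rewrite -nrm_cstar uact_star -uactM exprMn.
  apply: le_trans (nrmM _ _) _; rewrite nrmS mulrC [nrm x ^+ 2]expr2 mulrA.
  by rewrite ler_wpM2r ?nrm_ge0.
Qed.

Lemma uinjM a b : uinj (a ** b) = uinj a ** uinj b.
Proof. by apply: pair_eq => /=; rewrite ?mul0r // !scale0r !add0r. Qed.

Lemma uinjS a : uinj (star a) = star (uinj a).
Proof. by apply: pair_eq => //=; rewrite conjC0. Qed.

Lemma uinjD a b : uinj (a + b) = uinj a + uinj b.
Proof. by apply: pair_eq => //=; rewrite addr0. Qed.

Lemma uinjN a : uinj (- a) = - uinj a.
Proof. by apply: pair_eq => //=; rewrite oppr0. Qed.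

Lemma uact_inj a x : uact (uinj a) x = a ** x.
Proof. by rewrite /uact /= scale0r add0r. Qed.

Lemma uact_one x : uact uone x = x.
Proof. by rewrite /uact /= scale1r smul0l addr0. Qed.

Lemma ubnd_inj a c : nrm a <= c -> ubnd (uinj a) c.
Proof.
move=> ac; rewrite -[c]add0r; apply: ubndW => //=.
  by rewrite /cmod normr0.
exact: le_trans (nrm_ge0 _) ac.
Qed.

Lemma ubnd_injP a c : ubnd (uinj a) c -> nrm a <= c.
Proof.
move=> [c0 h]; apply: nrm_le_op => [|x]; last by rewrite -uact_inj.
exact: le_trans (cmod_ge0 _) c0.
Qed.

End Unitization.

Section CStarOrder.
Variables (R : realType) (A : cstarAlgType R).
Implicit Types a b c d h k s x y : A.
Let cb := ubnd_cstar A.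
Local Notation upos := (posel (uone A) (@ubnd R A)).

Lemma positive_star a : positive a -> star a = a.
Proof. by case=> b _ <-; rewrite starM starK. Qed.

Lemma star_sqr_positive b : positive (star b ** b).
Proof. by exists b. Qed.

Lemma upos_inj a : positive a -> upos (uinj a).
Proof. by case=> b _ <-; rewrite uinjM uinjS; exact: star_sqr_pos cb _. Qed.

(** The root of [(0, a)] in the unitization has a scalar part with square [0], so the root already
    lies in [A]. *)
Lemma upos_injP a : upos (uinj a) -> positive a.
Proof.
move=> /(pos_sqrt cb)[[l y] [[[_ sy] _] [ll]]].
have -> : l = 0 by apply/eqP; rewrite -[_ == _]orbb -mulf_eq0 ll.
rewrite !scale0r !add0r => yy _; exists y => //.
by rewrite sy.
Qed.

Lemma positiveD a b : positive a -> positive b -> positive (a + b).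
Proof.
move=> /upos_inj pa /upos_inj pb; apply: upos_injP.
by rewrite uinjD; exact: (posD cb).
Qed.

Lemma positive0 : positive (0 : A).
Proof. by exists 0 => //; rewrite smul0r. Qed.

Lemma positiveZ (r : R) a : 0 <= r -> positive a -> positive (r%:C *: a).
Proof.
move=> r0 [b _ <-]; exists ((Num.sqrt r)%:C *: b) => //.
rewrite starZ !smulE scalerA; congr (_ *: _).
rewrite conj_Creal; last by rewrite complex_real.
by rewrite -rmorphM /= -expr2 sqr_sqrtr.
Qed.

Lemma positive_sum (I : Type) (r : seq I) (F : I -> A) :
  (forall i, positive (F i)) -> positive (\sum_(i <- r) F i).
Proof.
by move=> h; elim/big_ind: _ => //; [exact: positive0|exact: positiveD].
Qed.

Lemma positive_nrm_le x y : positive x -> positive (y - x) -> nrm x <= nrm y.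
Proof.
move=> /upos_inj px /upos_inj; rewrite uinjD uinjN => pyx.
apply/ler_addgt0Pr => e e0; apply: ubnd_injP.
apply: (pos_bound_mono cb _ px pyx); first by rewrite ltr_wpDl // nrm_ge0.
by apply: ubnd_inj; rewrite lerDl ltW.
Qed.

Lemma one_sub_root s : star s = s -> nrm s <= 1 ->
  exists c : unitization A, star c = c /\ c ** c = uone A - uinj s.
Proof.
move=> ss s1; have [||c [sc cc _ _]] := sqrt_one_sub cb (k := uinj s).
- by rewrite -uinjS ss.
- exact: ubnd_inj.
by exists c.
Qed.

(** The root [c] of [1 - s] lives in the unitization, but [d = c b] lies in [A] because [c] acts on
    [A]. Order inequalities in a non-unital [A] are obtained through this device. *)
Lemma sub_conj_root s b : star s = s -> nrm s <= 1 ->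
  exists d, star d ** d = star b ** (b - s ** b).
Proof.
move=> ss s1; have [c [sc cc]] := one_sub_root ss s1.
exists (uact c b); rewrite uact_star sc -uactM cc uactD uact_one.
by rewrite -uinjN uact_inj smulNl.
Qed.

Lemma positive_conj_sub s t b : star s = s -> nrm s <= t ->
  positive (t%:C *: (star b ** b) - star b ** s ** b).
Proof.
move=> ss st; have t0 : 0 <= t by exact: le_trans (nrm_ge0 _) st.
have [t_eq0|tn0] := eqVneq t 0.
  have -> : s = 0 by apply: nrm_le0; rewrite -t_eq0.
  by rewrite t_eq0 scale0r smul0r smul0l subr0; exact: positive0.
have tp : 0 < t by rewrite lt_neqAle eq_sym tn0.
have [||d dE] := @sub_conj_root ((t^-1)%:C *: s) b.
- by rewrite starZ ss conj_Creal // complex_real.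
- by rewrite nrmZR gtr0_norm ?invr_gt0 // mulrC ler_pdivrMr // mul1r.
have -> : t%:C *: (star b ** b) - star b ** s ** b = t%:C *: (star d ** d).
  rewrite dE !smulE scalerBr scalerA -rmorphM /= mulfV //.
  by rewrite scale1r.
by apply: positiveZ => //; exact: star_sqr_positive.
Qed.

Lemma positive_conj_sub_star c t b : nrm c <= t ->
  positive ((t ^+ 2)%:C *: (star b ** b) - star (c ** b) ** (c ** b)).
Proof.
move=> ct; rewrite starM !smulA -(smulA (star b)).
apply: positive_conj_sub; first by rewrite starM starK.
by rewrite nrm_cstar ler_pXn2r // nnegrE ?nrm_ge0 // (le_trans (nrm_ge0 c)).
Qed.

End CStarOrder.

(** * Contractivity of homomorphisms *)

Section StarHomBound.
Variables (R : realType) (A B : cstarAlgType R) (f : A -> B).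
Hypothesis hf : star_hom f.

Let fuZ : forall (l : R[i]) a b, f (l *: a + b) = l *: f a + f b.
Proof. by case: hf. Qed.
Let f0 : f 0 = 0.
Proof. by have := fuZ (-1) 0 0; rewrite !scaleN1r !addNr. Qed.
Let fD a b : f (a + b) = f a + f b.
Proof. by rewrite -[a]scale1r fuZ !scale1r. Qed.
Let fZ l a : f (l *: a) = l *: f a.
Proof. by rewrite -[X in f X]addr0 fuZ f0 addr0. Qed.

Let fu (u : unitization A) : unitization B := (u.1, f u.2).

Let fuM u v : fu (u ** v) = fu u ** fu v.
Proof.
have [_ fM _] := hf.
by rewrite /fu /= !fD !fZ fM.
Qed.

(** For [t > |a|], [1 - a' a / t^2] has a self-adjoint root [c]. Its image under the unital
    extension [fu] is a root of [1 - f(a)' f(a) / t^2], so [t^2 y' y] dominates [(f(a) y)' (f(a) y)]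
    for every [y]. *)
Lemma star_hom_nrm_le a : nrm (f a) <= nrm a.
Proof.
have [_ fM fS] := hf.
apply/ler_addgt0Pr => e e0; set t := nrm a + e.
have t0 : 0 < t by rewrite ltr_wpDl // nrm_ge0.
have [||c [sc cc]] := one_sub_root (s := ((t ^+ 2)^-1)%:C *: (star a ** a)).
- by rewrite starZ starM starK conj_Creal // complex_real.
- rewrite nrmZR ger0_norm ?invr_ge0 ?sqr_ge0 // mulrC ler_pdivrMr ?exprn_gt0 //.
  by rewrite mul1r nrm_cstar ler_pXn2r // ?nnegrE ?nrm_ge0 ?lerDl ?ltW.
apply: nrm_le_op => [|y]; first exact: ltW.
rewrite -(@ler_pXn2r _ 2) ?nnegrE ?mulr_ge0 ?nrm_ge0 ?(ltW t0) // exprMn -!nrm_cstar.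
have t2 : 0 < t ^+ 2 by rewrite exprn_gt0.
rewrite -[t ^+ 2]ger0_norm ?sqr_ge0 // -nrmZR.
apply: positive_nrm_le; first exact: star_sqr_positive.
have sfc : star (fu c) = fu c by rewrite -[in RHS]sc /fu /= fS.
suff -> : (t ^+ 2)%:C *: (star y ** y) - star (f a ** y) ** (f a ** y) =
    (t ^+ 2)%:C *: (star (uact (fu c) y) ** uact (fu c) y).
  by apply: positiveZ; [exact: ltW|exact: star_sqr_positive].
have fN x : f (- x) = - f x by rewrite -scaleN1r fZ scaleN1r.
have E : uact (fu (c ** c)) y =
    y - ((t ^+ 2)^-1)%:C *: (star (f a) ** f a ** y).
  by rewrite cc /fu /uact /= subr0 scale1r sub0r fN fZ fM fS smulNl smulZl.
rewrite uact_star sfc -uactM -fuM E smulDr smulNr smulZr scalerBr scalerA.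
by rewrite -rmorphM /= mulfV ?gt_eqF // scale1r starM !smulA.
Qed.

End StarHomBound.

(** * Hilbert modules and square roots of matrices *)

Section StarAlgebraSums.
Variables (C : numClosedFieldType) (A : starAlgType C).
Implicit Types a b : A.

Lemma smul_suml (I : Type) (r : seq I) (P : pred I) (F : I -> A) a :
  (\sum_(i <- r | P i) F i) ** a = \sum_(i <- r | P i) (F i ** a).
Proof. by elim/big_rec2: _ => [|i y x _ <-]; rewrite ?smul0l ?smulDl. Qed.

Lemma smul_sumr (I : Type) (r : seq I) (P : pred I) (F : I -> A) a :
  a ** (\sum_(i <- r | P i) F i) = \sum_(i <- r | P i) (a ** F i).
Proof. by elim/big_rec2: _ => [|i y x _ <-]; rewrite ?smul0r ?smulDr. Qed.

Lemma star_sum (I : Type) (r : seq I) (P : pred I) (F : I -> A) :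
  star (\sum_(i <- r | P i) F i) = \sum_(i <- r | P i) star (F i).
Proof. by elim/big_rec2: _ => [|i y x _ <-]; rewrite ?star0 ?starD. Qed.

End StarAlgebraSums.

Lemma nrm_sum (R : realType) (V : normedModType R[i]) (I : Type) (r : seq I)
    (P : pred I) (F : I -> V) :
  nrm (\sum_(i <- r | P i) F i) <= \sum_(i <- r | P i) nrm (F i).
Proof.
elim/big_rec2: _ => [|i y x _ h]; first by rewrite nrm0.
by apply: le_trans (nrmD _ _) _; rewrite lerD2l.
Qed.

Lemma starZR (R : realType) (A : starAlgType R[i]) (r : R) (a : A) :
  star (r%:C *: a) = r%:C *: star a.
Proof. by rewrite starZ conj_Creal // complex_real. Qed.


Section HilbertModule.
Variables (R : realType) (A : cstarAlgType R) (I : finType).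
Implicit Types (x y z : I -> A) (X Y : I -> I -> A) (s t : R).

Definition ip x y : A := \sum_i star (x i) ** y i.
Definition hn x : R := Num.sqrt (nrm (ip x x)).

Lemma ipDr x y z : ip x (y + z) = ip x y + ip x z.
Proof. by rewrite -big_split /=; apply: eq_bigr => i _; exact: smulDr. Qed.

Lemma ipZr (c : R[i]) x y : ip x (c *: y) = c *: ip x y.
Proof. by rewrite scaler_sumr; apply: eq_bigr => i _; rewrite -smulZr. Qed.

Lemma ip_star x y : star (ip x y) = ip y x.
Proof. by rewrite star_sum; apply: eq_bigr => i _; rewrite starM starK. Qed.

Lemma ipDl x y z : ip (y + z) x = ip y x + ip z x.
Proof. by rewrite -!(ip_star x) ipDr starD. Qed.

Lemma ipZl (c : R[i]) x y : ip (c *: x) y = Num.conj c *: ip x y.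
Proof. by rewrite -!(ip_star y) ipZr starZ. Qed.

Lemma ipNr x y : ip x (- y) = - ip x y.
Proof. by rewrite -scaleN1r ipZr scaleN1r. Qed.

Lemma ipNl x y : ip (- x) y = - ip x y.
Proof. by rewrite -!(ip_star y) ipNr starN. Qed.

Lemma ip_mulr x y a : ip x (fun i => y i ** a) = ip x y ** a.
Proof. by rewrite smul_suml; apply: eq_bigr => i _; rewrite smulA. Qed.

Lemma ip_mull x y a : ip (fun i => x i ** a) y = star a ** ip x y.
Proof. by rewrite -[LHS]ip_star ip_mulr starM ip_star. Qed.

Lemma positive_ip x : positive (ip x x).
Proof. by apply: positive_sum => i; exact: star_sqr_positive. Qed.

Lemma hn_ge0 x : 0 <= hn x. Proof. exact: sqrtr_ge0. Qed.

Lemma hnE x : hn x ^+ 2 = nrm (ip x x).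
Proof. by rewrite sqr_sqrtr // nrm_ge0. Qed.

Lemma hn_le x s : 0 <= s -> nrm (ip x x) <= s ^+ 2 -> hn x <= s.
Proof.
by move=> s0; rewrite -hnE ler_pXn2r // nnegrE hn_ge0.
Qed.

Lemma hn_mono x y : positive (ip y y - ip x x) -> hn x <= hn y.
Proof.
move=> h; apply: hn_le; first exact: hn_ge0.
by rewrite hnE; apply: positive_nrm_le => //; exact: positive_ip.
Qed.

(** With [c = <x, y> / t], add the positive elements [<x c - y, x c - y>] and
    [t c' c - c' <x, x> c]. The terms in [<x, x>] cancel, and [t] times the sum is the claimed
    element. *)
Lemma ip_cauchy_schwarz x y t : 0 < t -> nrm (ip x x) <= t ->
  positive (t%:C *: ip y y - star (ip x y) ** ip x y).
Proof.
move=> t0 xt; pose c := (t^-1)%:C *: ip x y.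
have /(positiveZ (ltW t0)) := positiveD
  (positive_ip ((fun i => x i ** c) + (-1) *: y))
  (positive_conj_sub c (ip_star x x) xt).
have tC : t%:C != 0 by rewrite gt_eqF // ltcR.
congr positive; rewrite !(ipDl, ipDr, ipZl, ipZr, ip_mulr, ip_mull).
rewrite -(ip_star x y) rmorphN1 !smulE -![c]/((t^-1)%:C *: ip x y) !(starZR, smulZl, smulZr).
rewrite fmorphV.
by lmod R[i].
Qed.

Lemma nrm_ip x y : nrm (ip x y) <= hn x * hn y.
Proof.
rewrite -(@ler_pXn2r _ 2) ?nnegrE ?mulr_ge0 ?hn_ge0 ?nrm_ge0 //.
rewrite exprMn !hnE; apply: ler_addgt0M => [|e e0]; first exact: nrm_ge0.
have t0 : 0 < nrm (ip x x) + e by rewrite ltr_wpDl // nrm_ge0.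
have te : nrm (ip x x) <= nrm (ip x x) + e by rewrite lerDl ltW.
have /(positive_nrm_le (star_sqr_positive _)) := ip_cauchy_schwarz y t0 te.
by rewrite nrm_cstar nrmZR gtr0_norm.
Qed.

Lemma hnD x y : hn (x + y) <= hn x + hn y.
Proof.
apply: hn_le; first by rewrite addr_ge0 ?hn_ge0.
rewrite ipDl !ipDr -(ip_star x y) sqrrD !hnE.
have := nrm_ip x y; have := nrmS (ip x y).
set a := ip x x; set b := ip x y; set d := ip y y => h1 h2.
have := nrmD (a + b) (star b + d); have := nrmD a b; have := nrmD (star b) d.
by rewrite mulr2n => *; lra.
Qed.

Lemma hnZ (c : R[i]) x : hn (c *: x) = cmod c * hn x.
Proof.
rewrite /hn ipZl ipZr scalerA nrmZ cmodM cmod_conj -expr2 sqrtrM ?sqr_ge0 //.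
by rewrite sqrtr_sqr ger0_norm // cmod_ge0.
Qed.

Lemma hnN x : hn (- x) = hn x.
Proof. by rewrite -scaleN1r hnZ cmodN /cmod normr1 mul1r. Qed.

Lemma hnB x y : hn (x - y) <= hn x + hn y.
Proof. by rewrite -(hnN y) hnD. Qed.

Lemma nrm_le_hn x i : nrm (x i) <= hn x.
Proof.
rewrite -(@ler_pXn2r _ 2) ?nnegrE ?hn_ge0 ?nrm_ge0 // hnE -nrm_cstar.
apply: positive_nrm_le; first exact: star_sqr_positive.
rewrite /ip (bigD1 i) //= addrAC subrr add0r.
by rewrite big_mkcond; apply: positive_sum => j; case: ifP => // _;
  [exact: star_sqr_positive|exact: positive0].
Qed.

Lemma hn_le_sum x : hn x <= \sum_i nrm (x i).
Proof.
have s0 : 0 <= \sum_i nrm (x i) by apply: sumr_ge0 => i _; exact: nrm_ge0.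
apply: hn_le => //; apply: le_trans (nrm_sum _ _ _) _.
rewrite expr2 mulr_suml; apply: ler_sum => i _; rewrite nrm_cstar expr2.
apply: ler_wpM2l; first exact: nrm_ge0.
by rewrite (bigD1 i) //= lerDl; apply: sumr_ge0 => j _; exact: nrm_ge0.
Qed.

(** The sum is [<w, a w>] for the diagonal operator [a], so Cauchy-Schwarz reduces the claim to
    [|a w| <= t |w|], which is checked entrywise. *)
Lemma nrm_conj_sum_le (w a : I -> A) t : (forall i, nrm (a i) <= t) ->
  nrm (\sum_i star (w i) ** a i ** w i) <= t * nrm (\sum_i star (w i) ** w i).
Proof.
(* A negative [t] bounds norms only over an empty index type, where both sums vanish. *)
move=> at_; have [t0|t0] := leP 0 t; last first.
  have nI : forall i : I, False.
    by move=> i; have := le_trans (nrm_ge0 _) (at_ i); rewrite leNgt t0.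
  by rewrite !big1 ?nrm0 ?mulr0 // => i; case: (nI i).
have -> : \sum_i star (w i) ** a i ** w i = ip w (fun i => a i ** w i).
  by apply: eq_bigr => i _; rewrite smulA.
apply: le_trans (nrm_ip _ _) _; rewrite -[\sum_i _]/(ip w w) -hnE expr2 mulrA mulrC.
rewrite ler_wpM2r ?hn_ge0 //.
have -> : t * hn w = hn (t%:C *: w) by rewrite hnZ cmodR ger0_norm.
apply: hn_mono; rewrite ipZl ipZr conj_Creal ?complex_real // scalerA -rmorphM /=.
rewrite /ip scaler_sumr -sumrB; apply: positive_sum => i.
exact: positive_conj_sub_star.
Qed.

Definition mact X x : I -> A := fun i => \sum_j X i j ** x j.

Definition delta (j : I) (a : A) : I -> A := fun i => if i == j then a else 0.

Lemma mact_delta X j a i : mact X (delta j a) i = X i j ** a.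
Proof.
rewrite /mact (bigD1 j) //= /delta eqxx big1 ?addr0 // => k /negbTE kj.
by rewrite kj smul0r.
Qed.

Lemma hn_delta j a : hn (delta j a) = nrm a.
Proof.
rewrite /hn /ip (bigD1 j) //= /delta eqxx big1 ?addr0 => [|k /negbTE kj].
  by rewrite nrm_cstar sqrtr_sqr ger0_norm // nrm_ge0.
by rewrite kj smul0r.
Qed.

Lemma nrm_entry_le X c : 0 <= c -> (forall x, hn (mact X x) <= c * hn x) ->
  forall i j, nrm (X i j) <= c.
Proof.
move=> c0 h i j; apply: nrm_le_op => // a.
by rewrite -mact_delta -(hn_delta j a); apply: le_trans (h _); exact: nrm_le_hn.
Qed.

Lemma hn_mact_le X x : hn (mact X x) <= (\sum_i \sum_j nrm (X i j)) * hn x.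
Proof.
apply: le_trans (hn_le_sum _) _; rewrite mulr_suml; apply: ler_sum => i _.
apply: le_trans (nrm_sum _ _ _) _; rewrite mulr_suml; apply: ler_sum => j _.
apply: le_trans (nrmM _ _) _; apply: ler_wpM2l; first exact: nrm_ge0.
exact: nrm_le_hn.
Qed.


Definition gram (K : finType) (W : K -> I -> A) : I -> I -> A :=
  fun i j => \sum_k star (W k i) ** W k j.

(* [0 <= X] in the form [|t - X| <= t], which passes to averages and limits. *)
Definition psdm t X := (forall i j, star (X i j) = X j i) /\
  forall x, hn (t%:C *: x - mact X x) <= t * hn x.

Lemma ip_mact_gram (K : finType) (W : K -> I -> A) x y :
  ip x (mact (gram W) y) =
  \sum_k star (\sum_i W k i ** x i) ** (\sum_j W k j ** y j).
Proof.
transitivity (\sum_i \sum_j \sum_k star (x i) ** star (W k i) ** W k j ** y j).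
  apply: eq_bigr => i _; rewrite smul_sumr; apply: eq_bigr => j _.
  rewrite smul_suml smul_sumr; apply: eq_bigr => k _.
  by rewrite !smulA.
rewrite [RHS](eq_bigr (fun k => \sum_i \sum_j star (x i) ** star (W k i) ** W k j ** y j)).
  rewrite [RHS]exchange_big /=; apply: eq_bigr => i _; exact: exchange_big.
move=> k _; rewrite star_sum smul_suml; apply: eq_bigr => i _.
rewrite smul_sumr; apply: eq_bigr => j _.
by rewrite starM !smulA.
Qed.

End HilbertModule.

(* For [T = W'W] with [WW' <= t], where [W'] is the adjoint of [W], one has
   [(t - T)^2 = t^2 - 2tT + W'(WW')W <= t^2]. *)
Lemma gram_psdm (R : realType) (A : cstarAlgType R) (I K : finType)
    (W : K -> I -> A) (s : R) : 0 < s ->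
  (forall i, nrm (gram W i i) <= s) -> psdm ((#|I|.+1)%:R * s) (gram W).
Proof.
move=> s0 Ws; set t := _ * s.
have t0 : 0 < t by rewrite mulr_gt0.
split=> [i j|x].
  by rewrite star_sum; apply: eq_bigr => k _; rewrite starM starK.
pose Tx := mact (gram W) x; pose Wx k := \sum_j W k j ** x j.
have xTx : ip x Tx = ip Wx Wx by exact: ip_mact_gram.
have TxE i : Tx i = ip (fun k => W k i) Wx.
  rewrite /Tx /mact (eq_bigr (fun j => \sum_k star (W k i) ** W k j ** x j)); last first.
    by move=> j _; rewrite smul_suml.
  rewrite exchange_big; apply: eq_bigr => k _; rewrite smul_sumr.
  by apply: eq_bigr => j _; rewrite smulA.
(* Each [(T x)_i] is an inner product with [W x], so its square is at most [s <W x, W x>]; the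
   [#|I|] entries use up [#|I| s]. The extra [s] keeps [t] positive when [I] is empty. *)
have TT : positive (t%:C *: ip x Tx - ip Tx Tx).
  have -> : t%:C *: ip x Tx - ip Tx Tx = s%:C *: ip Wx Wx +
      \sum_i (s%:C *: ip Wx Wx - star (Tx i) ** Tx i).
    rewrite sumrB sumr_const xTx addrA; congr (_ - _).
    have -> : (s%:C *: ip Wx Wx) *+ #|I| = #|I|%:R *: (s%:C *: ip Wx Wx).
      by rewrite scaler_nat.
    by rewrite /t -natr1 rmorphM rmorphD /= rmorph_nat; lmod R[i].
  apply: positiveD; first by apply: positiveZ; [exact: ltW|exact: positive_ip].
  apply: positive_sum => i; rewrite TxE; apply: ip_cauchy_schwarz => //.
  exact: Ws.
have Txx : ip Tx x = ip x Tx.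
  by rewrite -ip_star xTx positive_star //; exact: positive_ip.
have -> : t * hn x = hn (t%:C *: x) by rewrite hnZ cmodR ger0_norm // ltW.
have key (T : I -> A) : ip T x = ip x T ->
    ip (t%:C *: x) (t%:C *: x) - ip (t%:C *: x - T) (t%:C *: x - T) =
    t%:C *: ip x T - ip T T + t%:C *: ip x T.
  move=> Tx'; rewrite !(ipDl, ipDr, ipZl, ipZr, ipNl, ipNr) Tx'.
  by rewrite !conj_Creal ?complex_real //; lmod R[i].
apply: hn_mono; rewrite (key _ Txx).
by apply: positiveD => //; rewrite xTx; apply: positiveZ; [exact: ltW|exact: positive_ip].
Qed.

Section MatrixSquareRoot.
Variables (R : realType) (A : cstarAlgType R) (I : finType).
Implicit Types (x y : I -> A) (X Y : I -> I -> A) (s t : R).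

(** The unitization of the algebra of matrices over [A], acting on [A^I]. Banach bounds are enough
    for it, because positivity of a matrix is used in the metric form [psdm]. *)
Let M := (R[i]^o * (I -> I -> A))%type.
Implicit Types u v w : M.

Let mul u v : M := (u.1 * v.1,
  fun i j => u.1 *: v.2 i j + v.1 *: u.2 i j + \sum_k u.2 i k ** v.2 k j).

Let uact u x : I -> A := u.1 *: x + mact u.2 x.

Let bnd u (c : R) := cmod u.1 <= c /\ forall x, hn (uact u x) <= c * hn x.

Let mactD X Y x : mact (X + Y) x = mact X x + mact Y x.
Proof.
apply/funext => i; rewrite /mact -[RHS]big_split /=; apply: eq_bigr => j _.
exact: smulDl.
Qed.

Let mactZ c X x : mact (c *: X) x = c *: mact X x.
Proof.
apply/funext => i; rewrite /mact [RHS]scaler_sumr; apply: eq_bigr => j _.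
exact: smulZl.
Qed.

Let uactD u v x : uact (u + v) x = uact u x + uact v x.
Proof. by rewrite /uact /= mactD; lmod R[i]. Qed.

Let uactZ c u x : uact (c *: u) x = c *: uact u x.
Proof. by rewrite /uact /= mactZ -[c *: u.1]/(c * u.1); lmod R[i]. Qed.

Let uactM u v x : uact (mul u v) x = uact u (uact v x).
Proof.
apply/funext => i.
transitivity ((u.1 * v.1) *: x i + \sum_j (u.1 *: (v.2 i j ** x j) +
  v.1 *: (u.2 i j ** x j) + \sum_k u.2 i k ** v.2 k j ** x j)).
  congr (_ + _); apply: eq_bigr => j _.
  by rewrite !smulDl !smulZl smul_suml.
transitivity (u.1 *: (v.1 *: x i + \sum_j v.2 i j ** x j) +
  \sum_k (v.1 *: (u.2 i k ** x k) + \sum_j u.2 i k ** v.2 k j ** x j)).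
  rewrite !big_split /= -!scaler_sumr [X in _ + (_ + X)]exchange_big /=.
  set s1 := \sum_j v.2 i j ** x j; set s2 := \sum_j u.2 i j ** x j.
  set s3 := \sum_j \sum_k u.2 i j ** v.2 j k ** x k.
  by lmod R[i].
congr (_ + _); apply: eq_bigr => k _.
rewrite -[RHS]/(u.2 i k ** (v.1 *: x k + \sum_j v.2 k j ** x j)).
rewrite smulDr smulZr smul_sumr; congr (_ + _).
by apply: eq_bigr => j _; rewrite smulA.
Qed.

Let bnd_snd u c : bnd u c -> forall i j, nrm (u.2 i j) <= c + c.
Proof.
move=> [u1 u2]; have c0 : 0 <= c by exact: le_trans (cmod_ge0 _) u1.
apply: nrm_entry_le => [|x]; first exact: addr_ge0.
have -> : mact u.2 x = uact u x - u.1 *: x by rewrite /uact addrC addKr.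
apply: le_trans (hnB _ _) _; rewrite mulrDl; apply: lerD => //.
by rewrite hnZ ler_wpM2r // hn_ge0.
Qed.

Let bndW u (c d : R) : cmod u.1 <= c -> \sum_i \sum_j nrm (u.2 i j) <= d ->
  bnd u (c + d).
Proof.
move=> uc ud.
have d0 : 0 <= d.
  apply: le_trans ud; apply: sumr_ge0 => i _; apply: sumr_ge0 => j _.
  exact: nrm_ge0.
split; first by rewrite (le_trans uc) // lerDl.
move=> x; apply: le_trans (hnD _ _) _; rewrite mulrDl; apply: lerD.
  by rewrite hnZ ler_wpM2r // hn_ge0.
by apply: le_trans (hn_mact_le _ _) _; rewrite ler_wpM2r // hn_ge0.
Qed.

Let bb : banach_bound mul bnd.
Proof.
have pair_eq u v : u.1 = v.1 -> u.2 = v.2 -> u = v.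
  by case: u v => [? ?] [? ?] /= -> ->.
split.
- move=> a b c; apply: pair_eq; first exact: mulrBl.
  apply/funext => i; apply/funext => j.
  rewrite -[RHS]/(a.1 *: c.2 i j + c.1 *: a.2 i j + \sum_k a.2 i k ** c.2 k j -
    (b.1 *: c.2 i j + c.1 *: b.2 i j + \sum_k b.2 i k ** c.2 k j)).
  rewrite -[LHS]/((a.1 - b.1) *: c.2 i j + c.1 *: (a.2 i j - b.2 i j) +
    \sum_k (a.2 i k - b.2 i k) ** c.2 k j).
  have -> : \sum_k (a.2 i k - b.2 i k) ** c.2 k j =
      \sum_k a.2 i k ** c.2 k j - \sum_k b.2 i k ** c.2 k j.
    by rewrite -sumrB; apply: eq_bigr => k _; rewrite smulDl smulNl.
  by lmod R[i].
- move=> a b c; apply: pair_eq; first exact: mulrBr.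
  apply/funext => i; apply/funext => j.
  rewrite -[RHS]/(c.1 *: a.2 i j + a.1 *: c.2 i j + \sum_k c.2 i k ** a.2 k j -
    (c.1 *: b.2 i j + b.1 *: c.2 i j + \sum_k c.2 i k ** b.2 k j)).
  rewrite -[LHS]/(c.1 *: (a.2 i j - b.2 i j) + (a.1 - b.1) *: c.2 i j +
    \sum_k c.2 i k ** (a.2 k j - b.2 k j)).
  have -> : \sum_k c.2 i k ** (a.2 k j - b.2 k j) =
      \sum_k c.2 i k ** a.2 k j - \sum_k c.2 i k ** b.2 k j.
    by rewrite -sumrB; apply: eq_bigr => k _; rewrite smulDr smulNr.
  by lmod R[i].
- move=> a c d [a1 a2] cd; split; first exact: le_trans cd.
  by move=> x; apply: le_trans (a2 x) _; rewrite ler_wpM2r // hn_ge0.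
- move=> a c h; split; first by apply/ler_addgt0Pr => e /h[].
  move=> x; apply: ler_addgt0M => [|e /h[_ ->]//].
  exact: hn_ge0.
- have := @bndW 0 0 0; rewrite addr0; apply; first by rewrite /cmod normr0.
  by rewrite big1 // => i _; rewrite big1 // => j _; rewrite nrm0.
- move=> a a0; apply: pair_eq; first by case: a0 => /cmod_eq0.
  apply/funext => i; apply/funext => j.
  by apply: nrm_le0; rewrite -[0]addr0; exact: bnd_snd.
- move=> a b c d [a1 a2] [b1 b2]; split.
    by apply: le_trans (cmodD _ _) _; exact: lerD.
  move=> x; rewrite uactD mulrDl; apply: le_trans (hnD _ _) _.
  exact: lerD.
- move=> z a c [a1 a2]; split; first by rewrite cmodM ler_wpM2l // cmod_ge0.
  by move=> x; rewrite uactZ hnZ -mulrA ler_wpM2l // cmod_ge0.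
- move=> a b c d [a1 a2] [b1 b2].
  have c0 : 0 <= c by exact: le_trans (cmod_ge0 _) a1.
  split; first by rewrite cmodM ler_pM // cmod_ge0.
  move=> x; rewrite uactM; apply: le_trans (a2 _) _.
  by rewrite -mulrA ler_wpM2l.
- move=> w h.
  have [|l hl] := @cauchy_cmod R (fun n => (w n).1).
    by move=> e /h[N hN]; exists N => n /hN[].
  have aex i j : exists l : A, (fun n => (w n).2 i j) @ \oo --> l.
    apply: cauchy_nrm => e e0; have [|N hN] := h (e / 2); first by rewrite divr_gt0.
    exists N => n /hN/bnd_snd/(_ i j).
    by rewrite -splitr.
  pose a i j := projT1 (cid (aex i j)).
  have ha i j : (fun n => (w n).2 i j) @ \oo --> a i j.
    exact: (projT2 (cid (aex i j))).
  exists (l, a) => e e0; have e2 : 0 < e / 2 by rewrite divr_gt0.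
  pose d := e / 2 / (#|I|%:R * #|I|%:R + 1).
  have d1 : 0 < #|I|%:R * #|I|%:R + 1 :> R by rewrite ltr_wpDl // mulr_ge0.
  have d0 : 0 < d by rewrite divr_gt0.
  near=> n; rewrite [e]splitr; apply: bndW => /=.
    by near: n; exact: hl.
  have hn' : forall i j, nrm ((w n).2 i j - a i j) <= d.
    near: n; apply: filter_forall => i; apply: filter_forall => j.
    by move/cvg_nrmP: (ha i j); exact.
  apply: (@le_trans _ _ (\sum_(i : I) \sum_(j : I) d)).
    by apply: ler_sum => i _; apply: ler_sum => j _; exact: hn'.
  have -> : \sum_(i : I) \sum_(j : I) d = d * (#|I|%:R * #|I|%:R).
    by rewrite [RHS]mulrA !mulr_natr !sumr_const.
  rewrite /d mulrAC ler_pdivrMr //.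
  by rewrite ler_pM2l // lerDl.
Unshelve. all: by end_near. Qed.

(* Applied to the unitization of the matrix algebra: the iteration for
   [1 - X / t] converges to an element whose matrix part squares to [X / t]. *)
Lemma matrix_sqrt X t (P : A -> Prop) : 0 < t -> psdm t X ->
  (forall a b, P a -> P b -> P (a + b)) -> (forall c a, P a -> P (c *: a)) ->
  (forall a b, P a -> P b -> P (a ** b)) ->
  (forall (u : nat -> A) a, (forall n, P (u n)) -> u @ \oo --> a -> P a) ->
  (forall i j, P (X i j)) ->
  exists2 Z : I -> I -> A, forall i j, P (Z i j) & X = gram Z.
Proof.
move=> t0 [sX Xt] PD PZ PM Pl PX.
have tV0 : 0 <= t^-1 by rewrite invr_ge0 ltW.
have tC : t%:C != 0 by rewrite gt_eqF // ltcR.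
(* This is [1 - X / t]; its bound [1] is [psdm t X] divided by [t]. *)
pose k : M := (1, (- (t^-1)%:C) *: X).
have k1 : bnd k 1.
  split; first by rewrite /= /cmod normr1.
  move=> x; have -> : uact k x = (t^-1)%:C *: (t%:C *: x - mact X x).
    rewrite /uact /= mactZ scalerBr scalerA -rmorphM /= mulVf ?gt_eqF //.
    by rewrite scaleNr.
  rewrite hnZ cmodR ger0_norm // ler_pdivrMl // mul1r.
  exact: Xt.
have [z [z1 zE zP]] := bounded_root bb k1.
(* On scalar parts the fixed point equation reads [(z.1 - 1)^2 = 0]. Hence [1 - z] has no scalar
   part, and the matrix [z.2], equal to it up to sign, squares to [X / t]. *)
have z11 : z.1 = 1.
  have /(congr1 fst) /= h := zE.
  have : (z.1 - 1) * (z.1 - 1) = 0 :> R[i].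
    have h' : z.1 = 2^-1 * (1 + z.1 * z.1) by [].
    have -> : (z.1 - 1) * (z.1 - 1) = 2 * (2^-1 * (1 + z.1 * z.1)) - 2 * z.1 :> R[i].
      by field.
    by rewrite -h' subrr.
  by move/eqP; rewrite mulf_eq0 orbb subr_eq0 => /eqP.
(* [P] is not assumed to hold at [0]; an index [i] supplies the element [X i i] from which [0] is
   obtained by scaling. For empty [I] there is no entry to consider. *)
have P0 (i : I) : P 0 by rewrite -(scale0r (X i i)); apply: (PZ).
have PS (J : Type) (r : seq J) (F : J -> A) (i : I) : (forall j, P (F j)) ->
    P (\sum_(j <- r) F j).
  by move=> PF; elim/big_ind: _ => [|a b|j _]; [exact: (P0 i)|exact: PD|exact: PF].
have [zR zS] : Num.conj (z.1 : R[i]) = z.1 /\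
    forall i j, P (z.2 i j) /\ star (z.2 i j) = z.2 j i.
  apply: (zP (fun z : M => Num.conj (z.1 : R[i]) = z.1 /\
    forall i j, P (z.2 i j) /\ star (z.2 i j) = z.2 j i)).
  - by split=> [|i j]; [exact: conjC0|split; [exact: P0 i|exact: star0]].
  - move=> x [x1 x2]; split=> [|i j].
      have -> : (2^-1 *: (k + mul x x)).1 = 2^-1 * (1 + x.1 * x.1) :> R[i] by [].
      by rewrite rmorphM rmorphD rmorphM /= !x1 fmorphV rmorph1 rmorph_nat.
    split.
      apply: (PZ); apply: (PD); first by apply: (PZ).
      apply: (PD); last by apply: (PS) => // l; apply: (PM); case: (x2 i l); case: (x2 l j).
      by apply: (PD); apply: (PZ); case: (x2 i j).
    have E i' j' : (2^-1 *: (k + mul x x)).2 i' j' = 2^-1 *: ((- (t^-1)%:C) *: X i' j' +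
      (x.1 *: x.2 i' j' + x.1 *: x.2 i' j' + \sum_l x.2 i' l ** x.2 l j')) by [].
    have cN : Num.conj (- (t^-1)%:C : R[i]) = - (t^-1)%:C.
      by rewrite conj_Creal // rpredN complex_real.
    have c2 : Num.conj (2^-1 : R[i]) = 2^-1 by rewrite fmorphV rmorph_nat.
    rewrite !E starZ !starD !starZ c2 x1 cN sX star_sum; have [_ ->] := x2 i j.
    congr (_ *: (_ + (_ + _))); apply: eq_bigr => l _.
    by rewrite starM; have [_ ->] := x2 i l; have [_ ->] := x2 l j.
  - move=> u x ux hux.
    have uij i j : (fun n => (u n).2 i j) @ \oo --> x.2 i j.
      apply/cvg_nrmP => e e0; have e2 : 0 < e / 2 by rewrite divr_gt0.
      apply: filterS (hux _ e2) => n /bnd_snd /(_ i j).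
      by rewrite -splitr.
    split.
      apply/eqP; rewrite -subr_eq0; apply/eqP/cmod_eq0/ler_addgt0Pr => e e0.
      have [|N _ /(_ N (leqnn N)) [uN _]] := hux (e / 2); first by rewrite divr_gt0.
      have [u1 _] := ux N.
      have -> : Num.conj (x.1 : R[i]) - x.1 =
          - Num.conj ((u N).1 - x.1 : R[i]) + ((u N).1 - x.1) :> R[i].
        have cB (a b : R[i]) : Num.conj (a - b) = Num.conj a - Num.conj b.
          exact: rmorphB.
        by rewrite cB; move: (Num.conj _) u1 => ? ->; ring.
      apply: le_trans (cmodD _ _) _; rewrite cmodN cmod_conj add0r [leRHS]splitr.
      exact: lerD.
    move=> i j; split; first by apply: (Pl) (uij i j) => n; case: (ux n) => _ /(_ i j)[].
    apply/eqP; rewrite -subr_eq0; apply/eqP/nrm_le0/ler_addgt0Pr => e e0.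
    have e2 : 0 < e / 2 by rewrite divr_gt0.
    have /cvg_nrmP/(_ _ e2) h1 := uij i j; have /cvg_nrmP/(_ _ e2) h2 := uij j i.
    have [N _ /(_ N (leqnn N)) [n1 n2]] := filterI h1 h2.
    have [_ /(_ i j) [_ sN]] := ux N.
    have -> : star (x.2 i j) - x.2 j i =
        - star ((u N).2 i j - x.2 i j) + ((u N).2 j i - x.2 j i).
      by rewrite starD starN sN opprB addrA subrK.
    apply: le_trans (nrmD _ _) _; rewrite nrmN nrmS add0r [leRHS]splitr.
    exact: lerD.
exists (fun i j => (Num.sqrt t)%:C *: z.2 i j).
  by move=> i j; apply: (PZ); case: (zS i j).
apply/funext => i; apply/funext => j.
have zij : z.2 i j = 2^-1 *: ((- (t^-1)%:C) *: X i j +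
    (z.1 *: z.2 i j + z.1 *: z.2 i j + \sum_l z.2 i l ** z.2 l j)).
  by rewrite [in LHS]zE.
have -> : gram (fun i j => (Num.sqrt t)%:C *: z.2 i j) i j =
    t%:C *: \sum_l z.2 i l ** z.2 l j.
  rewrite scaler_sumr; apply: eq_bigr => l _.
  rewrite starZR smulZl smulZr scalerA -rmorphM /= -expr2 sqr_sqrtr ?ltW //.
  by have [_ ->] := zS l i.
set S := \sum_l _ in zij *.
have -> : S = 2 *: (2^-1 *: ((- (t^-1)%:C) *: X i j +
    (z.1 *: z.2 i j + z.1 *: z.2 i j + S))) + (t^-1)%:C *: X i j -
    (z.2 i j + z.2 i j).
  by rewrite z11; lmod R[i].
rewrite -zij scaler_nat mulr2n addrAC subrr add0r scalerA -rmorphM /= mulfV ?gt_eqF //.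
by rewrite scale1r.
Qed.

End MatrixSquareRoot.

(** * Averaging over a compact group *)

Lemma near_all_seq (T : Type) (F : set_system T) (I : eqType) (s : seq I)
    (P : I -> T -> Prop) : Filter F ->
  (forall i, i \in s -> \forall x \near F, P i x) ->
  \forall x \near F, forall i, i \in s -> P i x.
Proof.
move=> FF; elim: s => [|i s IH] h; first by apply: nearW.
have h1 := h i (mem_head i s).
have h2 : \forall x \near F, forall j, j \in s -> P j x.
  by apply: IH => j js; apply: h; rewrite inE js orbT.
apply: filterS2 h1 h2 => x xi xs j; rewrite inE => /orP[/eqP->//|].
exact: xs.
Qed.

(** Compactness is applied to the filter of finite lists ordered by inclusion: a property that holds
    eventually in this filter holds for one list. The centres are kept in [K] by a final
    filtering. *)
Lemma compact_net (X : topologicalType) (K : set X) (U : X -> set X) :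
  compact K -> (forall x, K x -> nbhs x (U x)) ->
  exists2 l : seq X, (forall x, x \in l -> K x) &
    forall y, K y -> exists2 x, x \in l & U x y.
Proof.
move=> /compact_near_coveringP cK KU.
pose P (s : seq X) y := exists2 x, x \in s & K x /\ U x y.
pose D := fun s : seq X => [set t : seq X | {subset s <= t}].
have FF : Filter (filter_from setT D).
  apply: filter_from_filter; first by exists [::].
  move=> s t _ _; exists (s ++ t) => // r h; split=> x xs; apply: h;
    by rewrite mem_cat xs ?orbT.
have [|s _ /(_ s (fun x h => h)) sP] := cK _ (filter_from setT D) P FF.
  move=> x Kx; exists (U x, D [:: x]) => /=.
    by split; [exact: KU|exists [:: x]].
  move=> [y s] /= [Uy xs]; exists x; first by apply: xs; rewrite mem_head.
  by [].
exists [seq x <- s | `[< K x >]].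
  by move=> x; rewrite mem_filter => /andP[/asboolP].
move=> y /sP[x xs [Kx Uxy]]; exists x => //.
by rewrite mem_filter xs andbT; apply/asboolP.
Qed.

Section Mean.
Variables (R : realType) (V : normedModType R[i]) (I : eqType).
Implicit Types (s : seq I) (F : I -> V).

Definition mean s F : V := (size s)%:R^-1 *: \sum_(i <- s) F i.

Lemma mean_const s v : s != [::] -> mean s (fun=> v) = v.
Proof.
rewrite /mean big_const_seq count_predT iter_addr_0.
have -> : v *+ size s = (size s)%:R *: v by rewrite scaler_nat.
rewrite scalerA; by case: s => // i s _; rewrite mulVf ?scale1r // pnatr_eq0.
Qed.

Lemma meanD s F H : mean s (fun i => F i + H i) = mean s F + mean s H.
Proof. by rewrite /mean big_split scalerDr. Qed.

Lemma meanN s F : mean s (fun i => - F i) = - mean s F.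
Proof. by rewrite /mean sumrN scalerN. Qed.

Lemma meanZ s c F : mean s (fun i => c *: F i) = c *: mean s F.
Proof. by rewrite /mean -scaler_sumr !scalerA mulrC. Qed.

Lemma nrm_mean_le s F c : s != [::] -> (forall i, i \in s -> nrm (F i) <= c) ->
  nrm (mean s F) <= c.
Proof.
move=> s0 h; have n0 : 0 < (size s)%:R :> R by rewrite ltr0n; case: s s0 {h}.
have E : (size s)%:R^-1 = ((size s)%:R^-1 : R)%:C :> R[i].
  by rewrite fmorphV /= rmorph_nat.
rewrite /mean E nrmZR ger0_norm ?invr_ge0 ?ler0n // ler_pdivrMl //.
apply: le_trans (nrm_sum _ _ _) _.
apply: (@le_trans _ _ (\sum_(i <- s) c)).
  by rewrite !big_seq; apply: ler_sum.
by rewrite big_const_seq count_predT iter_addr_0 mulr_natl.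
Qed.

(** A single term near [v] replaces one of the [size s] contributions [c] by [d]. This gain of a
    fixed proportion is what makes averaging contract orbits. *)
Lemma nrm_mean_close s F v i c d : i \in s -> (forall j, nrm (F j) <= c) ->
  nrm (F i - v) <= d ->
  nrm (mean s F - (size s)%:R^-1 *: v) <=
    (1 - (size s)%:R^-1) * c + (size s)%:R^-1 * d.
Proof.
move=> si h hd; have n0 : 0 < (size s)%:R :> R by rewrite ltr0n; case: s si.
have E : (size s)%:R^-1 = ((size s)%:R^-1 : R)%:C :> R[i].
  by rewrite fmorphV /= rmorph_nat.
rewrite /mean -scalerBr E nrmZR ger0_norm ?invr_ge0 ?ler0n // ler_pdivrMl //.
rewrite mulrDr !mulrA mulrBr mulr1 mulfV ?gt_eqF // mul1r.
rewrite (big_rem i) //= addrAC addrC; apply: le_trans (nrmD _ _) _.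
apply: lerD => //; apply: le_trans (nrm_sum _ _ _) _.
apply: (@le_trans _ _ (\sum_(i <- rem i s) c)); first exact: ler_sum.
rewrite big_const_seq count_predT iter_addr_0 size_rem //.
by case: s si {h n0 E} => // j s _; rewrite -natr1 addrK mulr_natl.
Qed.

End Mean.

Section Averaging.
Variables (R : realType) (G : topGroupType) (A : cstarAlgType R).
Variable alpha : cstarAction G A.
Implicit Types (g h x : G) (a b m : A) (s t : seq G).

Lemma alphaP g c a b : alpha g (c *: a + b) = c *: alpha g a + alpha g b.
Proof. by have [+ _ _] := act_star_hom alpha g; exact. Qed.

Lemma alphaD g a b : alpha g (a + b) = alpha g a + alpha g b.
Proof. by rewrite -[a]scale1r alphaP !scale1r. Qed.

Lemma alpha0 g : alpha g 0 = 0.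
Proof. by apply: (addrI (alpha g 0)); rewrite -alphaD !addr0. Qed.

Lemma alphaZ g c a : alpha g (c *: a) = c *: alpha g a.
Proof. by rewrite -[c *: a]addr0 alphaP alpha0 addr0. Qed.

Lemma alphaN g a : alpha g (- a) = - alpha g a.
Proof. by rewrite -scaleN1r alphaZ scaleN1r. Qed.

Lemma alphaB g a b : alpha g (a - b) = alpha g a - alpha g b.
Proof. by rewrite alphaD alphaN. Qed.

Lemma alphaM g a b : alpha g (a ** b) = alpha g a ** alpha g b.
Proof. by have [_ -> _] := act_star_hom alpha g. Qed.

Lemma alphaS g a : alpha g (star a) = star (alpha g a).
Proof. by have [_ _ ->] := act_star_hom alpha g. Qed.

Lemma alpha_sum g (I : Type) (r : seq I) (P : pred I) (F : I -> A) :
  alpha g (\sum_(i <- r | P i) F i) = \sum_(i <- r | P i) alpha g (F i).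
Proof. by elim/big_rec2: _ => [|i y x _ <-]; rewrite ?alpha0 ?alphaD. Qed.

Lemma alphaK g a : alpha g^-1%g (alpha g a) = a.
Proof. by rewrite -actM mulVg act1. Qed.

Lemma alphaVK g a : alpha g (alpha g^-1%g a) = a.
Proof. by rewrite -actM mulgV act1. Qed.

Lemma nrm_alpha g a : nrm (alpha g a) = nrm a.
Proof.
have le h b : nrm (alpha h b) <= nrm b.
  exact: star_hom_nrm_le (act_star_hom alpha h) b.
by apply/eqP; rewrite eq_le le -{1}(alphaK g a) le.
Qed.

Lemma alpha_near g0 a (e : R) : 0 < e ->
  \forall g \near g0, nrm (alpha g a - alpha g0 a) <= e.
Proof.
move=> e0; have /cvgrPdist_le h := @act_continuous _ _ _ alpha a g0.
have /h : 0 < e%:C by rewrite ltcR.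
by apply: filterS => g; rewrite distrC nrmE lecR.
Qed.

Definition avg s a : A := mean s (fun h => alpha h a).

Lemma avgP s c a b : avg s (c *: a + b) = c *: avg s a + avg s b.
Proof.
rewrite /avg -meanZ -meanD; congr mean; apply/funext => h.
by rewrite alphaP.
Qed.

Lemma alpha_avg g s a : alpha g (avg s a) = mean s (fun h => alpha (g * h)%g a).
Proof.
rewrite /avg /mean alphaZ alpha_sum; congr (_ *: _); apply: eq_bigr => h _.
by rewrite actM.
Qed.

Definition prods s t : seq G := [seq (g * h)%g | g <- s, h <- t].

Lemma prods_nil s t : s != [::] -> t != [::] -> prods s t != [::].
Proof. by case: s => // g s _; case: t. Qed.

Lemma avg_prods s t a : avg (prods s t) a = avg s (avg t a).
Proof.
rewrite /avg /mean /prods size_allpairs natrM invfM -scalerA; congr (_ *: _).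
rewrite big_allpairs_dep scaler_sumr; apply: eq_bigr => g _.
rewrite alphaZ alpha_sum; congr (_ *: _); apply: eq_bigr => h _.
by rewrite actM.
Qed.

Lemma avg_dist_le s a b c : s != [::] ->
  (forall g, nrm (alpha g a - b) <= c) -> nrm (avg s a - b) <= c.
Proof.
move=> s0 h; rewrite -(mean_const b s0) -meanN -meanD.
by apply: nrm_mean_le.
Qed.

Lemma nrm_avg_le s a : s != [::] -> nrm (avg s a) <= nrm a.
Proof. by move=> s0; apply: nrm_mean_le => // g _; rewrite nrm_alpha. Qed.

Definition orbit_radius a (c : R) := exists m, forall g, nrm (alpha g a - m) <= c.

(** Equicontinuity at the identity along the whole orbit, rather than at [a] alone: quantifying over
    [h] makes the property pass to averages. *)
Definition orbit_modulus (V : set G) a (e : R) :=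
  forall x, V x -> forall h, nrm (alpha x (alpha h a) - alpha h a) <= e.

(** Every left translate of the list meets [V]. *)
Definition translate_cover (V : set G) s := forall g, exists2 h, h \in s & V (g * h)%g.

Lemma avg_modulus V s a e : s != [::] -> orbit_modulus V a e ->
  orbit_modulus V (avg s a) e.
Proof.
move=> s0 Va x Vx h; rewrite -actM !alpha_avg -meanN -meanD.
apply: nrm_mean_le => // g _; rewrite -mulgA [alpha (x * _)%g a]actM.
exact: Va.
Qed.

(* Every average over a translate of [s] contains a term close to [a]. *)
Lemma avg_radius V s a c e : orbit_modulus V a e -> translate_cover V s ->
  orbit_radius a c ->
  orbit_radius (avg s a) ((1 - (size s)%:R^-1) * c + (size s)%:R^-1 * e).
Proof.
move=> Va Vs [m ma].
have s0 : s != [::] by have [h + _] := Vs 1%g; case: s {Vs}.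
(* The new centre is moved from [m] towards [a], by the weight of the one term known to be close to
   [a]. *)
exists (m + (size s)%:R^-1 *: (a - m)) => g.
have [h hs Vgh] := Vs g.
rewrite alpha_avg opprD addrA -{1}(mean_const m s0) -meanN -meanD.
apply: (nrm_mean_close hs) => [x|]; first exact: ma.
have -> : alpha (g * h)%g a - m - (a - m) = alpha (g * h)%g a - a.
  by rewrite opprB addrA subrK.
by have := Va _ Vgh 1%g; rewrite !act1.
Qed.

Fixpoint powers s k : seq G := if k is k.+1 then prods s (powers s k) else [:: 1%g].

Lemma powers_nil s k : s != [::] -> powers s k != [::].
Proof. by move=> s0; elim: k => //= k IH; exact: prods_nil. Qed.

Lemma avg_one a : avg [:: 1%g] a = a.
Proof. by rewrite /avg /mean big_seq1 act1 invr1 scale1r. Qed.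

(** With [r = 1 - 1 / size s], the recursion [c -> r c + (1 - r) e] has the fixed point [e], so the
    errors do not accumulate over the steps. *)
Lemma powers_radius V s a c e k : 0 <= e -> orbit_modulus V a e ->
  translate_cover V s -> orbit_radius a c ->
  orbit_modulus V (avg (powers s k) a) e /\
  orbit_radius (avg (powers s k) a) ((1 - (size s)%:R^-1) ^+ k * c + e).
Proof.
move=> e0 Va Vs ac.
have s0 : s != [::] by have [h + _] := Vs 1%g; case: s {Vs}.
have n1 : 1 <= (size s)%:R :> R by rewrite ler1n; case: s s0 {Vs}.
have n0 : 0 < (size s)%:R :> R by exact: lt_le_trans n1.
have r0 : 0 <= 1 - (size s)%:R^-1 :> R by rewrite subr_ge0 invf_le1.
elim: k => [|k [IH1 IH2]] /=.
  split; rewrite avg_one // expr0 mul1r.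
  by have [m ma] := ac; exists m => g; rewrite (le_trans (ma g)) // lerDl.
rewrite avg_prods; split; first exact: avg_modulus.
have [m mb] := avg_radius IH1 Vs IH2; exists m => g; apply: le_trans (mb g) _.
rewrite exprS; set r := 1 - _ in r0 *.
have -> : (size s)%:R^-1 = 1 - r by rewrite /r; ring.
by rewrite le_eqVlt; apply/orP; left; apply/eqP; ring.
Qed.

(** The list is chosen before [a]: its length depends only on [s] and [n], through a power of
    [1 - 1 / size s] below [1 / n.+1]. *)
Lemma shrinking_averages V s (n : nat) : translate_cover V s ->
  exists2 t, t != [::] & forall a c e, 0 <= e -> 0 <= c -> orbit_modulus V a e ->
    orbit_radius a c -> orbit_radius (avg t a) (c / n.+1%:R + e).
Proof.
move=> Vs.
have s0 : s != [::] by have [h + _] := Vs 1%g; case: s {Vs}.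
have n1 : 1 <= (size s)%:R :> R by rewrite ler1n; case: s s0 {Vs}.
have n0 : 0 < (size s)%:R :> R by exact: lt_le_trans n1.
set r : R := 1 - (size s)%:R^-1.
have r0 : 0 <= r by rewrite subr_ge0 invf_le1.
have r1 : r < 1 by rewrite /r gtrBl invr_gt0.
have [k rk] : exists k, r ^+ k <= n.+1%:R^-1.
  have : (fun k => r ^+ k) @ \oo --> (0 : R) by apply: cvg_expr; rewrite ger0_norm.
  move=> /cvgrPdist_le /(_ n.+1%:R^-1); rewrite invr_gt0 ltr0n => /(_ isT).
  move=> [k _ /(_ k (leqnn k))]; rewrite /= sub0r normrN => h.
  by exists k; exact: le_trans (ler_norm _) h.
exists (powers s k); first exact: powers_nil.
move=> a c e e0 c0 Va ac; have [_ [m h]] := powers_radius k e0 Va Vs ac.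
exists m => g; apply: le_trans (h g) _; rewrite lerD2r mulrC.
exact: ler_wpM2l.
Qed.

Hypothesis Gc : compact [set: G].

Lemma exists_translate_cover V : nbhs 1%g V -> exists s, translate_cover V s.
Proof.
move=> V1; have [|l _ lP] := @compact_net G setT (fun x g => V (g * x^-1)%g) Gc.
  move=> x _.
  have c : continuous (fun g : G => (g * x^-1)%g).
    move=> g; apply: (@continuous_comp _ _ _ (fun g : G => (g, (x^-1)%g))
      (fun xy : G * G => (xy.1 * xy.2)%g)); last exact: mulg_continuous.
    by apply: cvg_pair => //=; exact: cvg_cst.
  by apply: c; rewrite mulgV.
exists [seq (x^-1)%g | x <- l] => g; have [x xl Vx] := lP g I.
by exists (x^-1)%g => //; exact: map_f.
Qed.

(** It suffices to have continuity at the identity for the finitely many points of a net of the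
    orbit. Automorphisms are isometric, so the estimate spreads to the whole orbit with three errors
    [e / 3]. *)
Lemma exists_orbit_modulus a (e : R) : 0 < e ->
  exists2 V, nbhs 1%g V & orbit_modulus V a e.
Proof.
move=> e0; have e3 : 0 < e / 3 by rewrite divr_gt0.
have [|l _ lP] := @compact_net G setT
  (fun h g => nrm (alpha g a - alpha h a) <= e / 3) Gc.
  by move=> h _; exact: alpha_near.
exists [set x | forall h, h \in l -> nrm (alpha x (alpha h a) - alpha h a) <= e / 3].
  apply: near_all_seq => h _.
  by have := alpha_near 1%g (alpha h a) e3; rewrite act1.
move=> x xl h; have [y yl hy] := lP h I.
have := xl y yl; have := nrm_alpha x (alpha h a - alpha y a); rewrite alphaB.
have -> : alpha x (alpha h a) - alpha h a =
  (alpha x (alpha h a) - alpha x (alpha y a)) +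
  ((alpha x (alpha y a) - alpha y a) - (alpha h a - alpha y a)) by lmod R[i].
set u := _ - alpha x (alpha y a); set v := alpha h a - _.
set w := _ - alpha y a.
have := nrmD u (w - v); have := nrmB w v; rewrite -/v in hy * => *.
lra.
Qed.

(** [V n] is the intersection of the base sets containing [x] whose code is at most [n], so the sets
    decrease and eventually enter each neighbourhood. *)
Lemma second_countable_base (x : G) : @second_countable G ->
  exists2 V : nat -> set G, forall n, nbhs x (V n) &
    forall U, nbhs x U -> exists n, forall k, (n <= k)%N -> V k `<=` U.
Proof.
move=> [B /countable_injP[f finj] [Bo Bx]].
exists (fun n => [set y | forall k, k \in iota 0 n.+1 ->
    forall U, B U -> f U = k -> U x -> U y]).
  move=> n; apply: near_all_seq => k _.
  have [[U [BU fU Ux]]|noU] := pselect (exists U, [/\ B U, f U = k & U x]).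
    have : nbhs x U by apply: open_nbhs_nbhs; split=> //; exact: Bo.
    apply: filterS => y Uy W BW fW Wx.
    by rewrite (finj W U) ?inE // fW.
  by apply: nearW => y U BU fU Ux; case: noU; exists U.
move=> U /Bx [W [BW Wx] WU]; exists (f W) => k fk y h; apply: WU.
by apply: (h (f W)) => //; rewrite mem_iota add0n ltnS fk.
Qed.

(** A later average is an average of translates of an earlier one and stays in any ball containing
    the earlier orbit. Orbit radii therefore stay small once they are small, which makes the
    averages Cauchy and their limit invariant. Countably many [V n] let one sequence serve every
    [a]. *)
Lemma averaging_sequence : @second_countable G ->
  exists2 t : nat -> seq G, forall n, t n != [::] &
    forall a, exists2 l, (fun n => avg (t n) a) @ \oo --> l & forall g, alpha g l = l.
Proof.
move=> G2.
have [V V1 VU] := second_countable_base 1%g G2.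
have sex n : exists2 p, p != [::] & forall a c e, 0 <= e -> 0 <= c ->
    orbit_modulus (V n) a e -> orbit_radius a c ->
    orbit_radius (avg p a) (c / n.+1%:R + e).
  by have [s Vs] := exists_translate_cover (V1 n); exact: shrinking_averages Vs.
pose p n := projT1 (cid2 (sex n)).
have p0 n : p n != [::] by rewrite /p; case: cid2.
have pP n a c e : 0 <= e -> 0 <= c -> orbit_modulus (V n) a e ->
    orbit_radius a c -> orbit_radius (avg (p n) a) (c / n.+1%:R + e).
  by rewrite /p; case: cid2 => /= ? _; exact.
(* The new factor goes on the left, so that [t n] is a product of some [q] with [t i] for [i <= n]
   and the averages compose accordingly. *)
pose t := fix t n := if n is n.+1 then prods (p n) (t n) else [:: 1%g].
have t0 n : t n != [::] by elim: n => //= n IH; exact: prods_nil.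
have tS i n : (i <= n)%N ->
    exists2 q, q != [::] & forall a, avg (t n) a = avg q (avg (t i) a).
  move=> /subnK <-; elim: (n - i)%N => [|k [q q0 IH]].
    by exists [:: 1%g] => // a; rewrite avg_one.
  exists (prods (p (k + i)%N) q); first exact: prods_nil.
  by move=> a; rewrite addSn /= !avg_prods IH.
have rad a e : 0 < e -> exists N, orbit_radius (avg (t N) a) e.
  move=> e0; have e2 : 0 < e / 2 by rewrite divr_gt0.
  have [U U1 Ua] := exists_orbit_modulus a e2; have [N0 VN0] := VU _ U1.
  (* Large enough for [V N] to lie in [U] and for [|a| / N.+1] to be at most [e / 2]. *)
  pose N := maxn N0 (Num.trunc (nrm a / (e / 2))).
  exists N.+1; rewrite /= avg_prods.
  have h1 : orbit_modulus (V N) (avg (t N) a) (e / 2).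
    apply: avg_modulus => // x /(VN0 _ (leq_maxl _ _)); exact: Ua.
  have h2 : orbit_radius (avg (t N) a) (nrm a).
    by exists 0 => g; rewrite subr0 nrm_alpha; exact: nrm_avg_le.
  have [m hm] := pP _ _ _ _ (ltW e2) (nrm_ge0 a) h1 h2.
  exists m => g; apply: le_trans (hm g) _; rewrite [leRHS]splitr lerD2r.
  rewrite ler_pdivrMr ?ltr0n // mulrC -ler_pdivrMr //.
  apply: ltW; apply: lt_le_trans (_ : (Num.trunc (nrm a / (e / 2))).+1%:R <= _).
    by have /andP[_ ->] := trunc_itv (divr_ge0 (nrm_ge0 a) (ltW e2)).
  by rewrite ler_nat ltnS leq_maxr.
exists t => // a.
have [|l la] := @cauchy_nrm R A (fun n => avg (t n) a).
  move=> e e0; have [N [m hm]] := rad a _ (divr_gt0 e0 (ltr0n _ 2)).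
  exists N => n /tS[q q0 ->].
  apply: le_trans (nrm_triangle m _ _) _; rewrite [leRHS]splitr; apply: lerD.
    exact: avg_dist_le.
  by have := hm 1%g; rewrite act1 nrm_distC.
exists l => // g; apply/eqP; rewrite -subr_eq0; apply/eqP/nrm_le0/ler_addgt0Pr => e e0.
have e4 : 0 < e / 4 by rewrite divr_gt0.
have [N [m hm]] := rad a _ e4; move/cvg_nrmP: la => /(_ _ e4) [M _ hM].
have := hM (maxn N M) (leq_maxr _ _) => /=.
have [q q0 ->] := tS _ _ (leq_maxl N M).
set b := avg (t N) a in hm *; set d := avg q b => dl.
have gd : nrm (alpha g d - m) <= e / 4.
  rewrite /d alpha_avg -(mean_const m q0) -meanN -meanD.
  by apply: nrm_mean_le => // h _; exact: hm.
have dm : nrm (d - m) <= e / 4 by exact: avg_dist_le.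
have gl : nrm (alpha g d - alpha g l) <= e / 4 by rewrite -alphaB nrm_alpha.
have -> : alpha g l - l = ((alpha g d - m) - (alpha g d - alpha g l)) +
   ((d - l) - (d - m)) by lmod R[i].
have := nrmD ((alpha g d - m) - (alpha g d - alpha g l)) ((d - l) - (d - m)).
have := nrmB (alpha g d - m) (alpha g d - alpha g l).
have := nrmB (d - l) (d - m).
by rewrite add0r => *; lra.
Qed.

End Averaging.

(** * Stability of matrix positivity under averages and limits *)

Section PsdClosure.
Variables (R : realType) (A : cstarAlgType R) (I : finType).
Implicit Types (x : I -> A) (X Y : I -> I -> A) (t : R).

Lemma hn_sum (J : Type) (r : seq J) (F : J -> I -> A) :
  hn (\sum_(j <- r) F j) <= \sum_(j <- r) hn (F j).
Proof.
elim/big_rec2: _ => [|j y x _ h].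
  by have := hnZ 0 (0 : I -> A); rewrite scale0r cmodR normr0 mul0r => ->.
by apply: le_trans (hnD _ _) _; rewrite lerD2l.
Qed.

Lemma mact_sub X Y x : mact X x - mact Y x = mact (fun i j => X i j - Y i j) x.
Proof.
apply/funext => i; rewrite /mact -[LHS]sumrB; apply: eq_bigr => j _.
by rewrite smulDl smulNl.
Qed.

(** For a fixed [t] the condition is convex: [t] minus a mean is the mean of the differences. This
    requires a common [t] for all members of the family. *)
Lemma psdm_mean (J : eqType) (s : seq J) (X : J -> I -> I -> A) t : s != [::] ->
  (forall h, psdm t (X h)) -> psdm t (fun i j => mean s (fun h => X h i j)).
Proof.
move=> s0 Xt; split=> [i j|x].
  rewrite /mean starZ fmorphV rmorph_nat star_sum; congr (_ *: _).
  by apply: eq_bigr => h _; case: (Xt h).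
have n0 : 0 < (size s)%:R :> R by rewrite ltr0n; case: s s0.
have E : (size s)%:R^-1 = ((size s)%:R^-1 : R)%:C :> R[i].
  by rewrite fmorphV /= rmorph_nat.
have -> : t%:C *: x - mact (fun i j => mean s (fun h => X h i j)) x =
    (size s)%:R^-1 *: \sum_(h <- s) (t%:C *: x - mact (X h) x).
  rewrite sumrB big_const_seq count_predT iter_addr_0 scalerBr.
  have -> : (t%:C *: x) *+ size s = (size s)%:R *: (t%:C *: x).
    by rewrite scaler_nat.
  rewrite [(size s)%:R^-1 *: (_ *: _)]scalerA mulVf ?scale1r; last first.
    by rewrite pnatr_eq0; case: s s0 {n0 E}.
  congr (_ - _); apply/funext => i.
  have -> : ((size s)%:R^-1 *: \sum_(h <- s) mact (X h) x) i =
     (size s)%:R^-1 *: \sum_(h <- s) mact (X h) x i.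
    by congr (_ *: _); elim/big_rec2: _ => // h u v _ <-.
  rewrite exchange_big scaler_sumr; apply: eq_bigr => j _.
  by rewrite /mean smulZl smul_suml.
rewrite hnZ E cmodR ger0_norm ?invr_ge0 ?ler0n // ler_pdivrMl //.
apply: le_trans (hn_sum _ _) _.
apply: (@le_trans _ _ (\sum_(h <- s) t * hn x)).
  by apply: ler_sum => h _; case: (Xt h).
by rewrite big_const_seq count_predT iter_addr_0 mulr_natl.
Qed.

Lemma psdm_lim (X : nat -> I -> I -> A) Y t : (forall n, psdm t (X n)) ->
  (forall i j, (fun n => X n i j) @ \oo --> Y i j) -> psdm t Y.
Proof.
move=> Xt XY; split=> [i j|x].
  apply/eqP; rewrite -subr_eq0; apply/eqP/nrm_le0/ler_addgt0Pr => e e0.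
  have e2 : 0 < e / 2 by rewrite divr_gt0.
  have /cvg_nrmP/(_ _ e2) h1 := XY i j; have /cvg_nrmP/(_ _ e2) h2 := XY j i.
  have [N _ /(_ N (leqnn N)) [n1 n2]] := filterI h1 h2.
  have [sN _] := Xt N.
  have -> : star (Y i j) - Y j i = - star (X N i j - Y i j) + (X N j i - Y j i).
    by rewrite starD starN sN opprB addrA subrK.
  apply: le_trans (nrmD _ _) _; rewrite nrmN nrmS add0r [leRHS]splitr.
  exact: lerD.
apply: ler_addgt0M => [|e e0]; first exact: hn_ge0.
pose d := e / (#|I|%:R * #|I|%:R + 1).
have d1 : 0 < #|I|%:R * #|I|%:R + 1 :> R by rewrite ltr_wpDl // mulr_ge0.
have d0 : 0 < d by rewrite divr_gt0.
have [N _ /(_ N (leqnn N)) hN] : \forall n \near \oo, forall i j, nrm (X n i j - Y i j) <= d.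
  apply: filter_forall => i; apply: filter_forall => j.
  by move/cvg_nrmP: (XY i j); exact.
have -> : t%:C *: x - mact Y x = (t%:C *: x - mact (X N) x) + (mact (X N) x - mact Y x).
  by rewrite addrA subrK.
apply: le_trans (hnD _ _) _; rewrite mulrDl; apply: lerD; first by case: (Xt N).
rewrite mact_sub; apply: le_trans (hn_mact_le _ _) _.
apply: ler_wpM2r; first exact: hn_ge0.
apply: (@le_trans _ _ (\sum_(i : I) \sum_(j : I) d)).
  by apply: ler_sum => i _; apply: ler_sum => j _; exact: hN.
have -> : \sum_(i : I) \sum_(j : I) d = d * (#|I|%:R * #|I|%:R).
  by rewrite [RHS]mulrA !mulr_natr !sumr_const.
rewrite /d mulrAC ler_pdivrMr //.
by rewrite ler_pM2l // lerDl.
Qed.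

End PsdClosure.

(** * The averaging map and complete positivity of its compositions *)

Section AveragedMap.
Variables (R : realType) (G : topGroupType) (A : cstarAlgType R).
Variable alpha : cstarAction G A.
Variables (t : nat -> seq G) (E : A -> A).
Hypothesis t0 : forall n, t n != [::].
Hypothesis tE : forall a, (fun n => avg alpha (t n) a) @ \oo --> E a.
Hypothesis Efix : forall a g, alpha g (E a) = E a.
Implicit Types a b : A.

Let tE' a (e : R) : 0 < e -> exists n, nrm (avg alpha (t n) a - E a) <= e.
Proof.
by move=> e0; have /cvg_nrmP/(_ _ e0) [N _ /(_ N (leqnn N))] := @tE a; exists N.
Qed.

Lemma lim_avgP c a b : E (c *: a + b) = c *: E a + E b.
Proof.
have h : (fun n => avg alpha (t n) (c *: a + b)) @ \oo --> c *: E a + E b.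
  under eq_fun do rewrite avgP.
  apply: cvgD; last exact: tE.
  by apply: cvgZr; exact: tE.
by apply: cvg_unique (@tE _) h; exact: norm_hausdorff.
Qed.

Lemma nrm_lim_avg a : nrm (E a) <= nrm a.
Proof.
apply/ler_addgt0Pr => e /(tE' a)[n hn].
have := nrm_avg_le alpha a (t0 n).
have := nrmB (avg alpha (t n) a) (avg alpha (t n) a - E a).
by rewrite opprB addrC subrK => *; lra.
Qed.

Lemma lim_avg_dist a b c : (forall g, nrm (alpha g a - b) <= c) -> nrm (E a - b) <= c.
Proof.
move=> h; apply/ler_addgt0Pr => e /(tE' a)[n hn].
have := avg_dist_le (t0 n) h.
have := nrm_triangle (avg alpha (t n) a) (E a) b.
by rewrite (nrm_distC (E a) (avg _ _ _)) => *; lra.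
Qed.

Lemma lim_avg_fixed a : (forall g, alpha g a = a) -> E a = a.
Proof.
move=> fa; apply/eqP; rewrite -subr_eq0; apply/eqP/nrm_le0/lim_avg_dist => g.
by rewrite fa subrr nrm0.
Qed.

Section Compression.
Variables (P : finType) (w : P -> A) (gamma : P -> G).

Definition conj_sum a : A := \sum_p star (w p) ** alpha (gamma p) a ** w p.

Lemma conj_sumP c a b : conj_sum (c *: a + b) = c *: conj_sum a + conj_sum b.
Proof.
rewrite /conj_sum scaler_sumr -big_split; apply: eq_bigr => p _ /=.
by rewrite alphaP smulDr smulZr smulDl smulZl.
Qed.

Lemma nrm_conj_sum a : nrm (conj_sum a) <= nrm a * nrm (\sum_p star (w p) ** w p).
Proof. by apply: nrm_conj_sum_le => p; rewrite nrm_alpha. Qed.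

Let fixedE a : E (conj_sum a) \in fixed_subalg alpha.
Proof. by apply/fixed_predP => g; rewrite Efix. Qed.

Let psi a : fixed_alg alpha := SubStar (fixedE a).

Let psi_linear : linear psi.
Proof.
by move=> c a b; apply: val_inj; rewrite /= conj_sumP lim_avgP.
Qed.

(* The average of a Gram matrix is a limit of averages of Gram matrices, and its
   square root has entries in [A^alpha]. *)
Lemma averaged_cp : completely_positive psi.
Proof.
move=> n X [Y XE].
pose W (q : P * 'I_n) (j : 'I_n) := alpha (gamma q.1) (Y q.2 j) ** w q.1.
have WE i j : conj_sum (X i j) = gram W i j.
  rewrite XE mxE /conj_sum /gram.
  rewrite -(pair_big xpredT xpredT (fun p k => star (W (p, k) i) ** W (p, k) j)) /=.
  apply: eq_bigr => p _; rewrite alpha_sum smul_sumr smul_suml.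
  by apply: eq_bigr => k _; rewrite alphaM alphaS starM !smulA.
(* [s] dominates every diagonal entry, and automorphisms preserve norms, so one constant [t] serves
   all translates of the Gram matrix. The added [1] makes it positive. *)
pose s := \sum_i nrm (gram W i i) + 1.
have s0 : 0 < s by rewrite ltr_wpDl // sumr_ge0 // => i _; exact: nrm_ge0.
have Wt g : psdm ((#|'I_n|.+1)%:R * s) (fun i j => alpha g (gram W i j)).
  have -> : (fun i j => alpha g (gram W i j)) = gram (fun q j => alpha g (W q j)).
    apply/funext => i; apply/funext => j; rewrite /gram alpha_sum.
    by apply: eq_bigr => q _; rewrite alphaM alphaS.
  apply: gram_psdm => // i.
  have -> : gram (fun q j => alpha g (W q j)) i i = alpha g (gram W i i).
    by rewrite /gram alpha_sum; apply: eq_bigr => q _; rewrite alphaM alphaS.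
  rewrite nrm_alpha /s (bigD1 i) //= -addrA lerDl addr_ge0 // sumr_ge0 // => j _.
  exact: nrm_ge0.
have Et : psdm ((#|'I_n|.+1)%:R * s) (fun i j => E (gram W i j)).
  apply: (psdm_lim (X := fun m i j => avg alpha (t m) (gram W i j))) => [m|i j];
    last exact: tE.
  by apply: (psdm_mean (X := fun g i j => alpha g (gram W i j))).
have [||||||Z ZP ZE] := matrix_sqrt (P := fun a => forall g, alpha g a = a) _ Et.
- by rewrite mulr_gt0.
- by move=> a b fa fb g; rewrite alphaD fa fb.
- by move=> c a fa g; rewrite alphaZ fa.
- by move=> a b fa fb g; rewrite alphaM fa fb.
- move=> u a fu ua g; apply/eqP; rewrite -subr_eq0; apply/eqP/nrm_le0.
  apply/ler_addgt0Pr => e e0; have e2 : 0 < e / 2 by rewrite divr_gt0.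
  have /cvg_nrmP/(_ _ e2) [N _ /(_ N (leqnn N)) uN] := ua.
  have -> : alpha g a - a = (u N - a) - alpha g (u N - a).
    by rewrite alphaB fu; lmod R[i].
  by apply: le_trans (nrmB _ _) _; rewrite nrm_alpha add0r [leRHS]splitr lerD.
- by move=> i j g; rewrite Efix.
have ZF k i : Z k i \in fixed_subalg alpha by apply/fixed_predP.
exists (\matrix_(k, i) SubStar (ZF k i)); apply/matrixP => i j; apply: val_inj.
rewrite !mxE /= WE.
have -> : E (gram W i j) = gram Z i j by rewrite -ZE.
rewrite /gram (big_morph val (fun _ _ => erefl) erefl) /=.
by apply: eq_bigr => k _; rewrite !mxE.
Qed.

Lemma averaged_cpc : nrm (\sum_p star (w p) ** w p) <= 1 ->
  exists2 psi : {linear A -> fixed_alg alpha},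
    cpc psi & forall a, val (psi a) = E (conj_sum a).
Proof.
move=> w1.
pose psiL := GRing.isLinear.Build R[i] A (fixed_alg alpha) *:%R psi psi_linear.
pose f : {linear A -> fixed_alg alpha} := HB.pack psi psiL.
exists f => //; split; first exact: averaged_cp.
move=> a; rewrite !nrmE lecR /=; apply: le_trans (nrm_lim_avg _) _.
apply: le_trans (nrm_conj_sum _) _; rewrite -[leRHS]mulr1.
by apply: ler_wpM2l => //; exact: nrm_ge0.
Qed.

End Compression.
End AveragedMap.

(** * Separable invariant subalgebras *)

Lemma nbhs_nrmP (R : realType) (V : normedModType R[i]) (a : V) (B : set V) :
  nbhs a B <-> exists2 e : R, 0 < e & forall x, nrm (x - a) <= e -> B x.
Proof.
split=> [/nbhs_ballP[e /= e0 eB]|[e e0 eB]].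
  have er : e = (complex.Re e)%:C by rewrite RRe_real // gtr0_real.
  have e0' : 0 < complex.Re e by rewrite -ltcR -er.
  exists (complex.Re e / 2); first by rewrite divr_gt0.
  move=> x xa; apply: eB; rewrite -ball_normE /= distrC nrmE er ltcR.
  by apply: le_lt_trans xa _; lra.
apply/nbhs_ballP; exists e%:C => /=; first by rewrite ltcR.
move=> x; rewrite -ball_normE /= distrC nrmE ltcR => /ltW; exact: eB.
Qed.

Lemma complex_rat_approx (R : realType) (c : R[i]) (e : R) : 0 < e ->
  exists p q : rat, cmod (c - (ratr p +i* ratr q)) <= e.
Proof.
move=> e0; have e2 : 0 < e / 2 by rewrite divr_gt0.
have approx (x : R) : exists p : rat, `|x - ratr p| <= e / 2.
  have [|p] := @rat_in_itvoo R (x - e / 2) (x + e / 2); first by lra.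
  rewrite in_itv /= => /andP[h1 h2]; exists p.
  by rewrite ler_norml; apply/andP; split; lra.
have [p hp] := approx (complex.Re c); have [q hq] := approx (complex.Im c).
exists p, q; apply: le_trans (cmod_le _) _; rewrite !raddfB /= [leRHS]splitr.
exact: lerD.
Qed.

Section SeparableSubalgebra.
Variables (R : realType) (G : topGroupType) (A : cstarAlgType R).
Variable alpha : cstarAction G A.
Implicit Types (a b s : A) (g : G).

(** One point is chosen in each nonempty base set; codes that name no such set receive the
    identity. *)
Lemma second_countable_dense : @second_countable G ->
  exists q : nat -> G, forall g U, nbhs g U -> exists k, U (q k).
Proof.
move=> [B /countable_injP[f finj] [Bo Bx]].
have qex k : exists g : G, forall U, B U -> f U = k -> (exists x, U x) -> U g.
  have [[U [BU fU [x Ux]]]|noU] :=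
      pselect (exists U, [/\ B U, f U = k & exists x, U x]).
    exists x => W BW fW _.
    by rewrite (finj W U) ?inE // fW.
  by exists 1%g => U BU fU xU; case: noU; exists U.
exists (fun k => projT1 (cid (qex k))) => g U /Bx[W [BW Wg] WU].
exists (f W); apply: WU; case: cid => x /= /(_ W BW erefl); apply.
by exists g.
Qed.

Variables (q : nat -> G) (c : nat -> A).
Hypothesis q_dense : forall g U, nbhs g U -> exists k, U (q k).

(** Stage [n] enumerates what [n] operations produce from the translates [alpha (q j) (c i)], with
    scalars having rational real and imaginary parts. Tags from [4] on copy an element, so stages
    increase; codes that decode to nothing give [0]. *)
Fixpoint gens (n : nat) : nat -> A :=
  match n with
  | 0 => fun k => if unpickle k is Some (i, j) then alpha (q j) (c i) else 0
  | n.+1 => fun k =>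
      if unpickle k is Some (i, j, (r, s), tag) then
        match tag with
        | 0 => gens n i + gens n j
        | 1 => gens n i ** gens n j
        | 2 => star (gens n i)
        | 3 => (ratr r +i* ratr s : R[i]) *: gens n i
        | _ => gens n i
        end
      else 0
  end.

Definition gens_near a (e : R) := exists n k, nrm (gens n k - a) <= e.

Let op n (i j : nat) (r s : rat) (tag : nat) :
  gens n.+1 (pickle (i, j, (r, s), tag)) =
  match tag with
        | 0 => gens n i + gens n j
        | 1 => gens n i ** gens n j
        | 2 => star (gens n i)
        | 3 => (ratr r +i* ratr s : R[i]) *: gens n i
        | _ => gens n i
  end.
Proof. by rewrite /= pickleK. Qed.

Let lift n i m : exists j, gens (m + n) j = gens n i.
Proof.
elim: m => [|m [j jE]]; first by exists i.
by exists (pickle (j, 0%N, (0%Q, 0%Q), 4%N)); rewrite addSn op.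
Qed.

Let common n i m j : exists N i' j', gens N i' = gens n i /\ gens N j' = gens m j.
Proof.
have [i' iE] := lift n i m; have [j' jE] := lift m j n.
by exists (m + n)%N, i', j'; split=> //; rewrite addnC.
Qed.

Definition gen_pred : {pred A} :=
  [pred a | `[< forall e : R, 0 < e -> gens_near a e >]].

Lemma gen_predP a : reflect (forall e : R, 0 < e -> gens_near a e) (a \in gen_pred).
Proof. exact: asboolP. Qed.

Let genD a b : a \in gen_pred -> b \in gen_pred -> a + b \in gen_pred.
Proof.
move=> /gen_predP Da /gen_predP Db; apply/gen_predP => e e0.
have e2 : 0 < e / 2 by rewrite divr_gt0.
have [n [i ni]] := Da _ e2; have [m [j mj]] := Db _ e2.
have [N [i' [j' [iE jE]]]] := common n i m j.
exists N.+1, (pickle (i', j', (0%Q, 0%Q), 0%N)); rewrite op iE jE.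
have -> : gens n i + gens m j - (a + b) = (gens n i - a) + (gens m j - b).
  by rewrite opprD addrACA.
by apply: le_trans (nrmD _ _) _; rewrite [leRHS]splitr lerD.
Qed.

Let half (e x y : R) : 0 < e -> 0 <= y -> 0 < 2 * (y + 1) ->
  x <= e / (2 * (y + 1)) -> x * y <= e / 2.
Proof.
move=> e0 y0 y1 xe; apply: le_trans (ler_wpM2r y0 xe) _.
rewrite -subr_ge0.
have -> : e / 2 - e / (2 * (y + 1)) * y = e / (2 * (y + 1)) by field; lra.
by rewrite divr_ge0 // ltW.
Qed.

Let genM a b : a \in gen_pred -> b \in gen_pred -> a ** b \in gen_pred.
Proof.
move=> /gen_predP Da /gen_predP Db; apply/gen_predP => e e0.
have b1 : 0 < 2 * (nrm b + 1) by rewrite mulr_gt0 // ltr_wpDl // nrm_ge0.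
have [n [i ni]] := Da _ (divr_gt0 e0 b1).
(* The tolerance for [b] is chosen after the approximant of [a], since the norm of that approximant
   multiplies the error in [b]. *)
have i1 : 0 < 2 * (nrm (gens n i) + 1) by rewrite mulr_gt0 // ltr_wpDl // nrm_ge0.
have [m [j mj]] := Db _ (divr_gt0 e0 i1).
have [N [i' [j' [iE jE]]]] := common n i m j.
exists N.+1, (pickle (i', j', (0%Q, 0%Q), 1%N)); rewrite op iE jE.
have -> : gens n i ** gens m j - a ** b =
    (gens n i - a) ** b + gens n i ** (gens m j - b).
  by rewrite !smulE; lmod R[i].
apply: le_trans (nrmD _ _) _; rewrite [leRHS]splitr.
apply: lerD; apply: le_trans (nrmM _ _) _; first exact: half e0 (nrm_ge0 _) b1 ni.
by rewrite mulrC; exact: half e0 (nrm_ge0 _) i1 mj.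
Qed.

Let genS a : a \in gen_pred -> star a \in gen_pred.
Proof.
move=> /gen_predP Da; apply/gen_predP => e /Da[n [i ni]].
exists n.+1, (pickle (i, 0%N, (0%Q, 0%Q), 2%N)); rewrite op.
by rewrite -starN -starD nrmS.
Qed.

Let genZ (z : R[i]) a : a \in gen_pred -> z *: a \in gen_pred.
Proof.
move=> /gen_predP Da; apply/gen_predP => e e0.
have a1 : 0 < 2 * (nrm a + 1) by rewrite mulr_gt0 // ltr_wpDl // nrm_ge0.
have [p [p' hp]] := complex_rat_approx z (divr_gt0 e0 a1).
set w : R[i] := _ +i* _ in hp.
have w1 : 0 < 2 * (cmod w + 1) by rewrite mulr_gt0 // ltr_wpDl // cmod_ge0.
have [n [i ni]] := Da _ (divr_gt0 e0 w1).
exists n.+1, (pickle (i, 0%N, (p, p'), 3%N)); rewrite op -/w.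
have -> : w *: gens n i - z *: a = w *: (gens n i - a) - (z - w) *: a.
  by lmod R[i].
apply: le_trans (nrmB _ _) _; rewrite [leRHS]splitr !nrmZ.
apply: lerD; last exact: half e0 (nrm_ge0 _) a1 hp.
by rewrite mulrC; exact: half e0 (cmod_ge0 _) w1 ni.
Qed.

Let gens_in n k : gens n k \in gen_pred.
Proof. by apply/gen_predP => e e0; exists n, k; rewrite subrr nrm0 ltW. Qed.

Let gen_submod : submod_closed gen_pred.
Proof.
split=> [|z a b Da Db]; last by apply: genD => //; exact: genZ.
by rewrite -(scale0r (gens 0 0)); apply: genZ.
Qed.

Definition gen_subalg := StarSubalg gen_submod (fun a b Da Db => genM Da Db)
  (fun a Da => genS Da).

Let gen_lim a : (forall e : R, 0 < e -> exists2 b, b \in gen_pred & nrm (b - a) <= e) ->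
  a \in gen_pred.
Proof.
move=> h; apply/gen_predP => e e0; have e2 : 0 < e / 2 by rewrite divr_gt0.
have [b /gen_predP/(_ _ e2)[n [k nk]] ba] := h _ e2; exists n, k.
by apply: le_trans (nrm_triangle b _ _) _; rewrite [leRHS]splitr lerD.
Qed.

Lemma gen_subalg_gen i : c i \in gen_subalg.
Proof.
apply: gen_lim => e e0; have [j hj] := q_dense (alpha_near alpha 1%g (c i) e0).
exists (alpha (q j) (c i)); last by rewrite act1 in hj.
by have := gens_in 0 (pickle (i, j)); rewrite /= pickleK.
Qed.

Lemma gen_subalg_closed : closed [set` gen_subalg].
Proof.
move=> a aD; apply: gen_lim => e e0.
have [|b [/= Db ba]] := aD [set b | nrm (b - a) <= e].
  by apply/nbhs_nrmP; exists e.
by exists b.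
Qed.

Lemma gen_subalg_separable : separable_set [set` gen_subalg].
Proof.
exists [set gens nk.1 nk.2 | nk in [set: nat * nat]]; split.
- exact: card_le_trans (card_image_le _ _) (countableP _).
- by move=> _ [nk _ <-]; exact: gens_in.
- move=> a /gen_predP Da B /nbhs_nrmP[e e0 eB].
  have [n [k nk]] := Da _ e0; exists (gens n k); split; last exact: eB.
  by exists (n, k).
Qed.

(** Only stage [0] needs an argument: [alpha g] sends [alpha (q j) (c i)] to a translate by
    [g * q j], a limit of translates by members of the dense sequence. The operations commute with
    [alpha g], and closure follows by isometry. *)
Lemma gen_subalg_invariant g a : a \in gen_subalg -> alpha g a \in gen_subalg.
Proof.
have h n k : alpha g (gens n k) \in gen_pred.
  elim: n k => [|n IH] k /=.
    case: (unpickle k) => [[i j]|].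
      apply: gen_lim => e e0.
      have [m hm] := q_dense (alpha_near alpha (g * q j)%g (c i) e0).
      exists (alpha (q m) (c i)); last by rewrite -actM.
      by have := gens_in 0 (pickle (i, m)); rewrite /= pickleK.
    by rewrite alpha0; case: gen_submod.
  case: (unpickle k) => [[[[i j] [r s]] tag]|]; last first.
    by rewrite alpha0; case: gen_submod.
  case: tag => [|[|[|[|tag]]]].
  - by rewrite alphaD; exact: genD.
  - by rewrite alphaM; exact: genM.
  - by rewrite alphaS; exact: genS.
  - by rewrite alphaZ; exact: genZ.
  - exact: IH.
move=> /gen_predP Da; apply: gen_lim => e /Da[n [k nk]].
by exists (alpha g (gens n k)) => //; rewrite -alphaB nrm_alpha.
Qed.

End SeparableSubalgebra.

Lemma separable_invariant_subalg (R : realType) (G : topGroupType)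
    (A : cstarAlgType R) (alpha : cstarAction G A) (c : nat -> A) :
  @second_countable G ->
  exists D : starSubalg A, [/\ closed [set` D], separable_set [set` D],
    forall g a, a \in D -> alpha g a \in D & forall i, c i \in D].
Proof.
move=> /second_countable_dense[q qd]; exists (gen_subalg alpha q c).
split; [exact: gen_subalg_closed|exact: gen_subalg_separable| |].
  by move=> g a; exact: gen_subalg_invariant.
by move=> i; exact: gen_subalg_gen.
Qed.

(** * Partitions of unity *)

Section PartitionOfUnity.
Variables (R : realType) (G : topGroupType) (A : cstarAlgType R).
Variable alpha : cstarAction G A.

Lemma sum_continuous (I : Type) (r : seq I) (f : I -> G -> R) :
  (forall i, continuous (f i)) -> continuous (fun g => \sum_(i <- r) f i g).
Proof.
move=> fc g; elim: r => [|i r IH].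
  by under eq_fun do rewrite big_nil; exact: cvg_cst.
under eq_fun do rewrite big_cons.
by apply: cvgD; [exact: fc|exact: IH].
Qed.

Lemma complexify_continuous (f : G -> R) : continuous f ->
  (fun g => (f g)%:C : R[i]^o) \in cont_subalg R G.
Proof.
move=> fc; apply/cont_predP => g; apply/cvgrPdist_le => e e0.
have er : e = (complex.Re e)%:C by rewrite RRe_real // gtr0_real.
have e0' : 0 < complex.Re e by rewrite -ltcR -er.
have /cvgrPdist_le/(_ _ e0') := fc g; apply: filterS => h.
by rewrite -rmorphB cmodE cmodR er lecR.
Qed.

Lemma orbit_nrm_continuous (a b : A) : continuous (fun g => nrm (alpha g a - b) : R).
Proof.
move=> g; apply/cvgrPdist_le => e e0; apply: filterS (alpha_near alpha g a e0) => h.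
rewrite nrm_distC; apply: le_trans; apply: le_trans (nrm_dist _ _) _.
by rewrite opprB addrA subrK.
Qed.

Hypothesis Gc : compact [set: G].

(** The orbit distance [d h] to the translates by [h], summed over [l], is continuous, and finitely
    many sets where it is below [e] cover [G]. Bumps on these sets are divided by the root of the
    sum of their squares, which normalises [sum star s ** s]. *)
Lemma orbit_partition_of_unity (l : seq A) (e : R) : 0 < e ->
  exists n (gamma : 'I_n -> G) (s : 'I_n -> contFun R G),
    \sum_p star (s p) ** s p = cont_one R G /\
    forall p g, val (s p) g != 0 -> forall a, a \in l ->
      nrm (alpha g a - alpha (gamma p) a) <= e.
Proof.
move=> e0.
pose d h g : R := \sum_(a <- l) nrm (alpha g a - alpha h a).
have dc h : continuous (d h).
  by apply: sum_continuous => a; exact: orbit_nrm_continuous.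
have dge a h g : a \in l -> nrm (alpha g a - alpha h a) <= d h g.
  move=> al; rewrite /d (big_rem a) //= lerDl; apply: sumr_ge0 => b _.
  exact: nrm_ge0.
have [|L _ LP] := @compact_net G setT (fun h => [set g | d h g < e]) Gc.
  move=> h _; have /cvgrPdist_lt/(_ _ e0) := dc h h.
  apply: filterS => g; have -> : d h h = 0.
    by rewrite /d big1 // => a _; rewrite subrr nrm0.
  by rewrite sub0r normrN; apply: le_lt_trans; exact: ler_norm.
pose gamma (p : 'I_(size L)) := nth 1%g L p.
(* This is twice the positive part of [e - d (gamma p) g]; the factor disappears in the
   normalisation. *)
pose u p g : R := (e - d (gamma p) g) + `|e - d (gamma p) g|.
have uc p : continuous (u p).
  move=> g; have h : (fun g => e - d (gamma p) g) @ g --> e - d (gamma p) g.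
    by apply: cvgB; [exact: cvg_cst|exact: dc].
  by apply: cvgD => //; exact: cvg_norm.
have u0 p g : u p g != 0 -> d (gamma p) g < e.
  apply: contraNT; rewrite -leNgt => h; rewrite /u ler0_norm ?subrr //.
  by rewrite subr_le0.
pose U g := Num.sqrt (\sum_p u p g * u p g).
have Upos g : 0 < \sum_p u p g * u p g.
  have [h hL hg] := LP g I.
  have hi : (index h L < size L)%N by rewrite index_mem.
  rewrite (bigD1 (Ordinal hi)) //=; apply: ltr_pwDl.
    rewrite -expr2 exprn_gt0 // /u /gamma /= nth_index //.
    have eg : 0 < e - d h g by rewrite subr_gt0.
    by rewrite gtr0_norm // addr_gt0.
  by apply: sumr_ge0 => p _; rewrite -expr2 sqr_ge0.
have U0 g : U g != 0 by rewrite gt_eqF // sqrtr_gt0.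
have Uc : continuous U.
  move=> g; apply: continuous_comp; last exact: sqrt_continuous.
  by apply: sum_continuous => p {}g; apply: cvgM; exact: uc.
have sc p : continuous (fun g => u p g / U g).
  by move=> g; apply: cvgM; [exact: uc|apply: cvgV => //; exact: Uc].
pose s p : contFun R G := SubStar (complexify_continuous (sc p)).
exists (size L), gamma, s; split.
  apply: val_inj; rewrite (big_morph val (fun _ _ => erefl) erefl).
  apply/funext => g.
  have -> : (\sum_p val (star (s p) ** s p)) g = \sum_p val (star (s p) ** s p) g.
    by elim/big_rec2: _ => // p x y _ <-.
  rewrite (eq_bigr (fun p => (u p g * u p g / (U g * U g))%:C)).
    rewrite -(rmorph_sum (real_complex R)) /= -mulr_suml -expr2 sqr_sqrtr ?ltW //.
    by rewrite mulfV ?gt_eqF.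
  move=> p _; rewrite /= -[LHS]/(Num.conj ((u p g / U g)%:C : R[i]) * (u p g / U g)%:C).
  rewrite conj_Creal ?complex_real // -rmorphM /=; congr _%:C.
  by field.
move=> p g sg a al; apply: le_trans (dge _ _ _ al) _; apply/ltW/u0.
by apply: contraNneq sg => up /=; rewrite up mul0r.
Qed.

End PartitionOfUnity.

(** * The sequence algebra *)

Section SequenceAlgebraNorm.
Variables (R : realType) (A : cstarAlgType R).
Implicit Types (a b : linf A) (x y : Ainf A) (c d e : R).

Lemma etaD a b : Defs.eta (a + b) = Defs.eta a + Defs.eta b.
Proof. exact: quot_mapD. Qed.

Lemma etaZ (z : R[i]) a : Defs.eta (z *: a) = z *: Defs.eta a.
Proof. exact: quot_mapZ. Qed.

Lemma etaM a b : Defs.eta (a ** b) = Defs.eta a ** Defs.eta b.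
Proof. by have [_ + _] := quot_map_star_hom (c0_ideal A); exact. Qed.

Lemma etaS a : Defs.eta (star a) = star (Defs.eta a).
Proof. by have [_ _ +] := quot_map_star_hom (c0_ideal A); exact. Qed.

Lemma etaN a : Defs.eta (- a) = - Defs.eta a.
Proof. by rewrite -scaleN1r etaZ scaleN1r. Qed.

Lemma eta0 : Defs.eta (0 : linf A) = 0.
Proof. by rewrite -(scale0r (0 : linf A)) etaZ scale0r. Qed.

Lemma eta_sum (I : Type) (r : seq I) (P : pred I) (F : I -> linf A) :
  Defs.eta (\sum_(i <- r | P i) F i) = \sum_(i <- r | P i) Defs.eta (F i).
Proof. exact: (big_morph _ etaD eta0). Qed.

Lemma linf_sumE (I : Type) (r : seq I) (P : pred I) (F : I -> linf A) n :
  val (\sum_(i <- r | P i) F i) n = \sum_(i <- r | P i) val (F i) n.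
Proof. by elim/big_rec2: _ => // i x y _ <-. Qed.

Lemma etaP a b : Defs.eta a = Defs.eta b <->
  forall e, 0 < e -> \forall n \near \oo, nrm (val a n - val b n) <= e.
Proof.
split=> [/quot_mapP/c0_predP/cvg_nrmP h e /h|h].
  by apply: filterS => n; rewrite subr0.
apply/quot_mapP/c0_predP/cvg_nrmP => e /h; apply: filterS => n.
by rewrite subr0.
Qed.

Lemma eta_surj x : exists a, Defs.eta a = x.
Proof. by exists (repr x); exact: quot_reprK. Qed.

Lemma constD (u v : A) : Ainf_const (u + v) = Ainf_const u + Ainf_const v.
Proof. by rewrite -etaD; congr Defs.eta; apply: val_inj. Qed.

Lemma constZ (z : R[i]) (u : A) : Ainf_const (z *: u) = z *: Ainf_const u.
Proof. by rewrite -etaZ; congr Defs.eta; apply: val_inj. Qed.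

Lemma constM (u v : A) : Ainf_const (u ** v) = Ainf_const u ** Ainf_const v.
Proof. by rewrite -etaM; congr Defs.eta; apply: val_inj. Qed.

Lemma constN (u : A) : Ainf_const (- u) = - Ainf_const u.
Proof. by rewrite -scaleN1r constZ scaleN1r. Qed.

(* [ninf x c] says that the quotient norm of [x] is at most [c]. *)
Definition ninf x c := exists2 a, Defs.eta a = x &
  forall e, 0 < e -> \forall n \near \oo, nrm (val a n) <= c + e.

(** Representatives of one class differ by a null sequence, so the bound of one of them passes to
    all. *)
Lemma ninf_eta a c : ninf (Defs.eta a) c ->
  forall e, 0 < e -> \forall n \near \oo, nrm (val a n) <= c + e.
Proof.
move=> [b /etaP ab hb] e e0; have e2 : 0 < e / 2 by rewrite divr_gt0.
apply: filterS2 (ab _ e2) (hb _ e2) => n h1 h2.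
have := nrmB (val b n) (val b n - val a n).
by rewrite opprB addrC subrK => *; lra.
Qed.

Lemma ninf_le x c d : ninf x c -> c <= d -> ninf x d.
Proof.
move=> [a ax h] cd; exists a => // e /h; apply: filterS => n /le_trans; apply.
by rewrite lerD2r.
Qed.

Lemma ninf_lim x c : (forall e, 0 < e -> ninf x (c + e)) -> ninf x c.
Proof.
move=> h; have [a ax] := eta_surj x; exists a => // e e0.
have e2 : 0 < e / 2 by rewrite divr_gt0.
have := h _ e2; rewrite -ax => /ninf_eta/(_ _ e2).
by apply: filterS => n; rewrite -addrA -splitr.
Qed.

Lemma ninfD x y c d : ninf x c -> ninf y d -> ninf (x + y) (c + d).
Proof.
move=> [a ax ha] [b b_y hb]; exists (a + b); first by rewrite etaD ax b_y.
move=> e e0; have e2 : 0 < e / 2 by rewrite divr_gt0.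
apply: filterS2 (ha _ e2) (hb _ e2) => n h1 h2 /=.
by have := nrmD (val a n) (val b n) => *; lra.
Qed.

Lemma ninfN x c : ninf x c -> ninf (- x) c.
Proof.
move=> [a ax ha]; exists (- a); first by rewrite etaN ax.
by move=> e /ha; apply: filterS => n; rewrite /= nrmN.
Qed.

Lemma ninfB x y c d : ninf x c -> ninf y d -> ninf (x - y) (c + d).
Proof. by move=> hx /ninfN; exact: ninfD. Qed.

Lemma ninfM x y c d : 0 <= c -> 0 <= d -> ninf x c -> ninf y d ->
  ninf (x ** y) (c * d).
Proof.
move=> c0 d0 [a ax ha] [b b_y hb]; exists (a ** b); first by rewrite etaM ax b_y.
move=> e e0.
(* Chosen so that [(c + k) (d + k) <= c d + e]; the summand [e] in the denominator ensures
   [k <= 1]. *)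
pose k := e / (c + d + e + 1).
have k0 : 0 < c + d + e + 1 by lra.
have k1 : 0 < k by rewrite divr_gt0.
have kE : k * (c + d + e + 1) = e by rewrite /k mulrAC -mulrA mulfV ?mulr1 // gt_eqF.
have ke : k <= 1 by rewrite /k ler_pdivrMr //; lra.
apply: filterS2 (ha _ k1) (hb _ k1) => n h1 h2 /=.
apply: le_trans (nrmM _ _) _.
apply: le_trans (ler_pM (nrm_ge0 _) (nrm_ge0 _) h1 h2) _.
nra.
Qed.

Lemma ninf_const (u : A) : ninf (Ainf_const u) (nrm u).
Proof.
exists (linf_const u) => // e e0; apply: nearW => n /=.
by rewrite lerDl ltW.
Qed.

Lemma linf_bound a : exists2 M : R, 0 <= M & forall n, nrm (val a n) <= M.
Proof.
have /linf_predP[M aM] := valP a.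
have M0 : 0 <= M by exact: le_trans (aM 0%N).
have Mr : M = (complex.Re M)%:C by rewrite RRe_real // ger0_real.
exists (complex.Re M); first by rewrite -lecR -Mr.
by move=> n; rewrite -lecR -Mr -nrmE.
Qed.

Lemma ninf_ex x : exists2 c, 0 <= c & ninf x c.
Proof.
have [a ax] := eta_surj x; have [M M0 aM] := linf_bound a.
exists M => //; exists a => // e e0; apply: nearW => n.
by apply: le_trans (aM n) _; rewrite lerDl ltW.
Qed.

(** Representatives of the [w p] reduce the claim to [nrm_conj_sum_le] in each coordinate. *)
Lemma ninf_conj_sum (P : finType) (w : P -> Ainf A) (u : P -> A) c d :
  0 <= c -> 0 <= d -> ninf (\sum_p star (w p) ** w p) c ->
  (forall p, nrm (u p) <= d) ->
  ninf (\sum_p star (w p) ** Ainf_const (u p) ** w p) (d * c).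
Proof.
move=> c0 d0 hw hu.
pose b p := projT1 (cid (eta_surj (w p))).
have bw p : Defs.eta (b p) = w p by rewrite /b; case: cid.
have hb : ninf (Defs.eta (\sum_p star (b p) ** b p)) c.
  rewrite eta_sum; rewrite (eq_bigr (fun p => star (w p) ** w p)) // => p _.
  by rewrite etaM etaS bw.
exists (\sum_p star (b p) ** linf_const (u p) ** b p).
  by rewrite eta_sum; apply: eq_bigr => p _; rewrite !etaM etaS bw.
move=> e e0; have d1 : 0 < d + 1 by lra.
apply: filterS (ninf_eta hb (divr_gt0 e0 d1)) => n; rewrite !linf_sumE => h.
apply: le_trans (nrm_conj_sum_le _ hu) _.
apply: le_trans (ler_wpM2l d0 h) _; rewrite mulrDr lerD2l mulrA ler_pdivrMr //.
by nra.
Qed.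

End SequenceAlgebraNorm.

Section SequenceActions.
Variables (R : realType) (G : topGroupType) (A : cstarAlgType R).
Variable alpha : cstarAction G A.
Implicit Types (a b : linf A) (x y : Ainf A) (g : G).

Lemma act_linfE g a n : val (act_linf alpha g a) n = alpha g (val a n).
Proof.
have h : (fun n => alpha g (val a n)) \in linf_subalg A.
  have [M M0 aM] := linf_bound a; apply/linf_predP; exists M%:C => k.
  by rewrite nrmE lecR nrm_alpha.
by rewrite /act_linf sub_liftE.
Qed.

Lemma act_AinfE g a : act_Ainf alpha g (Defs.eta a) = Defs.eta (act_linf alpha g a).
Proof.
apply: quot_liftE => b c /quot_mapP/etaP bc; apply/quot_mapP/etaP => e /bc.
by apply: filterS => n; rewrite !act_linfE -alphaB nrm_alpha.
Qed.

Lemma act_AinfP g (z : R[i]) x y :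
  act_Ainf alpha g (z *: x + y) = z *: act_Ainf alpha g x + act_Ainf alpha g y.
Proof.
have [a <-] := eta_surj x; have [b <-] := eta_surj y.
rewrite -etaZ -etaD !act_AinfE -etaZ -etaD; congr Defs.eta; apply: val_inj.
apply/funext => n; rewrite act_linfE.
transitivity (alpha g (z *: val a n + val b n)); first by [].
by rewrite alphaP -!act_linfE.
Qed.

Lemma act_AinfM g x y :
  act_Ainf alpha g (x ** y) = act_Ainf alpha g x ** act_Ainf alpha g y.
Proof.
have [a <-] := eta_surj x; have [b <-] := eta_surj y.
rewrite -etaM !act_AinfE -etaM; congr Defs.eta; apply: val_inj.
apply/funext => n; rewrite act_linfE.
transitivity (alpha g (val a n ** val b n)); first by [].
by rewrite alphaM -!act_linfE.
Qed.

Lemma act_Ainf0 g : act_Ainf alpha g 0 = 0.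
Proof. by have := act_AinfP g (-1) 0 0; rewrite !scaleN1r !addNr. Qed.

Lemma act_AinfD g x y :
  act_Ainf alpha g (x + y) = act_Ainf alpha g x + act_Ainf alpha g y.
Proof. by rewrite -[x]scale1r act_AinfP !scale1r. Qed.

Lemma act_Ainf_sum g (I : Type) (r : seq I) (P : pred I) (F : I -> Ainf A) :
  act_Ainf alpha g (\sum_(i <- r | P i) F i) =
  \sum_(i <- r | P i) act_Ainf alpha g (F i).
Proof. exact: (big_morph _ (act_AinfD g) (act_Ainf0 g)). Qed.

Lemma act_Ainf_const g (u : A) :
  act_Ainf alpha g (Ainf_const u) = Ainf_const (alpha g u).
Proof.
rewrite act_AinfE; congr Defs.eta; apply: val_inj.
by apply/funext => n; rewrite act_linfE.
Qed.

Lemma linf_alphaP a : linf_alpha alpha a <->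
  forall g0 (e : R), 0 < e ->
    \forall g \near g0, forall n, nrm (alpha g (val a n) - alpha g0 (val a n)) <= e.
Proof.
split=> h g0 e e0; apply: filterS (h g0 e e0) => g hg n; have := hg n;
  by rewrite !act_linfE nrmE lecR.
Qed.

Lemma linf_alphaD a b : linf_alpha alpha a -> linf_alpha alpha b ->
  linf_alpha alpha (a + b).
Proof.
move=> /linf_alphaP ha /linf_alphaP hb; apply/linf_alphaP => g0 e e0.
have e2 : 0 < e / 2 by rewrite divr_gt0.
apply: filterS2 (ha g0 _ e2) (hb g0 _ e2) => g h1 h2 n.
rewrite /= !alphaD opprD addrACA; apply: le_trans (nrmD _ _) _.
by rewrite [leRHS]splitr; apply: lerD; [exact: h1|exact: h2].
Qed.

Lemma linf_alphaM a b : linf_alpha alpha a -> linf_alpha alpha b ->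
  linf_alpha alpha (a ** b).
Proof.
move=> /linf_alphaP ha /linf_alphaP hb; apply/linf_alphaP => g0 e e0.
have [M M0 aM] := linf_bound a; have [N N0 bN] := linf_bound b.
pose k := M + N + 1; have k0 : 0 < k by rewrite /k; lra.
have ek : 0 < e / k by rewrite divr_gt0.
apply: filterS2 (ha g0 _ ek) (hb g0 _ ek) => g h1 h2 n.
rewrite /= !alphaM.
set u := val a n in h1 *; set v := val b n in h2 *.
have -> : alpha g u ** alpha g v - alpha g0 u ** alpha g0 v =
   (alpha g u - alpha g0 u) ** alpha g v + alpha g0 u ** (alpha g v - alpha g0 v).
  by rewrite !smulE; lmod R[i].
apply: le_trans (nrmD _ _) _.
have l1 : nrm ((alpha g u - alpha g0 u) ** alpha g v) <= e / k * N.
  apply: le_trans (nrmM _ _) _; apply: ler_pM;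
    by [exact: nrm_ge0|exact: nrm_ge0|exact: h1|rewrite nrm_alpha; exact: bN].
have l2 : nrm (alpha g0 u ** (alpha g v - alpha g0 v)) <= M * (e / k).
  apply: le_trans (nrmM _ _) _; apply: ler_pM;
    by [exact: nrm_ge0|exact: nrm_ge0|rewrite nrm_alpha; exact: aM|exact: h2].
have kE : e / k * k = e by rewrite mulrAC -mulrA mulfV ?mulr1 // gt_eqF.
by rewrite /k in kE l1 l2 ek *; nra.
Qed.

Lemma linf_alphaS a : linf_alpha alpha a -> linf_alpha alpha (star a).
Proof.
move=> /linf_alphaP ha; apply/linf_alphaP => g0 e e0.
apply: filterS (ha g0 _ e0) => g h n.
by rewrite /= !alphaS -starN -starD nrmS; exact: h.
Qed.

Lemma linf_alpha_const (u : A) : linf_alpha alpha (linf_const u).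
Proof.
apply/linf_alphaP => g0 e e0.
by apply: filterS (alpha_near alpha g0 u e0) => g h n.
Qed.

Lemma linf_alpha_sum (I : Type) (r : seq I) (F : I -> linf A) :
  (forall i, linf_alpha alpha (F i)) -> linf_alpha alpha (\sum_(i <- r) F i).
Proof.
move=> h; elim/big_ind: _ => //; last exact: linf_alphaD.
apply/linf_alphaP => g0 e e0; apply: nearW => g n /=.
by rewrite !alpha0 subrr nrm0 ltW.
Qed.

(** The hypothesis gives, for each [g], a tail depending on [g]. Equicontinuity of the sequence,
    which is what membership in [linf_alpha] provides, reduces all [g] to a finite net and hence to
    one common tail. *)
Lemma uniform_almost_fixed a c : compact [set: G] -> linf_alpha alpha a ->
  (forall g, ninf (act_Ainf alpha g (Defs.eta a) - Defs.eta a) c) ->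
  forall e : R, 0 < e ->
    \forall n \near \oo, forall g, nrm (alpha g (val a n) - val a n) <= c + e.
Proof.
move=> Gc /linf_alphaP ha hc e e0; have e2 : 0 < e / 2 by rewrite divr_gt0.
have [|L _ LP] := @compact_net G setT (fun h => [set g |
    forall n, nrm (alpha g (val a n) - alpha h (val a n)) <= e / 2]) Gc.
  by move=> h _; exact: ha.
have : \forall n \near \oo, forall h, h \in L ->
    nrm (alpha h (val a n) - val a n) <= c + e / 2.
  apply: near_all_seq => h _; have := hc h.
  rewrite act_AinfE -etaN -etaD => /ninf_eta/(_ _ e2); apply: filterS => n.
  by rewrite -act_linfE; exact.
apply: filterS => n hn g; have [h /hn hL hg] := LP g I.
have := nrm_triangle (alpha h (val a n)) (alpha g (val a n)) (val a n).
by have := hg n => *; lra.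
Qed.

End SequenceActions.

(** * Central lifts of Rokhlin homomorphisms *)

Section CentralLift.
Variables (R : realType) (G : topGroupType) (A : cstarAlgType R).
Variable alpha : cstarAction G A.
Implicit Types (a d : A) (g : G).

(* Choosing representatives of [phi f] in [A_infty] preserves the relations of
   [C(G)] only after multiplication by constants from [D]. *)
Record central_lift (D : starSubalg A) (beta : contFun R G -> Ainf A) : Prop := {
  clC : forall f d, d \in D ->
    beta f ** Ainf_const d = Ainf_const d ** beta f ;
  clM : forall f h d, d \in D ->
    beta (f ** h) ** Ainf_const d = beta f ** beta h ** Ainf_const d ;
  clS : forall f d, d \in D ->
    beta (star f) ** Ainf_const d = star (beta f) ** Ainf_const d ;
  clD : forall f h d, d \in D ->
    beta (f + h) ** Ainf_const d = beta f ** Ainf_const d + beta h ** Ainf_const d ;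
  cl1 : forall d, d \in D -> beta (cont_one R G) ** Ainf_const d = Ainf_const d ;
  clA : forall g f d, d \in D ->
    act_Ainf alpha g (beta f) ** Ainf_const d =
    beta (Defs.left_trans g f) ** Ainf_const d ;
  clL : forall f, Ainf_alpha alpha (beta f)
}.

Definition approx_unit (e : nat -> A) := forall a,
  (fun n => e n ** a) @ \oo --> a /\ (fun n => a ** e n) @ \oo --> a.

Hypothesis Gc : compact [set: G].

(** The orbit of [d] is approximated by a finite net, and [|e n| <= 1] keeps the error made in
    passing to the net from growing. *)
Lemma approx_unit_orbit (e : nat -> A) d (eps : R) : approx_unit e ->
  (forall n, nrm (e n) <= 1) -> 0 < eps ->
  \forall n \near \oo, forall g, nrm (e n ** alpha g d - alpha g d) <= eps /\
    nrm (alpha g d ** e n - alpha g d) <= eps.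
Proof.
move=> eu e1 eps0; have eps3 : 0 < eps / 3 by rewrite divr_gt0.
have [|L _ LP] := @compact_net G setT
    (fun h => [set g | nrm (alpha g d - alpha h d) <= eps / 3]) Gc.
  by move=> h _; exact: alpha_near.
have : \forall n \near \oo, forall h, h \in L ->
    nrm (e n ** alpha h d - alpha h d) <= eps / 3 /\
    nrm (alpha h d ** e n - alpha h d) <= eps / 3.
  apply: near_all_seq => h _; have [/cvg_nrmP h1 /cvg_nrmP h2] := eu (alpha h d).
  by apply: filterS2 (h1 _ eps3) (h2 _ eps3).
apply: filterS => n hn g; have [h /hn [h1 h2] hg] := LP g I.
set u := alpha g d in hg *; set v := alpha h d in h1 h2 hg *.
have mle (x y : A) : nrm x <= 1 -> nrm (x ** y) <= nrm y /\ nrm (y ** x) <= nrm y.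
  move=> x1; split; apply: le_trans (nrmM _ _) _.
    by rewrite -[leRHS]mul1r ler_wpM2r ?nrm_ge0.
  by rewrite -[leRHS]mulr1 ler_wpM2l ?nrm_ge0.
have [m1 m2] := mle (e n) (u - v) (e1 n); rewrite /= -/u -/v in hg.
split.
- have -> : e n ** u - u = e n ** (u - v) + ((e n ** v - v) - (u - v)).
    by rewrite !smulE; lmod R[i].
  have := nrmD (e n ** (u - v)) ((e n ** v - v) - (u - v)).
  by have := nrmB (e n ** v - v) (u - v) => *; lra.
- have -> : u ** e n - u = (u - v) ** e n + ((v ** e n - v) - (u - v)).
    by rewrite !smulE; lmod R[i].
  have := nrmD ((u - v) ** e n) ((v ** e n - v) - (u - v)).
  by have := nrmB (v ** e n - v) (u - v) => *; lra.
Qed.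

Variables (t : nat -> seq G) (E : A -> A).
Hypothesis t0 : forall n, t n != [::].
Hypothesis tE : forall a, (fun n => avg alpha (t n) a) @ \oo --> E a.
Hypothesis Efix : forall a g, alpha g (E a) = E a.

(** [alpha g a ** d - d] is the image under [alpha g] of the same expression for [a] and
    [alpha g^-1 d], so the hypothesis bounds every term of the averages. *)
Lemma lim_avg_mul a d (eps : R) :
  (forall g, nrm (a ** alpha g d - alpha g d) <= eps /\
    nrm (alpha g d ** a - alpha g d) <= eps) ->
  nrm (E a ** d - d) <= eps /\ nrm (d ** E a - d) <= eps.
Proof.
move=> h.
have orb g : nrm (alpha g a ** d - d) <= eps /\ nrm (d ** alpha g a - d) <= eps.
  rewrite -{1 2 3 4}(alphaVK alpha g d) -!alphaM -!alphaB !nrm_alpha.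
  exact: h.
have d1 : 0 < nrm d + 1 by rewrite ltr_wpDl // nrm_ge0.
have near_E k : 0 < k -> exists n, nrm (E a - avg alpha (t n) a) * nrm d <= k.
  move=> k0; have /cvg_nrmP/(_ _ (divr_gt0 k0 d1)) [n _ /(_ n (leqnn n)) hn] := @tE a.
  exists n; rewrite nrm_distC; apply: le_trans (ler_wpM2r (nrm_ge0 d) hn) _.
  by rewrite mulrAC ler_pdivrMr //; apply: ler_wpM2l; [exact: ltW|rewrite lerDl].
split; apply/ler_addgt0Pr => k /near_E[n hn].
- have -> : E a ** d - d = (avg alpha (t n) a ** d - d) + (E a - avg alpha (t n) a) ** d.
    by rewrite !smulE; lmod R[i].
  apply: le_trans (nrmD _ _) _; apply: lerD; last exact: le_trans (nrmM _ _) hn.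
  have -> : avg alpha (t n) a ** d - d = mean (t n) (fun g => alpha g a ** d - d).
    by rewrite meanD meanN mean_const // /avg /mean smulZl smul_suml.
  by apply: nrm_mean_le => // g _; case: (orb g).
- have -> : d ** E a - d = (d ** avg alpha (t n) a - d) + d ** (E a - avg alpha (t n) a).
    by rewrite !smulE; lmod R[i].
  apply: le_trans (nrmD _ _) _; apply: lerD.
    have -> : d ** avg alpha (t n) a - d = mean (t n) (fun g => d ** alpha g a - d).
      by rewrite meanD meanN mean_const // /avg /mean smulZr smul_sumr.
    by apply: nrm_mean_le => // g _; case: (orb g).
  by apply: le_trans (nrmM _ _) _; rewrite mulrC.
Qed.

Variable e : nat -> A.
Hypothesis eu : approx_unit e.
Hypothesis e1 : forall n, nrm (e n) <= 1.

(* Averaging an approximate unit gives an invariant element of [A_infty] acting as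
   a unit on the constants; it is the test element for [phi 1]. *)
Let ebar_linf : (fun n => E (e n)) \in linf_subalg A.
Proof.
apply/linf_predP; exists 1 => n; rewrite nrmE lecR.
by apply: le_trans (nrm_lim_avg t0 tE _) (e1 n).
Qed.

Let ebar : linf A := SubStar ebar_linf.

Let ebarl d : Defs.eta ebar ** Ainf_const d = Ainf_const d.
Proof.
rewrite -etaM; apply/etaP => eps eps0.
apply: filterS (approx_unit_orbit d eu e1 eps0) => n hn.
by case: (lim_avg_mul hn).
Qed.

Let ebarr d : Ainf_const d ** Defs.eta ebar = Ainf_const d.
Proof.
rewrite -etaM; apply/etaP => eps eps0.
apply: filterS (approx_unit_orbit d eu e1 eps0) => n hn.
by case: (lim_avg_mul hn).
Qed.

Variable D : starSubalg A.
Hypothesis Dinv : forall g a, a \in D -> alpha g a \in D.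
Variable phi : contFun R G -> central_seq D.
Hypothesis phi_hom : star_hom phi.
Hypothesis phi_alpha : forall f, F_alpha alpha (phi f).
Hypothesis phi1 : forall y : central_seq D, F_alpha alpha y ->
  phi (cont_one R G) ** y = y /\ y ** phi (cont_one R G) = y.
Hypothesis phiA : forall g f, phi (Defs.left_trans g f) = act_F alpha g (phi f).

Implicit Types x y : sub_star (commutant D).

Let kappa_eq x y d : kappa x = kappa y -> d \in D ->
  val x ** Ainf_const d = val y ** Ainf_const d.
Proof.
move=> /quot_mapP/ann_predP h /h[+ _]; rewrite smulDl smulNl => /eqP.
by rewrite subr_eq0 => /eqP.
Qed.

(** Agreement against [D] on the right suffices, because elements of the commutant commute with
    [D]. *)
Let kappa_eq' x y : (forall d, d \in D ->
  val x ** Ainf_const d = val y ** Ainf_const d) -> kappa x = kappa y.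
Proof.
move=> h; apply/quot_mapP/ann_predP => d dD /=.
have /commutant_predP/(_ d dD) hx := valP x.
have /commutant_predP/(_ d dD) hy := valP y.
rewrite smulDl smulDr smulNl smulNr -hx -hy h // subrr; split=> //.
Qed.

Let lift_ex f : exists2 x, Ainf_alpha alpha (val x) & kappa x = phi f.
Proof. by have [x] := phi_alpha f; exists x. Qed.

Let b f := projT1 (cid2 (lift_ex f)).
Let b_alpha f : Ainf_alpha alpha (val (b f)).
Proof. by rewrite /b; case: cid2. Qed.
Let bE f : kappa (b f) = phi f.
Proof. by rewrite /b; case: cid2. Qed.

Let kappaM x y : kappa (x ** y) = kappa x ** kappa y.
Proof. by have [_ + _] := quot_map_star_hom (ann D); exact. Qed.
Let kappaS x : kappa (star x) = star (kappa x).
Proof. by have [_ _ +] := quot_map_star_hom (ann D); exact. Qed.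
Let kappaD x y : kappa (x + y) = kappa x + kappa y.
Proof. exact: quot_mapD. Qed.

Let act_commutant_closed g (x : Ainf A) :
  x \in commutant D -> act_Ainf alpha g x \in commutant D.
Proof.
move=> /commutant_predP xD; apply/commutant_predP => d dD.
by rewrite -(alphaVK alpha g d) -act_Ainf_const -!act_AinfM xD // Dinv.
Qed.

Let act_commE g x : val (act_commutant alpha g x) = act_Ainf alpha g (val x).
Proof. by apply: sub_liftE; apply: act_commutant_closed; exact: valP. Qed.

Let act_FE g x : act_F alpha g (kappa x) = kappa (act_commutant alpha g x).
Proof.
apply: quot_liftE => y z /quot_mapP yz; apply/quot_mapP/kappa_eq' => d dD.
rewrite !act_commE -(alphaVK alpha g d) -act_Ainf_const -!act_AinfM.
by rewrite (kappa_eq yz) // Dinv.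
Qed.

Lemma exists_central_lift : exists beta, central_lift D beta.
Proof.
exists (fun f => val (b f)); split.
- by move=> f d dD; have /commutant_predP/(_ d dD) := valP (b f).
- move=> f h d dD; apply: (kappa_eq (y := b f ** b h)) => //.
  by rewrite kappaM !bE; have [_ -> _] := phi_hom.
- move=> f d dD; apply: (kappa_eq (y := star (b f))) => //.
  by rewrite kappaS !bE; have [_ _ ->] := phi_hom.
- move=> f h d dD; rewrite -smulDl; apply: (kappa_eq (y := b f + b h)) => //.
  rewrite kappaD !bE; have [lin _ _] := phi_hom.
  by have := lin 1 f h; rewrite !scale1r.
(* The class of [ebar] lies in [F_alpha] because [ebar] is a sequence of invariant elements, so
   [phi 1] fixes it. Multiplying by [d] and using [ebar d = d] removes [ebar]. *)
- move=> d dD.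
  have ec : Defs.eta ebar \in commutant D.
    by apply/commutant_predP => d' _; rewrite ebarl ebarr.
  have ea : linf_alpha alpha ebar.
    apply/linf_alphaP => g0 eps eps0; apply: nearW => g n /=.
    by rewrite !Efix subrr nrm0 ltW.
  have [|h _] := phi1 (y := kappa (SubStar ec)).
    by exists (SubStar ec) => //; exists ebar.
  rewrite -bE -kappaM in h.
  by have := kappa_eq h dD; rewrite /= -smulA !ebarl.
- move=> g f d dD; rewrite -act_commE; apply: kappa_eq => //.
  by rewrite bE phiA -act_FE bE.
- exact: b_alpha.
Qed.

End CentralLift.

Lemma sum_swap (V : nmodType) (P Q : finType) (F : P -> Q -> V) :
  \sum_(r : P * Q) F r.1 r.2 = \sum_(r : Q * P) F r.2 r.1.
Proof. by rewrite -(pair_big xpredT xpredT F) exchange_big pair_big. Qed.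

(** * Sums weighted by a lifted partition of unity *)

Section CentralSums.
Variables (R : realType) (G : topGroupType) (A : cstarAlgType R).
Variable alpha : cstarAction G A.
Variables (D : starSubalg A) (beta : contFun R G -> Ainf A).
Hypothesis cl : central_lift alpha D beta.
Hypothesis Dinv : forall g a, a \in D -> alpha g a \in D.
Implicit Types (d : A) (g : G) (f h : contFun R G) (c : R).
Local Notation iota := (@Ainf_const R A).

Lemma contFunM f h x : val (f ** h) x = val f x * val h x.
Proof. by []. Qed.

Lemma contFunS f x : val (star f) x = Num.conj (val f x).
Proof. by []. Qed.

Lemma contFun_eq f h : (forall x, val f x = val h x) -> f = h.
Proof.
by move=> fh; apply: (@val_inj _ _ (sub_star (cont_subalg R G))); exact/funext.
Qed.

Lemma contFunC f h : f ** h = h ** f.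
Proof. by apply: contFun_eq => x; rewrite !contFunM mulrC. Qed.

Lemma contFun1 f : cont_one R G ** f = f.
Proof. by apply: contFun_eq => x; rewrite contFunM mul1r. Qed.

Lemma cl0 d : d \in D -> beta 0 ** iota d = 0.
Proof.
move=> dD; have := clD cl 0 0 dD; rewrite addr0 => /eqP.
by rewrite -subr_eq0 opprD addrA subrr sub0r oppr_eq0 => /eqP.
Qed.

Lemma cl_sum (I : Type) (r : seq I) (P : pred I) (F : I -> contFun R G) d : d \in D ->
  beta (\sum_(i <- r | P i) F i) ** iota d = \sum_(i <- r | P i) beta (F i) ** iota d.
Proof.
by move=> dD; elim/big_rec2: _ => [|i x y _ <-]; [exact: cl0|exact: (clD cl)].
Qed.

Lemma clCs f d : d \in D -> star (beta f) ** iota d = iota d ** star (beta f).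
Proof.
move=> dD; have := clC cl f (subalgS dD).
by rewrite Ainf_const_star => /(congr1 star); rewrite !starM !starK.
Qed.

Definition sqn f := star f ** f.

(** Centrality moves [d] to the right, after which [star (beta f) ** beta f] may be replaced by the
    lift of [sqn f]. This turns weighted sums into sums of conjugates, to which positivity
    applies. *)
Lemma cl_conj f d : d \in D ->
  star (beta f) ** iota d ** beta f = beta (sqn f) ** iota d.
Proof.
move=> dD; rewrite -(clS cl) // -smulA -(clC cl) // smulA.
exact/esym/(clM cl).
Qed.

Lemma cl_sqn f d : d \in D ->
  star (beta f) ** beta f ** iota d = beta (sqn f) ** iota d.
Proof. by move=> dD; rewrite -cl_conj // -!smulA (clC cl). Qed.

Lemma cl_partition (P : finType) (f : P -> contFun R G) d :
  \sum_p sqn (f p) = cont_one R G -> d \in D ->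
  \sum_p beta (sqn (f p)) ** iota d = iota d.
Proof. by move=> f1 dD; rewrite -cl_sum // f1 (cl1 cl). Qed.

Variable e : nat -> A.
Hypothesis eu : approx_unit e.
Hypothesis e1 : forall n, nrm (e n) <= 1.
Hypothesis eS : forall n, star (e n) = e n.
Hypothesis eD : forall n, e n \in D.

Lemma approx_unit_conj d c : 0 < c ->
  \forall n \near \oo, nrm (e n ** d ** e n - d) <= c.
Proof.
move=> c0; have c2 : 0 < c / 2 by rewrite divr_gt0.
have [/cvg_nrmP h1 /cvg_nrmP h2] := eu d.
apply: filterS2 (h1 _ c2) (h2 _ c2) => n k1 k2.
have -> : e n ** d ** e n - d = (e n ** d - d) ** e n + (d ** e n - d).
  by rewrite !smulE; lmod R[i].
apply: le_trans (nrmD _ _) _; rewrite [leRHS]splitr; apply: lerD => //.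
apply: le_trans (nrmM _ _) _; rewrite -[leRHS]mulr1.
by apply: ler_pM; rewrite ?nrm_ge0.
Qed.

(* Compressing by an element of the approximate unit turns
   [sum w' w = 1 on D] into a genuine norm bound. *)
Lemma central_sum_bound (P : finType) (f : P -> contFun R G) (x : P -> A) c :
  \sum_p sqn (f p) = cont_one R G -> 0 <= c -> (forall p, x p \in D) ->
  (forall p, f p != 0 -> nrm (x p) <= c) ->
  ninf (\sum_p beta (sqn (f p)) ** iota (x p)) c.
Proof.
(* The bound on [x p] is assumed only where [f p] is nonzero. The other terms vanish, as [beta 0]
   annihilates [D], and may be given the coefficient [0]. *)
move=> f1 c0 xD xc; pose y p := if f p == 0 then 0 else x p.
have D0 : 0 \in D by case: (subalg_submod D).
have yD p : y p \in D by rewrite /y; case: ifP.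
have yc p : nrm (y p) <= c.
  by rewrite /y; case: ifP => [_|/negbT/xc//]; rewrite nrm0.
have -> : \sum_p beta (sqn (f p)) ** iota (x p) =
    \sum_p star (beta (f p)) ** iota (y p) ** beta (f p).
  apply: eq_bigr => p _; rewrite cl_conj // /y; case: eqP => // ->.
  by rewrite /sqn smul0r !cl0.
(* Some finite bound [k] on this uncontrolled sum is enough: it multiplies only the error
   [e y e - y], which is made smaller than [d / (k + 1)]. The main term has weights summing to
   [e n ** e n], of norm at most [1]. *)
have [k k0 hk] := ninf_ex (\sum_p star (beta (f p)) ** beta (f p)).
apply: ninf_lim => d d0; have k1 : 0 < k + 1 by lra.
pose d' := d / (k + 1); have d'0 : 0 < d' by rewrite divr_gt0.
have [n _ /(_ n (leqnn n)) hn] : \forall n \near \oo,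
    forall p, nrm (e n ** y p ** e n - y p) <= d'.
  by apply: filter_forall => p; exact: approx_unit_conj.
have -> : \sum_p star (beta (f p)) ** iota (y p) ** beta (f p) =
   \sum_p star (iota (e n) ** beta (f p)) ** iota (y p) ** (iota (e n) ** beta (f p)) -
   \sum_p star (beta (f p)) ** iota (e n ** y p ** e n - y p) ** beta (f p).
  rewrite -sumrB; apply: eq_bigr => p _.
  rewrite constD constN !constM starM -Ainf_const_star eS !smulE.
  by lmod R[i].
apply: (@ninf_le _ _ _ (c * 1 + d' * k)).
  apply: ninfB; last exact: ninf_conj_sum (ltW d'0) _ hn.
  apply: ninf_conj_sum => //.
  rewrite (eq_bigr (fun p => beta (sqn (f p)) ** iota (e n ** e n))); last first.
    move=> p _; rewrite starM -Ainf_const_star eS constM.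
    rewrite -smulA (smulA (iota _)) -[iota _ ** iota _]constM smulA.
    by rewrite cl_conj // subalgM.
  rewrite cl_partition //; last exact: subalgM.
  apply: ninf_le (ninf_const _) _; apply: le_trans (nrmM _ _) _.
  by rewrite -[leRHS]mulr1 ler_pM ?nrm_ge0.
rewrite mulr1 lerD2l /d' mulrAC ler_pdivrMr //.
by apply: ler_wpM2l; [exact: ltW|rewrite lerDl].
Qed.

Lemma sqnM f h : sqn (f ** h) = sqn f ** sqn h.
Proof.
rewrite /sqn starM (contFunC (star h)) -!smulA; congr (_ ** _).
by rewrite !smulA (contFunC (star h)).
Qed.

Lemma sqn_sumM (P Q : finType) (f : P -> contFun R G) (h : Q -> contFun R G) :
  \sum_p sqn (f p) = cont_one R G -> \sum_q sqn (h q) = cont_one R G ->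
  \sum_(r : P * Q) sqn (f r.1 ** h r.2) = cont_one R G.
Proof.
move=> f1 h1; rewrite -(pair_big xpredT xpredT (fun p q => sqn (f p ** h q))) /=.
rewrite (eq_bigr (fun p => sqn (f p))) // => p _.
rewrite (eq_bigr (fun q => sqn (f p) ** sqn (h q))); last by move=> q _; exact: sqnM.
by rewrite -smul_sumr h1 contFunC contFun1.
Qed.

Lemma central_sum_refine (P Q : finType) (f : P -> contFun R G)
    (h : Q -> contFun R G) (x : P -> A) :
  \sum_q sqn (h q) = cont_one R G -> (forall p, x p \in D) ->
  \sum_p beta (sqn (f p)) ** iota (x p) =
  \sum_(r : P * Q) beta (sqn (f r.1 ** h r.2)) ** iota (x r.1).
Proof.
move=> h1 xD.
rewrite -(pair_big xpredT xpredT (fun p q => beta (sqn (f p ** h q)) ** iota (x p))) /=.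
apply: eq_bigr => p _; rewrite -cl_sum //; congr (beta _ ** _).
rewrite (eq_bigr (fun q => sqn (f p) ** sqn (h q))); last by move=> q _; exact: sqnM.
by rewrite -smul_sumr h1 contFunC contFun1.
Qed.

(* Both sums are rewritten over the common refinement [f_p h_q]. *)
Lemma central_sum_dist (P Q : finType) (f : P -> contFun R G)
    (h : Q -> contFun R G) (x : P -> A) (y : Q -> A) c :
  \sum_p sqn (f p) = cont_one R G -> \sum_q sqn (h q) = cont_one R G ->
  0 <= c -> (forall p, x p \in D) -> (forall q, y q \in D) ->
  (forall p q, f p ** h q != 0 -> nrm (x p - y q) <= c) ->
  ninf (\sum_p beta (sqn (f p)) ** iota (x p) -
        \sum_q beta (sqn (h q)) ** iota (y q)) c.
Proof.
move=> f1 h1 c0 xD yD xyc.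
rewrite (central_sum_refine f h1 xD) (central_sum_refine h f1 yD).
have -> : \sum_(r : Q * P) beta (sqn (h r.1 ** f r.2)) ** iota (y r.1) =
    \sum_(r : P * Q) beta (sqn (f r.1 ** h r.2)) ** iota (y r.2).
  rewrite (sum_swap (fun q p => beta (sqn (h q ** f p)) ** iota (y q))).
  by apply: eq_bigr => r _; rewrite contFunC.
rewrite -sumrB (eq_bigr (fun r : P * Q =>
   beta (sqn (f r.1 ** h r.2)) ** iota (x r.1 - y r.2))); last first.
  by move=> r _; rewrite constD constN smulDr smulNr.
apply: (central_sum_bound (f := fun r : P * Q => f r.1 ** h r.2)) => //.
- exact: sqn_sumM.
- by move=> r; rewrite rpredB.
- by move=> r; exact: xyc.
Qed.

(** Both the product and the sum of products become double sums with weights [|f p f q|^2], with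
    coefficients [x p y q] and [x q y q]. Only pairs with [f p ** f q] nonzero matter, and there
    [x p] is close to [x q]. *)
Lemma central_sum_mul (P : finType) (f : P -> contFun R G) (x y : P -> A) c k :
  \sum_p sqn (f p) = cont_one R G -> 0 <= c -> 0 <= k ->
  (forall p, x p \in D) -> (forall p, y p \in D) -> (forall p, nrm (y p) <= k) ->
  (forall p q, f p ** f q != 0 -> nrm (x p - x q) <= c) ->
  ninf ((\sum_p beta (sqn (f p)) ** iota (x p)) ** (\sum_p beta (sqn (f p)) ** iota (y p)) -
        \sum_p beta (sqn (f p)) ** iota (x p ** y p)) (c * k).
Proof.
move=> f1 c0 k0 xD yD yk xc.
have -> : (\sum_p beta (sqn (f p)) ** iota (x p)) **
    (\sum_p beta (sqn (f p)) ** iota (y p)) =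
    \sum_(r : P * P) beta (sqn (f r.1 ** f r.2)) ** iota (x r.1 ** y r.2).
  rewrite smul_suml -(pair_big xpredT xpredT
    (fun p q => beta (sqn (f p ** f q)) ** iota (x p ** y q))) /=.
  apply: eq_bigr => p _; rewrite smul_sumr; apply: eq_bigr => q _.
  rewrite sqnM (clM cl) ?subalgM // constM !smulA; congr (_ ** _).
  by rewrite -!smulA (clC cl).
have -> : \sum_p beta (sqn (f p)) ** iota (x p ** y p) =
    \sum_(r : P * P) beta (sqn (f r.1 ** f r.2)) ** iota (x r.2 ** y r.2).
  rewrite (central_sum_refine f f1); last by move=> p; exact: subalgM.
  rewrite (sum_swap (fun p q => beta (sqn (f p ** f q)) ** iota (x p ** y p))).
  by apply: eq_bigr => r _; rewrite contFunC.
rewrite -sumrB (eq_bigr (fun r : P * P =>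
   beta (sqn (f r.1 ** f r.2)) ** iota ((x r.1 - x r.2) ** y r.2))); last first.
  by move=> r _; rewrite smulDl smulNl constD constN smulDr smulNr.
apply: (central_sum_bound (f := fun r : P * P => f r.1 ** f r.2)) => //.
- exact: sqn_sumM.
- exact: mulr_ge0.
- by move=> r; rewrite subalgM // rpredB.
- move=> r /xc h; apply: le_trans (nrmM _ _) _.
  by apply: ler_pM; rewrite ?nrm_ge0.
Qed.

Lemma left_transE g f x : val (Defs.left_trans g f) x = val f (g^-1 * x)%g.
Proof. by []. Qed.

Lemma left_trans_sqn g f : Defs.left_trans g (sqn f) = sqn (Defs.left_trans g f).
Proof.
apply: contFun_eq => x.
by rewrite left_transE !contFunM !contFunS left_transE.
Qed.

Lemma act_central_sum (P : finType) (f : P -> contFun R G) (x : P -> A) g :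
  (forall p, x p \in D) ->
  act_Ainf alpha g (\sum_p beta (sqn (f p)) ** iota (x p)) =
  \sum_p beta (sqn (Defs.left_trans g (f p))) ** iota (alpha g (x p)).
Proof.
move=> xD; rewrite act_Ainf_sum; apply: eq_bigr => p _.
rewrite act_AinfM act_Ainf_const (clA cl) ?Dinv //.
by rewrite left_trans_sqn.
Qed.

Lemma left_trans_partition (P : finType) (f : P -> contFun R G) g :
  \sum_p sqn (f p) = cont_one R G ->
  \sum_p sqn (Defs.left_trans g (f p)) = cont_one R G.
Proof.
move=> f1.
have sumE (F : P -> contFun R G) x : val (\sum_p F p) x = \sum_p val (F p) x.
  by elim/big_rec2: _ => // p u v _ <-.
apply: contFun_eq => x; rewrite sumE.
transitivity (val (\sum_p sqn (f p)) (g^-1 * x)%g); last by rewrite f1.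
rewrite sumE; apply: eq_bigr => p _.
by rewrite -left_trans_sqn left_transE.
Qed.

End CentralSums.

(** * Discretised orbits in the sequence algebra and their compressions *)

Section Compression.
Variables (R : realType) (G : topGroupType) (A : cstarAlgType R).
Variable alpha : cstarAction G A.
Implicit Types (a b : A) (g : G).
Local Notation iota := (@Ainf_const R A).

Lemma ninf_act g (x : Ainf A) (c : R) : ninf x c -> ninf (act_Ainf alpha g x) c.
Proof.
move=> [b bx h]; exists (act_linf alpha g b); first by rewrite -act_AinfE bx.
by move=> e /h; apply: filterS => n; rewrite act_linfE nrm_alpha.
Qed.

Lemma contFun_neq0 (f : contFun R G) : f != 0 -> exists g, val f g != 0.
Proof.
move=> f0; apply: contrapT => h; case/eqP: f0.
apply: contFun_eq => g.
by apply: contrapT => fg; apply: h; exists g; apply/eqP.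
Qed.

Variable D : starSubalg A.
Hypothesis Dinv : forall g a, a \in D -> alpha g a \in D.
Variable beta : contFun R G -> Ainf A.
Hypothesis cl : central_lift alpha D beta.
Variable e : nat -> A.
Hypothesis eu : approx_unit e.
Hypothesis e1 : forall n, nrm (e n) <= 1.
Hypothesis eS : forall n, star (e n) = e n.
Hypothesis eD : forall n, e n \in D.
Hypothesis Gc : compact [set: G].

Variables (n : nat) (gamma : 'I_n -> G) (s : 'I_n -> contFun R G).
Variables (L : seq A) (d : R).
Hypothesis LD : forall a, a \in L -> a \in D.
Hypothesis d0 : 0 < d.
Hypothesis s1 : \sum_p sqn (s p) = cont_one R G.
Hypothesis sL : forall p g, val (s p) g != 0 -> forall a, a \in L ->
  nrm (alpha g a - alpha (gamma p) a) <= d.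

Let S a := \sum_p beta (sqn (s p)) ** iota (alpha (gamma p) a).

Let d2 : 0 <= d + d. Proof. by rewrite addr_ge0 // ltW. Qed.

(** At a point [t] where both the translate of [s p] and [s q] are nonzero, the coefficients
    [alpha g (alpha (gamma p) a)] and [alpha (gamma q) a] are each within [d] of [alpha t a]. *)
Lemma act_translate_sum_dist a g : a \in L ->
  ninf (act_Ainf alpha g (S a) - S a) (d + d).
Proof.
move=> aL; have aD p : alpha (gamma p) a \in D by rewrite Dinv // LD.
rewrite /S (act_central_sum cl Dinv) //.
apply: (central_sum_dist cl eu e1 eS eD) => //.
- exact: left_trans_partition.
- by move=> p; exact: Dinv.
- move=> p q /contFun_neq0[t].
  rewrite contFunM left_transE mulf_eq0 negb_or => /andP[sp sq].
  have h1 := sL sp aL; have h2 := sL sq aL.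
  have -> : alpha g (alpha (gamma p) a) - alpha (gamma q) a =
    (alpha t a - alpha (gamma q) a) -
    alpha g (alpha (g^-1 * t)%g a - alpha (gamma p) a).
    by rewrite alphaB -(actM alpha g (g^-1 * t)%g) mulgA mulgV mul1g; lmod R[i].
  by apply: le_trans (nrmB _ _) _; rewrite nrm_alpha lerD.
Qed.

Lemma translate_sum_mul a b (k : R) : a \in L -> b \in L -> nrm b <= k ->
  ninf (S a ** S b - S (a ** b)) ((d + d) * k).
Proof.
move=> aL bL bk.
have aD p : alpha (gamma p) a \in D by rewrite Dinv // LD.
have bD p : alpha (gamma p) b \in D by rewrite Dinv // LD.
have k0 : 0 <= k by exact: le_trans (nrm_ge0 b) bk.
rewrite [S (a ** b)](eq_bigr (fun p => beta (sqn (s p)) **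
    iota (alpha (gamma p) a ** alpha (gamma p) b))); last first.
  by move=> p _; rewrite alphaM.
apply: (central_sum_mul cl eu e1 eS eD) => //.
- by move=> p; rewrite nrm_alpha.
- move=> p q /contFun_neq0[t].
  rewrite contFunM mulf_eq0 negb_or => /andP[sp sq].
  have h1 := sL sp aL; have h2 := sL sq aL.
  have := nrm_triangle (alpha t a) (alpha (gamma p) a) (alpha (gamma q) a).
  by rewrite (nrm_distC (alpha (gamma p) a) (alpha t a)) => *; lra.
Qed.

Lemma translate_sum_fixed a : a \in D -> (forall g, alpha g a = a) -> S a = iota a.
Proof.
move=> aD fa; rewrite /S (eq_bigr (fun p => beta (sqn (s p)) ** iota a)).
  exact: (cl_partition cl).
by move=> p _; rewrite fa.
Qed.

Lemma translate_sum_bound a : a \in D -> ninf (S a) (nrm a).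
Proof.
move=> aD; apply: (central_sum_bound cl eu e1 eS eD) => //.
- exact: nrm_ge0.
- by move=> p; exact: Dinv.
- by move=> p _; rewrite nrm_alpha.
Qed.

Variable v : A.
Hypothesis vD : v \in D.
Hypothesis vS : star v = v.

(** [w p] is a lift of [beta (s p)] multiplied by [v]. As [v] is in [D], the relations of [C(G)]
    become available, and the sum of the [star w ** w] is exactly the constant [v ** v], whose norm
    is known. *)
Lemma compression_lift : exists w : 'I_n -> linf A,
  [/\ forall p, linf_alpha alpha (w p),
    Defs.eta (\sum_p star (w p) ** w p) = iota (v ** v) &
    forall a, a \in D ->
      Defs.eta (\sum_p star (w p) ** linf_const (alpha (gamma p) a) ** w p) =
      \sum_p beta (sqn (s p)) ** iota (v ** alpha (gamma p) a ** v)].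
Proof.
have bex p : exists2 u : linf A, linf_alpha alpha u & Defs.eta u = beta (s p).
  by have [u] := clL cl (s p); exists u.
pose b p := projT1 (cid2 (bex p)).
have b_alpha p : linf_alpha alpha (b p) by rewrite /b; case: cid2.
have bE p : Defs.eta (b p) = beta (s p) by rewrite /b; case: cid2.
exists (fun p => b p ** linf_const v); split=> [p||a aD].
- by apply: linf_alphaM => //; exact: linf_alpha_const.
- rewrite eta_sum -(cl_partition cl s1 (subalgM vD vD)); apply: eq_bigr => p _.
  rewrite !etaM etaS etaM bE -/(iota v) starM -Ainf_const_star vS.
  rewrite -(clCs cl) // -smulA (smulA (iota v)) -(clC cl) // !smulA.
  rewrite -(cl_sqn cl); last exact: subalgM.
  by rewrite constM !smulA.
- rewrite eta_sum; apply: eq_bigr => p _.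
  have cD : alpha (gamma p) a \in D by exact: Dinv.
  rewrite !etaM etaS etaM bE -/(iota v) -/(iota (alpha (gamma p) a)).
  rewrite starM -Ainf_const_star vS -(clCs cl) // (clC cl) //.
  rewrite -(cl_conj cl); last by rewrite !subalgM.
  by rewrite !constM !smulA.
Qed.

End Compression.

(** * Approximate homomorphisms *)

Section Compressions.
Variables (R : realType) (G : topGroupType) (A : cstarAlgType R).
Variable alpha : cstarAction G A.
Hypothesis Asu : sigma_unital A.
Hypothesis Gc : compact [set: G].
Hypothesis G2 : @second_countable G.
Hypothesis aR : Rokhlin alpha.
Implicit Types (a b u : A) (g : G).
Local Notation iota := (@Ainf_const R A).

Lemma sigma_unital_approx_unit : exists e : nat -> A,
  [/\ approx_unit e, forall n, nrm (e n) <= 1 & forall n, star (e n) = e n].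
Proof.
have [e [e1 _ eu]] := Asu; exists e; split=> // n; have [en1 en2] := e1 n.
  by rewrite -lecR -nrmE.
exact: positive_star.
Qed.

Lemma list_bound (L : seq A) : exists2 M : R, 0 <= M & forall a, a \in L -> nrm a <= M.
Proof.
exists (\sum_(a <- L) nrm a); first by apply: sumr_ge0 => a _; exact: nrm_ge0.
move=> a aL; rewrite (big_rem a) //= lerDl; apply: sumr_ge0 => b _.
exact: nrm_ge0.
Qed.

(** [L] has to lie in [D] for the lift to be central against its elements, and the approximate unit
    for the norm estimates on central sums. *)
Lemma invariant_subalg_lift (e : nat -> A) (L : seq A) :
  approx_unit e -> (forall n, nrm (e n) <= 1) ->
  exists (D : starSubalg A) (beta : contFun R G -> Ainf A),
    [/\ forall g a, a \in D -> alpha g a \in D, central_lift alpha D beta,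
      forall n, e n \in D & forall a, a \in L -> a \in D].
Proof.
move=> eu e1.
pose c k := if (k < size L)%N then nth 0 L k else e (k - size L)%N.
have [D [Dc Ds Dinv Dgen]] := separable_invariant_subalg alpha c G2.
have [phi [phom palpha p1 pA]] := aR Dc Ds Dinv.
have [t t0 tl] := averaging_sequence alpha Gc G2.
pose E a := projT1 (cid2 (tl a)).
have tE a : (fun n => avg alpha (t n) a) @ \oo --> E a by rewrite /E; case: cid2.
have Efix a g : alpha g (E a) = E a by rewrite /E; case: cid2.
have [beta cl] := exists_central_lift Gc t0 tE Efix eu e1 Dinv phom palpha p1 pA.
exists D, beta; split=> // [n|a aL].
  by have := Dgen (n + size L)%N; rewrite /c ltnNge leq_addl /= addnK.
by have := Dgen (index a L); rewrite /c index_mem aL nth_index.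
Qed.

(** [S a] is the discretised orbit, for which the estimates hold in [A_infty], and [F a] is a lift
    of its compression, within [d] of it. Each of the finitely many required inequalities then holds
    for large indices, and one common index [k] gives the [w p]. *)
Lemma rokhlin_compression (l : seq A) (eta : R) : 0 < eta ->
  exists n (w : 'I_n -> A) (gamma : 'I_n -> G),
  [/\ nrm (\sum_p star (w p) ** w p) <= 1,
    forall a, a \in l -> forall g,
      nrm (alpha g (conj_sum alpha w gamma a) - conj_sum alpha w gamma a) <= eta,
    forall a b, a \in l -> b \in l -> a ** b \in l ->
      nrm (conj_sum alpha w gamma (a ** b) -
        conj_sum alpha w gamma a ** conj_sum alpha w gamma b) <= eta &
    forall a, a \in l -> (forall g, alpha g a = a) ->
      nrm (conj_sum alpha w gamma a - a) <= eta].
Proof.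
move=> eta0; have [M M0 lM] := list_bound l.
(* The largest accumulated errors are [5 d] for invariance and [3 d + 4 d M] for multiplicativity,
   so [10 (M + 1)] is ample. *)
have C0 : 0 < 10 * (M + 1) by lra.
pose d := Num.min 1 (eta / (10 * (M + 1))).
have d0 : 0 < d by rewrite lt_min ltr01 divr_gt0.
have d1 : d <= 1 by rewrite ge_min lexx.
have dC : d * (10 * (M + 1)) <= eta.
  by rewrite -ler_pdivlMr // ge_min lexx orbT.
have [n [gamma [s [s1 sl]]]] := orbit_partition_of_unity alpha Gc l d0.
have [e [eu e1 eS]] := sigma_unital_approx_unit.
have [D [beta [Dinv cl eD lD]]] := invariant_subalg_lift l eu e1.
(* Scaling by [r] costs at most [d / 2] on elements of norm up to [M], and [r < 1] gives the margin
   with which the norm of the lifted sum falls below [1] exactly. *)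
pose r := 1 - d / (2 * (M + 1)).
have rE : (1 - r) * (2 * (M + 1)) = d by rewrite /r; field; lra.
have r01 : 0 < r < 1 by apply/andP; split; nra.
clearbody r.
have [r0 r1] := andP r01.
have d2 : 0 < d / 2 by rewrite divr_gt0.
have : \forall m \near \oo, forall p a, a \in l ->
    nrm (e m ** alpha (gamma p) a ** e m - alpha (gamma p) a) <= d / 2.
  apply: filter_forall => p; apply: near_all_seq => a _.
  exact: approx_unit_conj.
move=> /filter_ex[m hm].
pose v := (Num.sqrt r)%:C *: e m.
have sr2 : (Num.sqrt r)%:C * (Num.sqrt r)%:C = r%:C :> R[i].
  by rewrite -rmorphM /= -expr2 sqr_sqrtr // ltW.
have vD : v \in D by rewrite rpredZ.
have vS : star v = v by rewrite starZR eS.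
have vv : nrm (v ** v) <= r.
  rewrite smulZl smulZr scalerA sr2 nrmZR gtr0_norm // -[leRHS]mulr1.
  apply: ler_wpM2l; first exact: ltW.
  by apply: le_trans (nrmM _ _) _; rewrite -[leRHS]mulr1 ler_pM ?nrm_ge0.
have vx p a : a \in l ->
    nrm (v ** alpha (gamma p) a ** v - alpha (gamma p) a) <= d.
  move=> al; have aM := lM a al; set x := alpha (gamma p) a.
  have -> : v ** x ** v - x = r%:C *: (e m ** x ** e m - x) - (1 - r)%:C *: x.
    have -> : (1 - r)%:C = 1 - r%:C :> R[i] by rewrite rmorphB rmorph1.
    by rewrite /v !smulZl smulZr scalerA sr2; lmod R[i].
  apply: le_trans (nrmB _ _) _; rewrite !nrmZR !gtr0_norm ?subr_gt0 // nrm_alpha.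
  have h1 : r * nrm (e m ** x ** e m - x) <= d / 2.
    rewrite -[leRHS]mul1r; apply: ler_pM => //; rewrite ?nrm_ge0 ?(ltW r0) ?(ltW r1) //.
    exact: hm.
  have h2 : (1 - r) * nrm a <= d / 2.
    apply: le_trans (_ : (1 - r) * M <= _); first by apply: ler_wpM2l => //; lra.
    nra.
  by lra.
have [w [w_alpha w1 wE]] := compression_lift Dinv cl gamma s1 vD vS.
pose F a : linf A := \sum_p star (w p) ** linf_const (alpha (gamma p) a) ** w p.
pose S a := \sum_p beta (sqn (s p)) ** iota (alpha (gamma p) a).
have Fval a k : val (F a) k = conj_sum alpha (fun p => val (w p) k) gamma a.
  by rewrite /F linf_sumE.
have F_alpha a : linf_alpha alpha (F a).
  apply: linf_alpha_sum => p; apply: linf_alphaM => //; apply: linf_alphaM.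
    exact: linf_alphaS.
  exact: linf_alpha_const.
have FS a : a \in l -> ninf (Defs.eta (F a) - S a) d.
  move=> al; rewrite wE ?lD // -sumrB.
  rewrite (eq_bigr (fun p => beta (sqn (s p)) **
    iota (v ** alpha (gamma p) a ** v - alpha (gamma p) a))); last first.
    by move=> p _; rewrite constD constN smulDr smulNr.
  apply: (central_sum_bound cl eu e1 eS eD) => //; first exact: ltW.
    move=> p; have xD : alpha (gamma p) a \in D by exact/Dinv/lD.
    by apply: rpredB => //; apply: subalgM => //; apply: subalgM.
  by move=> p _; exact: vx.
have Sbound a : a \in l -> ninf (S a) M.
  move=> al; apply: ninf_le (lM a al).
  exact: (translate_sum_bound Dinv cl eu e1 eS eD _ s1 (lD a al)).
have Fbound a : a \in l -> ninf (Defs.eta (F a)) (d + M).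
  by move=> al; rewrite -(subrK (S a) (Defs.eta (F a))); apply: ninfD; auto.
have fix_near a : a \in l -> \forall k \near \oo, forall g,
    nrm (alpha g (val (F a) k) - val (F a) k) <= eta.
  move=> al.
  have h g : ninf (act_Ainf alpha g (Defs.eta (F a)) - Defs.eta (F a)) (d + (d + d) + d).
    have -> : act_Ainf alpha g (Defs.eta (F a)) - Defs.eta (F a) =
       act_Ainf alpha g (Defs.eta (F a) - S a) + (act_Ainf alpha g (S a) - S a) -
       (Defs.eta (F a) - S a).
      have -> : act_Ainf alpha g (Defs.eta (F a) - S a) =
          act_Ainf alpha g (Defs.eta (F a)) - act_Ainf alpha g (S a).
        have := act_AinfP alpha g (-1) (S a) (Defs.eta (F a)).
        by rewrite !scaleN1r addrC => ->; rewrite addrC.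
      by lmod R[i].
    apply: ninfB; last exact: FS.
    apply: ninfD; first by apply: ninf_act; exact: FS.
    exact: (act_translate_sum_dist Dinv cl eu e1 eS eD lD d0 s1 sl).
  apply: filterS (uniform_almost_fixed Gc (F_alpha a) h d0) => k hk g.
  by apply: le_trans (hk g) _; nra.
have mul_near a b : a \in l -> b \in l -> a ** b \in l -> \forall k \near \oo,
    nrm (val (F (a ** b)) k - val (F a) k ** val (F b) k) <= eta.
  move=> al bl abl.
  have h : ninf (Defs.eta (F (a ** b) - F a ** F b))
      (d + (d + d) * M + (d * M + (d + M) * d)).
    have -> : Defs.eta (F (a ** b) - F a ** F b) =
        (Defs.eta (F (a ** b)) - S (a ** b)) - (S a ** S b - S (a ** b)) -
        ((Defs.eta (F a) - S a) ** S b + Defs.eta (F a) ** (Defs.eta (F b) - S b)).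
      by rewrite etaD etaN etaM !smulE; lmod R[i].
    apply: ninfB; [apply: ninfB|apply: ninfD].
    - exact: FS.
    - exact: (translate_sum_mul Dinv cl eu e1 eS eD lD d0 s1 sl) (lM b bl).
    - by apply: ninfM; rewrite ?(ltW d0) //; auto.
    - by apply: ninfM; rewrite ?addr_ge0 ?(ltW d0) //; auto.
  apply: filterS (ninf_eta h d0) => k hk.
  by apply: le_trans hk _; nra.
have id_near a : a \in l -> (forall g, alpha g a = a) -> \forall k \near \oo,
    nrm (val (F a) k - a) <= eta.
  move=> al fa; have := FS a al.
  have -> : S a = iota a.
    exact: (translate_sum_fixed (alpha := alpha) cl gamma s1 (lD a al) fa).
  rewrite /iota -etaN -etaD => /ninf_eta/(_ _ d0); apply: filterS => k hk.
  by apply: le_trans hk _; nra.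
have norm_near : \forall k \near \oo, nrm (\sum_p star (val (w p) k) ** val (w p) k) <= 1.
  have h : ninf (Defs.eta (\sum_p star (w p) ** w p)) r.
    by rewrite w1; apply: ninf_le (ninf_const _) vv.
  have r1' : 0 < 1 - r by rewrite subr_gt0.
  apply: filterS (ninf_eta h r1') => k; rewrite linf_sumE addrCA subrr addr0.
  exact.
have fix_all := near_all_seq (@eventually_filter) fix_near.
have mul_all : \forall k \near \oo, forall a, a \in l -> forall b, b \in l ->
    a ** b \in l -> nrm (val (F (a ** b)) k - val (F a) k ** val (F b) k) <= eta.
  apply: (near_all_seq (P := fun a k => forall b, b \in l -> a ** b \in l ->
    nrm (val (F (a ** b)) k - val (F a) k ** val (F b) k) <= eta)) => a al.
  apply: (near_all_seq (P := fun b k => a ** b \in l ->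
    nrm (val (F (a ** b)) k - val (F a) k ** val (F b) k) <= eta)) => b bl.
  have [abl|nabl] := boolP (a ** b \in l); last exact: nearW.
  by apply: filterS (mul_near a b al bl abl) => k hk _.
have id_all : \forall k \near \oo, forall a, a \in l ->
    (forall g, alpha g a = a) -> nrm (val (F a) k - a) <= eta.
  apply: (near_all_seq (P := fun a k => (forall g, alpha g a = a) ->
    nrm (val (F a) k - a) <= eta)) => a al.
  have [fa|nfa] := pselect (forall g, alpha g a = a); last exact: nearW.
  by apply: filterS (id_near a al fa) => k hk _.
have [k [[k1 k2] [k3 k4]]] := filter_ex
  (filterI (filterI norm_near fix_all) (filterI mul_all id_all)).
exists n, (fun p => val (w p) k), gamma; split => //.
- by move=> a al g; rewrite -!Fval; exact: k2.
- by move=> a b al bl abl; rewrite -!Fval; exact: k3.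
- by move=> a al fa; rewrite -Fval; exact: k4.
Qed.

Lemma unity_star (u : A) : is_unity u -> star u = u.
Proof.
move=> u1; have /(congr1 star) := (u1 (star u)).1.
by rewrite starM !starK (u1 _).1.
Qed.

Lemma alpha_unity g (u : A) : is_unity u -> alpha g u = u.
Proof.
move=> u1; have /(congr1 (alpha g)) := (u1 (alpha g^-1%g u)).1.
by rewrite alphaM !alphaVK (u1 _).2.
Qed.

Lemma unity_nrm_le1 (u : A) : is_unity u -> nrm u <= 1.
Proof.
move=> u1; have := nrm_cstar u; rewrite (unity_star u1) (u1 u).1.
have := nrm_ge0 u; nra.
Qed.

(* If [A] has a unit [u], the summand [q^* a q] with [q^* q = u - sum w^* w] is
   added; it is small because [u] is almost preserved. *)
Lemma unital_rokhlin_compression (l : seq A) (eta : R) : 0 < eta ->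
  exists n (w : 'I_n -> A) (gamma : 'I_n -> G),
  [/\ nrm (\sum_p star (w p) ** w p) <= 1,
    forall a, a \in l -> forall g,
      nrm (alpha g (conj_sum alpha w gamma a) - conj_sum alpha w gamma a) <= eta,
    forall a b, a \in l -> b \in l -> a ** b \in l ->
      nrm (conj_sum alpha w gamma (a ** b) -
        conj_sum alpha w gamma a ** conj_sum alpha w gamma b) <= eta,
    forall a, a \in l -> (forall g, alpha g a = a) ->
      nrm (conj_sum alpha w gamma a - a) <= eta &
    forall u, is_unity u -> conj_sum alpha w gamma u = u].
Proof.
move=> eta0; have [[u u1]|nu] := pselect (exists u : A, is_unity u); last first.
  have [n [w [gamma [h1 h2 h3 h4]]]] := rokhlin_compression l eta0.
  exists n, w, gamma; split=> // u uu; exfalso; apply: nu; by exists u.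
have [M M0 lM] := list_bound l.
pose d := eta / (2 * (M + 1) ^+ 2).
have C0 : 0 < 2 * (M + 1) ^+ 2 by rewrite mulr_gt0 // exprn_gt0 // ltr_wpDl.
have dE : d * (2 * (M + 1) ^+ 2) = eta by rewrite /d divfK // gt_eqF.
have d0 : 0 < d by rewrite divr_gt0.
(* Adding [u] to the list makes [sum star w ** w], the image of [u], close to [u]; this bounds
   [|q|^2] by [d]. *)
have [n [w [gamma [w1 hfix hmul hid]]]] := rokhlin_compression (u :: l) d0.
have lu a : a \in l -> a \in u :: l by rewrite inE orbC => ->.
pose S := \sum_p star (w p) ** w p.
have SE : conj_sum alpha w gamma u = S.
  by apply: eq_bigr => p _; rewrite alpha_unity // (u1 _).2.
have Ss : star S = S.
  by rewrite star_sum; apply: eq_bigr => p _; rewrite starM starK.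
have [q qE] := sub_conj_root u Ss w1.
have qqE : star q ** q = u - S by rewrite qE unity_star // (u1 _).1 (u1 S).2.
have qd : nrm q ^+ 2 <= d.
  rewrite -nrm_cstar qqE nrm_distC -SE; apply: hid; first exact: mem_head.
  by move=> g; exact: alpha_unity.
pose w' p := if unlift ord0 p is Some i then w i else q.
pose gamma' p := if unlift (@ord0 n) p is Some i then gamma i else 1%g.
have phiE a : conj_sum alpha w' gamma' a =
    conj_sum alpha w gamma a + star q ** alpha 1%g a ** q.
  rewrite /conj_sum big_ord_recl /w' /gamma' unlift_none addrC; congr (_ + _).
  by apply: eq_bigr => p _; rewrite liftK.
have S' : \sum_p star (w' p) ** w' p = u.
  rewrite big_ord_recl /w' unlift_none qqE.
  rewrite (eq_bigr (fun p => star (w p) ** w p)); first by rewrite subrK.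
  by move=> p _; rewrite liftK.
have qM a : a \in l -> nrm (star q ** alpha 1%g a ** q) <= d * M.
  move=> al; apply: le_trans (nrmM _ _) _.
  apply: le_trans (ler_wpM2r (nrm_ge0 _) (nrmM _ _)) _.
  rewrite nrmS nrm_alpha mulrAC -expr2.
  by apply: ler_pM; rewrite ?sqr_ge0 ?nrm_ge0 ?lM.
have phiM a : a \in l -> nrm (conj_sum alpha w gamma a) <= M.
  move=> al; apply: le_trans (nrm_conj_sum _ _ _ _) _.
  by rewrite -[leRHS]mulr1 ler_pM ?nrm_ge0 ?lM.
have phiM' a : a \in l -> nrm (conj_sum alpha w' gamma' a) <= M.
  move=> al; apply: le_trans (nrm_conj_sum _ _ _ _) _.
  by rewrite -[leRHS]mulr1 ler_pM ?nrm_ge0 ?lM // S' unity_nrm_le1.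
exists n.+1, w', gamma'; split.
- by rewrite S' unity_nrm_le1.
- move=> a al g; rewrite phiE alphaD.
  set x := conj_sum _ _ _ a; set y := star q ** _ ** _.
  have -> : alpha g x + alpha g y - (x + y) = (alpha g x - x) + alpha g y - y.
    by lmod R[i].
  have := hfix a (lu a al) g; have := qM a al.
  have := nrmB (alpha g x - x + alpha g y) y; have := nrmD (alpha g x - x) (alpha g y).
  by rewrite nrm_alpha -/x -/y => *; nra.
- move=> a b al bl abl; have hb := phiM' b bl; rewrite {1}phiE.
  have -> : conj_sum alpha w gamma (a ** b) + star q ** alpha 1%g (a ** b) ** q -
      conj_sum alpha w' gamma' a ** conj_sum alpha w' gamma' b =
    (conj_sum alpha w gamma (a ** b) -
     conj_sum alpha w gamma a ** conj_sum alpha w gamma b) +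
    star q ** alpha 1%g (a ** b) ** q -
    ((star q ** alpha 1%g a ** q) ** conj_sum alpha w' gamma' b +
     conj_sum alpha w gamma a ** (star q ** alpha 1%g b ** q)).
    by rewrite !phiE !smulE; lmod R[i].
  have h1 := hmul a b (lu a al) (lu b bl) (lu _ abl); have h2 := qM _ abl.
  apply: le_trans (_ : d + d * M + (d * M * M + M * (d * M)) <= _); last by nra.
  apply: le_trans (nrmB _ _) _; apply: lerD.
    by apply: le_trans (nrmD _ _) _; apply: lerD.
  apply: le_trans (nrmD _ _) _; apply: lerD; apply: le_trans (nrmM _ _) _.
    by apply: ler_pM; rewrite ?nrm_ge0 ?qM.
  by apply: ler_pM; rewrite ?nrm_ge0 ?qM ?phiM.
- move=> a al fa; rewrite phiE addrAC.
  have h1 := hid a (lu a al) fa; have h2 := qM a al.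
  by apply: le_trans (nrmD _ _) _; nra.
- move=> v v1; have -> : v = u by rewrite -(u1 v).1 (v1 u).2.
  rewrite -[RHS]S'; apply: eq_bigr => p _.
  by rewrite alpha_unity // (u1 _).2.
Qed.

End Compressions.

Section AlmostHomomorphisms.
Variables (R : realType) (G : topGroupType) (A : cstarAlgType R).
Variable alpha : cstarAction G A.
Hypothesis Asu : sigma_unital A.
Hypothesis Gc : compact [set: G].
Hypothesis G2 : @second_countable G.
Hypothesis aR : Rokhlin alpha.
Implicit Types (a b u : A) (g : G).

Lemma invariant_average : exists (t : nat -> seq G) (E : A -> A),
  [/\ forall n, t n != [::],
    forall a, (fun n => avg alpha (t n) a) @ \oo --> E a &
    forall a g, alpha g (E a) = E a].
Proof.
have [t t0 tl] := averaging_sequence alpha Gc G2.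
exists t, (fun a => projT1 (cid2 (tl a))); split=> // a; by case: cid2.
Qed.

(** [psi] is [E] after the compression. Almost invariance means that [E] moves each relevant value
    by at most [d], so the estimates for the compression survive, and [E] fixes the unit. *)
Lemma almost_homomorphism (l1 l2 : seq A) (eps : R) : 0 < eps ->
  (forall a, a \in l2 -> a \in fixed_subalg alpha) ->
  exists psi : {linear A -> fixed_alg alpha},
  [/\ cpc psi,
    forall a b, a \in l1 -> b \in l1 ->
      nrm (val (psi (a ** b) - psi a ** psi b)) <= eps,
    forall a, a \in l2 -> nrm (val (psi a) - a) <= eps &
    forall u, is_unity u -> val (psi u) = u].
Proof.
move=> eps0 l2F.
have [t [E [t0 tE Efix]]] := invariant_average.
(* The products of [l1] are included because the multiplicative estimate is available only for
   products in the list. *)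
pose l := l1 ++ l2 ++ [seq a ** b | a <- l1, b <- l1].
have [M M0 lM] := list_bound l.
pose d := eps / (2 * (M + 1)).
have C0 : 0 < 2 * (M + 1) by lra.
have dE : d * (2 * (M + 1)) = eps by rewrite /d divfK // gt_eqF.
have d0 : 0 < d by rewrite divr_gt0.
have [n [w [gamma [w1 hfix hmul hid hu]]]] :=
  unital_rokhlin_compression Asu Gc G2 aR l d0.
have [psi pc pE] := averaged_cpc t0 tE Efix gamma w1.
have psid a : a \in l -> nrm (E (conj_sum alpha w gamma a) - conj_sum alpha w gamma a) <= d.
  by move=> al; apply: (lim_avg_dist t0 tE) => g; exact: hfix.
have phiM a : a \in l -> nrm (conj_sum alpha w gamma a) <= M.
  move=> al; apply: le_trans (nrm_conj_sum _ _ _ _) _.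
  by rewrite -[leRHS]mulr1 ler_pM ?nrm_ge0 ?lM.
exists psi; split=> // [a b a1 b1|a a2|u u1].
- have al : a \in l by rewrite mem_cat a1.
  have bl : b \in l by rewrite mem_cat b1.
  have abl : a ** b \in l by rewrite !mem_cat (allpairs_f _ a1 b1) !orbT.
  have -> : val (psi (a ** b) - psi a ** psi b) =
    val (psi (a ** b)) - val (psi a) ** val (psi b) by [].
  rewrite !pE.
  have Ea : nrm (E (conj_sum alpha w gamma a)) <= M.
    by apply: le_trans (nrm_lim_avg t0 tE _) _; exact: phiM.
  have := psid _ al; have := psid _ bl; have := psid _ abl.
  have := hmul a b al bl abl; have := phiM b bl.
  set x := conj_sum _ _ _ a in Ea *; set y := conj_sum _ _ _ b.
  set z := conj_sum _ _ _ (a ** b) => hy hz Ez Ey Ex.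
  have -> : E z - E x ** E y = (E z - z) + (z - x ** y) -
      ((E x - x) ** y + E x ** (E y - y)).
    by rewrite !smulE; lmod R[i].
  apply: le_trans (_ : d + d + (d * M + M * d) <= _); last by nra.
  apply: le_trans (nrmB _ _) _; apply: lerD.
    by apply: le_trans (nrmD _ _) _; apply: lerD.
  apply: le_trans (nrmD _ _) _; apply: lerD; apply: le_trans (nrmM _ _) _.
    by apply: ler_pM; rewrite ?nrm_ge0.
  by apply: ler_pM; rewrite ?nrm_ge0.
- have al : a \in l by rewrite !mem_cat a2 orbT.
  have /fixed_predP fa := l2F a a2.
  rewrite pE; have h1 := psid a al; have h2 := hid a al fa.
  have := nrm_triangle (conj_sum alpha w gamma a) (E (conj_sum alpha w gamma a)) a.
  by move=> *; nra.
- by rewrite pE hu // (lim_avg_fixed t0 tE) // => g; exact: alpha_unity.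
Qed.

Variable psi : {linear A -> fixed_alg alpha}.
Hypothesis pc : cpc psi.

Lemma nrm_cpc a : nrm (val (psi a)) <= nrm a.
Proof. by have [_ /(_ a)] := pc; rewrite !nrmE lecR. Qed.

Lemma nrm_cpcB a b : nrm (val (psi a) - val (psi b)) <= nrm (a - b).
Proof.
have -> : val (psi a) - val (psi b) = val (psi (a - b)) by rewrite raddfB.
exact: nrm_cpc.
Qed.

(** Contractivity of [psi] bounds the change of both [psi (a ** b)] and [psi a ** psi b] by the same
    quantity. It carries estimates from a finite net or a dense sequence to all elements. *)
Lemma defect_mul_near a b a' b' :
  nrm (val (psi (a ** b) - psi a ** psi b)) <=
  nrm (val (psi (a' ** b') - psi a' ** psi b')) +
    2 * (nrm (a - a') * nrm b + nrm a' * nrm (b - b')).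
Proof.
have E x y : val (psi (x ** y) - psi x ** psi y) =
  val (psi (x ** y)) - val (psi x) ** val (psi y) by [].
have le2 (u v x y : A) : nrm (u ** v - x ** y) <= nrm (u - x) * nrm v + nrm x * nrm (v - y).
  have -> : u ** v - x ** y = (u - x) ** v + x ** (v - y) by rewrite !smulE; lmod R[i].
  by apply: le_trans (nrmD _ _) _; apply: lerD; exact: nrmM.
rewrite !E.
set X := val (psi (a ** b)); set X' := val (psi (a' ** b')).
set Y := val _ ** val _; set Y' := val (psi a') ** _.
have -> : X - Y = (X' - Y') + (X - X') - (Y - Y') by lmod R[i].
have h1 : nrm (X - X') <= nrm (a - a') * nrm b + nrm a' * nrm (b - b').
  exact: le_trans (nrm_cpcB _ _) (le2 _ _ _ _).
have h2 : nrm (Y - Y') <= nrm (a - a') * nrm b + nrm a' * nrm (b - b').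
  apply: le_trans (le2 _ _ _ _) _.
  by apply: lerD; apply: ler_pM; rewrite ?nrm_ge0 ?nrm_cpc ?nrm_cpcB.
have := nrmB (X' - Y' + (X - X')) (Y - Y'); have := nrmD (X' - Y') (X - X').
by move=> *; lra.
Qed.

Lemma defect_id_near a a' :
  nrm (val (psi a) - a) <= nrm (val (psi a') - a') + 2 * nrm (a - a').
Proof.
have -> : val (psi a) - a = (val (psi a') - a') + (val (psi a) - val (psi a')) - (a - a').
  by lmod R[i].
apply: le_trans (nrmB _ _) _.
by have := nrmD (val (psi a') - a') (val (psi a) - val (psi a')); have := nrm_cpcB a a' => *; lra.
Qed.

End AlmostHomomorphisms.

(** * Nets in compact sets and dense sequences *)

Section ApproximationSequences.
Variables (R : realType) (A : cstarAlgType R).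

Lemma compact_nrm_net (K : set A) (d : R) : compact K -> 0 < d ->
  exists2 l : seq A, (forall x, x \in l -> K x) &
    forall y, K y -> exists2 x, x \in l & nrm (y - x) <= d.
Proof.
move=> Kc d0; apply: (compact_net (U := fun x y => nrm (y - x) <= d) Kc) => x _.
by apply/nbhs_nrmP; exists d.
Qed.

Lemma compact_nrm_bound (K : set A) : compact K ->
  exists2 M : R, 0 <= M & forall a, K a -> nrm a <= M.
Proof.
move=> Kc; have [l _ lK] := compact_nrm_net Kc ltr01.
have [M M0 lM] := list_bound l; exists (M + 1) => [|a /lK[b bl ab]]; first by lra.
have := lM b bl; have := nrmD b (a - b); rewrite addrC subrK => *; lra.
Qed.

Lemma cvg_norm0 (x : nat -> A) :
  (forall e : R, 0 < e -> \forall n \near \oo, nrm (x n) <= e) ->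
  (fun n => `|x n|) @ \oo --> (0 : R[i]^o).
Proof.
move=> h; have /norm_cvg0P : x @ \oo --> (0 : A).
  apply/cvg_nrmP => e /h; apply: filterS => n; by rewrite subr0.
exact.
Qed.

Lemma dense_sequence : separable_set [set: A] ->
  exists d : nat -> A, forall a (e : R), 0 < e -> exists n, nrm (a - d n) <= e.
Proof.
move=> [S [Sc _ Sd]].
have [f fS] : exists f : nat -> A, forall s, S s -> exists n, f n = s.
  have [r rS] : exists r : A -> nat, {in S &, injective r}.
    by move/countable_injP: Sc => [r rS]; exists r.
  exists (fun n => if pselect (exists2 s, S s & r s = n) is left h then projT1 (cid2 h) else 0).
  move=> s Ss; exists (r s); case: pselect => [h|[]]; last by exists s.
  by case: cid2 => s' S's e /=; apply: rS; rewrite ?inE.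
exists f => a e e0; have [|s [/fS[n <-]]] := Sd a I (fun y => nrm (y - a) <= e).
  by apply/nbhs_nrmP; exists e.
by rewrite nrm_distC; exists n.
Qed.

End ApproximationSequences.

Theorem theorem2p11 (R : realType) (A : cstarAlgType R) (G : topGroupType)
    (alpha : cstarAction G A) :
  sigma_unital A ->
  compact [set: G] -> hausdorff_space G -> @second_countable G ->
  Rokhlin alpha ->
  (forall (F1 F2 : set A) (eps : R),
     compact F1 -> compact F2 -> F2 `<=` [set` fixed_subalg alpha] ->
     0 < eps ->
   exists psi : {linear A -> fixed_alg alpha},
     [/\ cpc psi,
         forall a b, F1 a -> F1 b ->
           `|val (psi (a ** b) - psi a ** psi b)| < eps%:C,
         forall a, F2 a -> `|val (psi a) - a| < eps%:C &
         forall u : A, is_unity u -> val (psi u) = u]) /\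
  (separable_set [set: A] ->
   exists psi : nat -> {linear A -> fixed_alg alpha},
     [/\ forall n, cpc (psi n),
         forall u : A, is_unity u -> forall n, val (psi n u) = u,
         forall a b : A,
           (fun n => `|val (psi n (a ** b) - psi n a ** psi n b)|) @ \oo
             --> (0 : R[i]^o) &
         forall a : A, a \in fixed_subalg alpha ->
           (fun n => `|val (psi n a) - a|) @ \oo --> (0 : R[i]^o)]).
Proof.
move=> Asu Gc _ G2 aR; split=> [F1 F2 eps F1c F2c F2F eps0|Asep].
  have [M M0 MF] := compact_nrm_bound F1c.
  (* The defect at net points is at most [eps / 4], and moving to the net adds at most
     [4 d M <= eps / 2], which leaves the inequality strict. *)
  pose d := eps / (8 * (M + 1)).
  have C0 : 0 < 8 * (M + 1) by lra.
  have dE : d * (8 * (M + 1)) = eps by rewrite /d divfK // gt_eqF.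
  have d0 : 0 < d by rewrite divr_gt0.
  have [l1 l1F l1d] := compact_nrm_net F1c d0.
  have [l2 l2F l2d] := compact_nrm_net F2c d0.
  have [||psi [pc pM p1 pu]] := almost_homomorphism Asu Gc G2 aR l1 (l2 := l2) (eps := eps / 4).
  - by rewrite divr_gt0.
  - by move=> a /l2F /F2F.
  exists psi; split=> // [a b Fa Fb|a Fa]; rewrite nrmE ltcR.
    have [a' a'l aa'] := l1d a Fa; have [b' b'l bb'] := l1d b Fb.
    apply: le_lt_trans (defect_mul_near pc a b a' b') _.
    have h1 := pM a' b' a'l b'l.
    have h2 : nrm (a - a') * nrm b <= d * M by apply: ler_pM; rewrite ?nrm_ge0 ?MF.
    have h3 : nrm a' * nrm (b - b') <= M * d.
      by apply: ler_pM; rewrite ?nrm_ge0 ?MF //; exact: l1F.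
    by nra.
  have [a' a'l aa'] := l2d a Fa.
  apply: le_lt_trans (defect_id_near pc a a') _.
  by have h1 := p1 a' a'l; nra.
have [x xd] := dense_sequence Asep.
have [t [E [t0 tE Efix]]] := invariant_average alpha Gc G2.
(* Stage [n] handles the first [n] members of the dense sequence. For the second estimate they are
   replaced by their averages [E (x i)], which are invariant and still dense in [A^alpha], because
   [E] is contractive and fixes [A^alpha]. *)
have hn n : exists psi : {linear A -> fixed_alg alpha},
  [/\ cpc psi,
    forall a b, a \in mkseq x n -> b \in mkseq x n ->
      nrm (val (psi (a ** b) - psi a ** psi b)) <= n.+1%:R^-1,
    forall a, a \in mkseq (E \o x) n -> nrm (val (psi a) - a) <= n.+1%:R^-1 &
    forall u, is_unity u -> val (psi u) = u].
  apply: (almost_homomorphism Asu Gc G2 aR); first by rewrite invr_gt0.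
  by move=> _ /mapP[i _ ->]; apply/fixed_predP => g; exact: Efix.
have [psi psiP] := boolp.choice hn; exists psi.
have small (e : R) i : 0 < e -> \forall n \near \oo, (i < n)%N /\ n.+1%:R^-1 <= e.
  move=> e0; have [N _ hN] := near_infty_natSinv_lt (PosNum e0).
  exists (maxn i.+1 N) => // n /=; rewrite geq_max => /andP[h1 /hN h2].
  by split=> //; exact: ltW.
split=> [n|u u1 n|a b|a /fixed_predP fa].
- by have [] := psiP n.
- by have [_ _ _] := psiP n; exact.
- apply: cvg_norm0 => e e0.
  have C0 : 0 < 8 * (nrm a + nrm b + e + 1).
    by have := nrm_ge0 a; have := nrm_ge0 b => *; lra.
  pose d := Num.min 1 (e / (8 * (nrm a + nrm b + e + 1))).
  have d0 : 0 < d by rewrite lt_min ltr01 divr_gt0.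
  have d1 : d <= 1 by rewrite ge_min lexx.
  have dC : d * (8 * (nrm a + nrm b + e + 1)) <= e.
    by rewrite -ler_pdivlMr // ge_min lexx orbT.
  have [i ai] := xd a d d0; have [j bj] := xd b d d0.
  have e2 : 0 < e / 2 by rewrite divr_gt0.
  apply: filterS (small (e / 2) (maxn i j) e2) => n [].
  rewrite gtn_max => /andP[ni nj] ne. have [pc pM _ _] := psiP n.
  apply: le_trans (defect_mul_near pc a b (x i) (x j)) _.
  have h1 : nrm (val (psi n (x i ** x j) - psi n (x i) ** psi n (x j))) <= e / 2.
    by apply: le_trans ne; apply: pM; apply: map_f; rewrite mem_iota.
  have h2 : nrm (a - x i) * nrm b <= d * nrm b by apply: ler_wpM2r; rewrite ?nrm_ge0.
  have xi : nrm (x i) <= nrm a + 1.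
    by have := nrmB a (a - x i); rewrite opprB addrC subrK => *; lra.
  have h3 : nrm (x i) * nrm (b - x j) <= (nrm a + 1) * d.
    by apply: ler_pM; rewrite ?nrm_ge0.
  by have := nrm_ge0 a; have := nrm_ge0 b => *; nra.
- apply: cvg_norm0 => e e0.
  have e2 : 0 < e / 2 by rewrite divr_gt0.
  have e4 : 0 < e / 4 by rewrite divr_gt0.
  have [i ai] := xd a _ e4.
  apply: filterS (small (e / 2) i e2) => n [ni ne]. have [pc _ p1 _] := psiP n.
  apply: le_trans (defect_id_near pc a (E (x i))) _.
  have h1 : nrm (val (psi n (E (x i))) - E (x i)) <= e / 2.
    apply: le_trans ne; apply: p1; apply/mapP; exists i => //.
    by rewrite mem_iota.
  (* As [a] is invariant, every translate of [x i] is as close to [a] as [x i] itself. *)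
  have h2 : nrm (a - E (x i)) <= e / 4.
    rewrite nrm_distC; apply: (lim_avg_dist t0 tE) => g.
    by rewrite -(fa g) -alphaB nrm_alpha nrm_distC.
  by lra.
Qed.
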